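(* Let $\Bbbk$ be an algebraically closed field. Every hereditary pointed ($\Bbbk$-linear abelian) finite monoidal category of finite type with a fiber functor is of the form $\operatorname{Rep}Q$, where $Q$ is a finite disjoint union of quivers of $\mathrm{ADE}$ type; that is, it is monoidally equivalent to the category $\operatorname{Rep}Q$ of finite-dimensional representations of such a quiver $Q$, equipped with a suitable monoidal structure for which the forgetful functor to vector spaces is a fiber functor.
   Context: All monoidal categories are $\Bbbk$-linear abelian. Finite: a monoidal category is finite if its underlying category is equivalent to the category of finite-dimensional comodules over a finite-dimensional coalgebra over $\Bbbk$. Finite type: a finite monoidal category is of finite type if it has only finitely many isomorphism classes of indecomposable objects. Pointed: a $\Bbbk$-linear monoidal category is pointed if the isomorphism classes of its simple objects form a monoid under the tensor product (in particular the tensor product of two simple objects is simple and the unit object is simple). Hereditary: an abelian category is hereditary if $\operatorname{Ext}^n(-,-)=0$ for all $n\ge2$. Fiber functor: a $\Bbbk$-linear exact faithful (strong) monoidal functor to the category of finite-dimensional $\Bbbk$-vector spaces. A quiver $Q=(Q_0,Q_1,s,t)$ consists of a set $Q_0$ of vertices, a set $Q_1$ of arrows, and source and target maps $s,t:Q_1\to Q_0$. A representation $V=(V_g,V_a)_{g\in Q_0,a\in Q_1}$ consists of a vector space $V_g$ for each vertex and a linear map $V_a:V_{s(a)}\to V_{t(a)}$ for each arrow; morphisms are families of linear maps $\phi_g:V_g\to W_g$ with $W_a\phi_{s(a)}=\phi_{t(a)}V_a$. The forgetful functor sends $V$ to $\bigoplus_{g\in Q_0}V_g$. A quiver is of ADE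 type if its underlying undirected graph is one of the simply laced Dynkin diagrams $A_n$ ($n\ge1$), $D_n$ ($n\ge4$), $E_6,E_7,E_8$. *)

(* Defs.v *)
From HB Require Import structures.
From mathcomp Require Import all_boot all_order all_algebra.
From Stdlib Require Import Relation_Operators.

Set Implicit Arguments.
Unset Strict Implicit.
Unset Printing Implicit Defensive.

Import GRing.Theory.
Import VectorInternalTheory.

Local Open Scope ring_scope.

Record kCat (k : fieldType) := KCat {
  obj :> Type;
  hom : obj -> obj -> lmodType k;
  idm : forall X, hom X X;
  comp : forall X Y Z, hom Y Z -> hom X Y -> hom X Z;
  compA : forall W X Y Z (h : hom Y Z) (g : hom X Y) (f : hom W X),
    comp h (comp g f) = comp (comp h g) f;
  comp1m : forall X Y (f : hom X Y), comp (idm Y) f = f;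
  compm1 : forall X Y (f : hom X Y), comp f (idm X) = f;
  comp_linl : forall X Y Z (f : hom X Y), linear (fun g : hom Y Z => comp g f);
  comp_linr : forall X Y Z (g : hom Y Z), linear (fun f : hom X Y => comp g f)
}.

Arguments hom {k} {_} X Y.
Arguments idm {k} {_} X.
Arguments comp {k} {_} {X Y Z} g f : rename.

Notation "g \oc f" := (comp g f) (at level 40, left associativity).

Section Category.
Context {k : fieldType} {C : kCat k}.
Implicit Types X Y Z A B : C.

Definition is_iso X Y (f : hom X Y) :=
  exists g : hom Y X, g \oc f = idm X /\ f \oc g = idm Y.

Definition isomorphic X Y := exists f : hom X Y, is_iso f.

Definition mono X Y (f : hom X Y) :=
  forall A (g h : hom A X), f \oc g = f \oc h -> g = h.

Definition epi X Y (f : hom X Y) :=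
  forall A (g h : hom Y A), g \oc f = h \oc f -> g = h.

Definition is_zero X :=
  (forall A (f g : hom X A), f = g) /\ (forall A (f g : hom A X), f = g).

Definition is_biproduct X A B (i : hom A X) (j : hom B X)
    (p : hom X A) (q : hom X B) :=
  [/\ p \oc i = idm A, q \oc j = idm B, p \oc j = 0, q \oc i = 0
    & i \oc p + j \oc q = idm X].

Definition is_direct_sum X A B :=
  exists (i : hom A X) (j : hom B X) (p : hom X A) (q : hom X B),
    is_biproduct i j p q.

Definition is_kernel K X Y (m : hom K X) (f : hom X Y) :=
  f \oc m = 0 /\
  forall A (g : hom A X), f \oc g = 0 ->
    exists! u : hom A K, m \oc u = g.

Definition is_cokernel X Y L (e : hom Y L) (f : hom X Y) :=
  e \oc f = 0 /\
  forall A (g : hom Y A), g \oc f = 0 ->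
    exists! u : hom L A, u \oc e = g.

(* the image of [f] is the kernel of [g] *)
Definition exact_at X Y Z (f : hom X Y) (g : hom Y Z) :=
  exists K (m : hom K Y) (e : hom X K),
    [/\ is_kernel m g, epi e & m \oc e = f].

Definition short_exact X Y Z (f : hom X Y) (g : hom Y Z) :=
  is_kernel f g /\ is_cokernel g f.

Definition simple X :=
  ~ is_zero X /\
  forall A (m : hom A X), mono m -> is_zero A \/ is_iso m.

Definition indecomposable X :=
  ~ is_zero X /\
  forall A B, is_direct_sum X A B -> is_zero A \/ is_zero B.

End Category.

Record abelian (k : fieldType) (C : kCat k) : Prop := Abelian {
  abelian_zero : exists Z : C, is_zero Z;
  abelian_sum : forall A B : C, exists X, is_direct_sum X A B;
  abelian_ker : forall (X Y : C) (f : hom X Y),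
    exists K (m : hom K X), is_kernel m f;
  abelian_coker : forall (X Y : C) (f : hom X Y),
    exists L (e : hom Y L), is_cokernel e f;
  abelian_mono : forall (X Y : C) (f : hom X Y), mono f ->
    exists Z (g : hom Y Z), is_kernel f g;
  abelian_epi : forall (X Y : C) (f : hom X Y), epi f ->
    exists Z (g : hom Z X), is_cokernel f g
}.

Section Ext.
Context {k : fieldType} {C : kCat k}.

(* An exact sequence
     0 -> Y -> E_0 -> E_1 -> ... -> E_(n-1) -> X -> 0,
   for n >= 2.  The objects [yobj i] with n <= i and the maps [ydiff i] with
   n <= i.+1 are unconstrained and play no role. *)
Record yext (n : nat) (X Y : C) := YExt {
  yobj : nat -> C;
  yinj : hom Y (yobj 0%N);
  ydiff : forall i, hom (yobj i) (yobj i.+1);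
  yproj : hom (yobj n.-2.+1) X;
  yinj_mono : mono yinj;
  yexact_first : exact_at yinj (ydiff 0%N);
  yexact_mid : forall i, (i.+2 < n)%N -> exact_at (ydiff i) (ydiff i.+1);
  yexact_last : exact_at (ydiff n.-2) yproj;
  yproj_epi : epi yproj
}.

Definition yext_map n X Y (E E' : yext n X Y) :=
  exists f : forall i, hom (yobj E i) (yobj E' i),
    [/\ f 0%N \oc yinj E = yinj E',
        forall i, (i.+1 < n)%N -> f i.+1 \oc ydiff E i = ydiff E' i \oc f i
      & yproj E' \oc f n.-2.+1 = yproj E].

Definition yext_equiv n X Y : yext n X Y -> yext n X Y -> Prop :=
  clos_refl_sym_trans _ (@yext_map n X Y).

(* For n >= 2, Ext^n(X, Y) is the set of Yoneda classes of n-extensions; it is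
   a group, so it vanishes iff all n-extensions are equivalent. *)
Definition ext_vanishes n (X Y : C) := forall E E' : yext n X Y, yext_equiv E E'.

End Ext.

Definition hereditary (k : fieldType) (C : kCat k) :=
  forall n (X Y : C), (2 <= n)%N -> ext_vanishes n X Y.

Definition finite_type (k : fieldType) (C : kCat k) :=
  exists (n : nat) (E : 'I_n -> C),
    forall X : C, indecomposable X -> exists i, isomorphic X (E i).

Record kFunctor (k : fieldType) (C D : kCat k) := KFunctor {
  fobj :> C -> D;
  fmap : forall X Y : C, hom X Y -> hom (fobj X) (fobj Y);
  fmap1 : forall X, fmap (idm X) = idm (fobj X);
  fmap_comp : forall X Y Z (g : hom Y Z) (f : hom X Y),
    fmap (g \oc f) = fmap g \oc fmap f;
  fmap_lin : forall X Y, linear (@fmap X Y)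
}.

Arguments fmap {k C D} _ {X Y}.

Section Functor.
Context {k : fieldType} {C D : kCat k}.

Definition faithful (F : kFunctor C D) :=
  forall (X Y : C) (f g : hom X Y), fmap F f = fmap F g -> f = g.

Definition exact_functor (F : kFunctor C D) :=
  forall (X Y Z : C) (f : hom X Y) (g : hom Y Z),
    short_exact f g -> short_exact (fmap F f) (fmap F g).

Definition is_equivalence (F : kFunctor C D) :=
  exists G : kFunctor D C,
    (exists eta : forall X : C, hom X (G (F X)),
       (forall X, is_iso (eta X)) /\
       forall X Y (f : hom X Y), eta Y \oc f = fmap G (fmap F f) \oc eta X) /\
    (exists eps : forall X : D, hom (F (G X)) X,
       (forall X, is_iso (eps X)) /\
       forall X Y (f : hom X Y), f \oc eps X = eps Y \oc fmap F (fmap G f)).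

End Functor.

Definition equivalent (k : fieldType) (C D : kCat k) :=
  exists F : kFunctor C D, is_equivalence F.

Record monoidal (k : fieldType) (C : kCat k) := Monoidal {
  unit_ob : C;
  ten : C -> C -> C;
  tenm : forall X X' Y Y' : C,
    hom X X' -> hom Y Y' -> hom (ten X Y) (ten X' Y');
  tenm1 : forall X Y, tenm (idm X) (idm Y) = idm (ten X Y);
  tenm_comp : forall X X' X'' Y Y' Y''
    (f' : hom X' X'') (f : hom X X') (g' : hom Y' Y'') (g : hom Y Y'),
    tenm (f' \oc f) (g' \oc g) = tenm f' g' \oc tenm f g;
  tenm_linl : forall X X' Y Y' (g : hom Y Y'),
    linear (fun f : hom X X' => tenm f g);
  tenm_linr : forall X X' Y Y' (f : hom X X'),
    linear (fun g : hom Y Y' => tenm f g);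
  massoc : forall X Y Z, hom (ten (ten X Y) Z) (ten X (ten Y Z));
  munitl : forall X, hom (ten unit_ob X) X;
  munitr : forall X, hom (ten X unit_ob) X;
  massoc_iso : forall X Y Z, is_iso (massoc X Y Z);
  munitl_iso : forall X, is_iso (munitl X);
  munitr_iso : forall X, is_iso (munitr X);
  massoc_nat : forall X X' Y Y' Z Z'
    (f : hom X X') (g : hom Y Y') (h : hom Z Z'),
    massoc X' Y' Z' \oc tenm (tenm f g) h =
    tenm f (tenm g h) \oc massoc X Y Z;
  munitl_nat : forall X X' (f : hom X X'),
    munitl X' \oc tenm (idm unit_ob) f = f \oc munitl X;
  munitr_nat : forall X X' (f : hom X X'),
    munitr X' \oc tenm f (idm unit_ob) = f \oc munitr X;
  mtriangle : forall X Y,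
    tenm (idm X) (munitl Y) \oc massoc X unit_ob Y = tenm (munitr X) (idm Y);
  mpentagon : forall W X Y Z,
    tenm (idm W) (massoc X Y Z) \oc massoc W (ten X Y) Z
      \oc tenm (massoc W X Y) (idm Z) =
    massoc W X (ten Y Z) \oc massoc (ten W X) Y Z
}.

Arguments unit_ob {k C} m.
Arguments ten {k C} m X Y.
Arguments tenm {k C} m {X X' Y Y'}.
Arguments massoc {k C} m X Y Z.
Arguments munitl {k C} m X.
Arguments munitr {k C} m X.

Section MonoidalFunctor.
Context {k : fieldType} {C D : kCat k}.

Definition strong_monoidal (M : monoidal C) (N : monoidal D)
    (F : kFunctor C D) :=
  exists (phi0 : hom (unit_ob N) (F (unit_ob M)))
         (phi : forall X Y, hom (ten N (F X) (F Y)) (F (ten M X Y))),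
    is_iso phi0 /\ (forall X Y, is_iso (phi X Y)) /\
    (forall X X' Y Y' (f : hom X X') (g : hom Y Y'),
       phi X' Y' \oc tenm N (fmap F f) (fmap F g) =
       fmap F (tenm M f g) \oc phi X Y) /\
    (forall X Y Z,
       fmap F (massoc M X Y Z) \oc phi (ten M X Y) Z
         \oc tenm N (phi X Y) (idm (F Z)) =
       phi X (ten M Y Z) \oc tenm N (idm (F X)) (phi Y Z)
         \oc massoc N (F X) (F Y) (F Z)) /\
    (forall X,
       fmap F (munitl M X) \oc phi (unit_ob M) X
         \oc tenm N phi0 (idm (F X)) = munitl N (F X)) /\
    (forall X,
       fmap F (munitr M X) \oc phi X (unit_ob M)
         \oc tenm N (idm (F X)) phi0 = munitr N (F X)).

Definition monoidally_equivalent (M : monoidal C) (N : monoidal D) :=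
  exists F : kFunctor C D, strong_monoidal M N F /\ is_equivalence F.

End MonoidalFunctor.

Definition pointed (k : fieldType) (C : kCat k) (M : monoidal C) :=
  simple (unit_ob M) /\
  forall X Y : C, simple X -> simple Y -> simple (ten M X Y).

Section VecCat.
Variable k : fieldType.

Lemma vec_compA (W X Y Z : vectType k)
    (h : 'Hom(Y, Z)) (g : 'Hom(X, Y)) (f : 'Hom(W, X)) :
  (h \o (g \o f))%VF = ((h \o g) \o f)%VF.
Proof. exact: comp_lfunA. Qed.

Lemma vec_linl (X Y Z : vectType k) (f : 'Hom(X, Y)) :
  linear (fun g : 'Hom(Y, Z) => (g \o f)%VF).
Proof. by move=> a g h; rewrite comp_lfunDl comp_lfunZl. Qed.

Lemma vec_linr (X Y Z : vectType k) (g : 'Hom(Y, Z)) :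
  linear (fun f : 'Hom(X, Y) => (g \o f)%VF).
Proof. by move=> a f h; rewrite comp_lfunDr comp_lfunZr. Qed.

Definition Vec : kCat k :=
  @KCat k (vectType k) (fun V W => 'Hom(V, W)) (fun V => \1%VF)
    (fun U V W g f => (g \o f)%VF)
    vec_compA (fun V W f => comp_lfun1l f) (fun V W f => comp_lfun1r f)
    vec_linl vec_linr.

End VecCat.

Section Tensor.
Variable k : fieldType.
Implicit Types U V W : vectType k.

(* The tensor product in coordinates: a tensor is the matrix of its
   coefficients on the products of the basis vectors of the two factors. *)
Definition tens V W : vectType k := 'M[k]_(dim V, dim W).

Definition pure V W (v : V) (w : W) : tens V W := (v2r v)^T *m v2r w.

Definition bilin V W U (f : V -> W -> U) :=
  (forall w, linear (f^~ w)) /\ (forall v, linear (f v)).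

Definition tlift_fun V W U (f : V -> W -> U) (A : tens V W) : U :=
  \sum_i \sum_j A i j *: f (r2v (delta_mx 0 i)) (r2v (delta_mx 0 j)).

Fact tlift_fun_linear V W U (f : V -> W -> U) : linear (tlift_fun f).
Proof.
move=> a A B; rewrite /tlift_fun scaler_sumr -big_split /=.
apply: eq_bigr => i _; rewrite scaler_sumr -big_split /=.
by apply: eq_bigr => j _; rewrite !mxE scalerDl scalerA.
Qed.

HB.instance Definition _ V W U (f : V -> W -> U) :=
  GRing.isLinear.Build k (tens V W) U *:%R (tlift_fun f) (tlift_fun_linear f).

(* the linear map [v (x) w |-> f v w] induced by a bilinear map [f] *)
Definition tlift V W U (f : V -> W -> U) : 'Hom(tens V W, U) :=
  linfun (tlift_fun f).

Lemma bilin_suml V W U (f : V -> W -> U) (hf : bilin f)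
    I (r : seq I) (a : I -> k) (v : I -> V) w :
  f (\sum_(i <- r) a i *: v i) w = \sum_(i <- r) a i *: f (v i) w.
Proof.
have f0 : f 0 w = 0.
  have := hf.1 w (-1) 0 0; rewrite scaler0 addr0 => ->.
  by rewrite scaleN1r addNr.
elim: r => [|i r IH]; first by rewrite !big_nil f0.
by rewrite !big_cons (hf.1 w) IH.
Qed.

Lemma bilin_sumr V W U (f : V -> W -> U) (hf : bilin f)
    I (r : seq I) (a : I -> k) v (w : I -> W) :
  f v (\sum_(i <- r) a i *: w i) = \sum_(i <- r) a i *: f v (w i).
Proof.
by apply: (@bilin_suml W V U (fun x y => f y x)); split; [apply: hf.2 | apply: hf.1].
Qed.

Lemma v2r_sum V (v : V) : v = \sum_i v2r v 0 i *: r2v (delta_mx 0 i).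
Proof.
rewrite -[LHS]v2rK {1}(row_sum_delta (v2r v)) linear_sum.
by apply: eq_bigr => i _; rewrite linearZ.
Qed.

Lemma tlift_pure V W U (f : V -> W -> U) (v : V) (w : W) :
  bilin f -> tlift f (pure v w) = f v w.
Proof.
move=> hf; rewrite lfunE /= /tlift_fun.
rewrite [v in RHS]v2r_sum [w in RHS]v2r_sum (bilin_suml hf).
apply: eq_bigr => i _; rewrite (bilin_sumr hf) scaler_sumr.
apply: eq_bigr => j _.
by rewrite scalerA /pure !mxE big_ord1 !mxE.
Qed.

Lemma pure_bilin V W : bilin (@pure V W).
Proof.
split=> [w a x y|v a x y]; rewrite /pure linearP /=.
  by rewrite [(_ + _)^T]linearP /= mulmxDl scalemxAl.
by rewrite mulmxDr scalemxAr.
Qed.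

Lemma tens_ext V W U (f g : 'Hom(tens V W, U)) :
  (forall v w, f (pure v w) = g (pure v w)) -> f = g.
Proof.
move=> fg; apply/lfunP => A; rewrite (matrix_sum_delta A) !linear_sum.
apply: eq_bigr => i _; rewrite !linear_sum; apply: eq_bigr => j _.
rewrite !linearZ /=; congr (_ *: _).
have -> : delta_mx i j =
    pure (r2v (delta_mx 0 i) : V) (r2v (delta_mx 0 j) : W).
  by rewrite /pure !r2vK trmx_delta mul_delta_mx.
exact: fg.
Qed.

Lemma tlift_linear V W U U' (f : V -> U -> W -> U') :
  (forall v w, linear (fun u => f v u w)) ->
  forall x, linear (fun u => tlift (fun v w => f v u w) x).
Proof.
move=> hf x a u u'; rewrite !lfunE /= /tlift_fun scaler_sumr -big_split /=.
apply: eq_bigr => i _; rewrite scaler_sumr -big_split /=.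
by apply: eq_bigr => j _; rewrite hf scalerDr !scalerA mulrC.
Qed.

Definition tmap V V' W W' (f : 'Hom(V, V')) (g : 'Hom(W, W')) :
    'Hom(tens V W, tens V' W') :=
  tlift (fun v w => pure (f v) (g w)).

Lemma tmap_bilin V V' W W' (f : 'Hom(V, V')) (g : 'Hom(W, W')) :
  bilin (fun v w => pure (f v) (g w)).
Proof.
have [hl hr] := @pure_bilin V' W'.
by split=> [w|v] a x y; rewrite linearP; [apply: hl | apply: hr].
Qed.

Lemma tmap_pure V V' W W' (f : 'Hom(V, V')) (g : 'Hom(W, W')) v w :
  tmap f g (pure v w) = pure (f v) (g w).
Proof. exact: tlift_pure (tmap_bilin f g). Qed.

Definition tassoc U V W : 'Hom(tens (tens U V) W, tens U (tens V W)) :=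
  tlift (fun x w => tlift (fun u v => pure u (pure v w)) x).

Definition tassoc_inv U V W : 'Hom(tens U (tens V W), tens (tens U V) W) :=
  tlift (fun u x => tlift (fun v w => pure (pure u v) w) x).

Lemma tassoc_pure U V W (u : U) (v : V) (w : W) :
  tassoc U V W (pure (pure u v) w) = pure u (pure v w).
Proof.
rewrite /tassoc tlift_pure.
  rewrite tlift_pure //; split=> [y|x] a x1 x2.
    exact: (pure_bilin _ _).1.
  by rewrite (pure_bilin V W).1 (pure_bilin U (tens V W)).2.
split=> [y|x]; first exact: linearP.
apply: (@tlift_linear U V W _ (fun u w v => pure u (pure v w))) => u' v' a x1 x2.
by rewrite (pure_bilin V W).2 (pure_bilin U (tens V W)).2.
Qed.

Lemma tassoc_inv_pure U V W (u : U) (v : V) (w : W) :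
  tassoc_inv U V W (pure u (pure v w)) = pure (pure u v) w.
Proof.
rewrite /tassoc_inv tlift_pure.
  rewrite tlift_pure //; split=> [y|x] a x1 x2.
    by rewrite (pure_bilin U V).2 (pure_bilin (tens U V) W).1.
  exact: (pure_bilin _ _).2.
split=> [y|x]; last exact: linearP.
apply: (@tlift_linear V W U _ (fun v u w => pure (pure u v) w)) => u' v' a x1 x2.
by rewrite (pure_bilin U V).1 (pure_bilin (tens U V) W).1.
Qed.

Definition tunitl V : 'Hom(tens k^o V, V) := tlift (fun (a : k^o) v => a *: v).
Definition tunitr V : 'Hom(tens V k^o, V) := tlift (fun v (a : k^o) => a *: v).

Lemma scale_bilinl V : bilin (fun (a : k^o) (v : V) => a *: v).
Proof.
split=> [v a x y|c a x y]; first by rewrite scalerDl scalerA.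
by rewrite scalerDr !scalerA mulrC.
Qed.

Lemma scale_bilinr V : bilin (fun (v : V) (a : k^o) => a *: v).
Proof. by have [h1 h2] := scale_bilinl V; split. Qed.

Lemma tunitl_pure V (a : k^o) (v : V) : tunitl V (pure a v) = a *: v.
Proof. exact: tlift_pure (scale_bilinl V). Qed.

Lemma tunitr_pure V (a : k^o) (v : V) : tunitr V (pure v a) = a *: v.
Proof. exact: tlift_pure (scale_bilinr V). Qed.

Definition purel W V (w : W) (v : V) := pure v w.

Fact purel_linear W V (w : W) : linear (@purel W V w).
Proof. exact: (pure_bilin _ _).1. Qed.
Fact pure_linear V W (v : V) : linear (@pure V W v).
Proof. exact: (pure_bilin _ _).2. Qed.

HB.instance Definition _ V W (v : V) :=
  GRing.isLinear.Build k W (tens V W) *:%R (@pure V W v) (pure_linear v).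
HB.instance Definition _ V W (w : W) :=
  GRing.isLinear.Build k V (tens V W) *:%R (@purel W V w) (purel_linear w).

Lemma tens_ext3l U V W (X : vectType k) (f g : 'Hom(tens (tens U V) W, X)) :
  (forall u v w, f (pure (pure u v) w) = g (pure (pure u v) w)) -> f = g.
Proof.
move=> fg; apply: tens_ext => x w.
suff /lfunP/(_ x) : (f \o linfun (purel w))%VF = (g \o linfun (purel w))%VF.
  by rewrite !comp_lfunE !lfunE.
by apply: tens_ext => u v; rewrite !comp_lfunE !lfunE; apply: fg.
Qed.

Lemma tens_ext3r U V W (X : vectType k) (f g : 'Hom(tens U (tens V W), X)) :
  (forall u v w, f (pure u (pure v w)) = g (pure u (pure v w))) -> f = g.
Proof.
move=> fg; apply: tens_ext => u x.
suff /lfunP/(_ x) : (f \o linfun (pure u))%VF = (g \o linfun (pure u))%VF.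
  by rewrite !comp_lfunE !lfunE.
by apply: tens_ext => v w; rewrite !comp_lfunE !lfunE; apply: fg.
Qed.

Lemma tens_ext4l U V W Y (X : vectType k)
    (f g : 'Hom(tens (tens (tens U V) W) Y, X)) :
  (forall u v w y,
     f (pure (pure (pure u v) w) y) = g (pure (pure (pure u v) w) y)) -> f = g.
Proof.
move=> fg; apply: tens_ext => x y.
suff /lfunP/(_ x) : (f \o linfun (purel y))%VF = (g \o linfun (purel y))%VF.
  by rewrite !comp_lfunE !lfunE.
by apply: tens_ext3l => u v w; rewrite !comp_lfunE !lfunE; apply: fg.
Qed.

Lemma pureZ V W (a : k) (v : V) (w : W) : pure (a *: v) w = pure v (a *: w).
Proof. by rewrite linearZ -[LHS]/(purel w (a *: v)) linearZ. Qed.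

Lemma tunitl_iso V : @is_iso _ (Vec k) _ _ (tunitl V).
Proof.
exists (linfun (pure (1 : k^o))); split; last first.
  apply/lfunP => v; rewrite comp_lfunE [X in tunitl V X]lfunE id_lfunE.
  by rewrite [LHS]tunitl_pure scale1r.
apply: tens_ext => a v /=.
rewrite comp_lfunE tunitl_pure lfunE /= id_lfunE -pureZ.
by congr pure; rewrite /GRing.scale /= mulr1.
Qed.

Lemma tunitr_iso V : @is_iso _ (Vec k) _ _ (tunitr V).
Proof.
exists (linfun (purel (1 : k^o))); split; last first.
  apply/lfunP => v; rewrite comp_lfunE [X in tunitr V X]lfunE id_lfunE.
  by rewrite [LHS]tunitr_pure scale1r.
apply: tens_ext => v a /=.
rewrite comp_lfunE tunitr_pure lfunE /= id_lfunE /purel pureZ.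
by congr pure; rewrite /GRing.scale /= mulr1.
Qed.

Lemma tassoc_iso U V W : @is_iso _ (Vec k) _ _ (tassoc U V W).
Proof.
exists (tassoc_inv U V W); split.
  apply: tens_ext3l => u v w.
  by rewrite comp_lfunE tassoc_pure tassoc_inv_pure id_lfunE.
apply: tens_ext3r => u v w.
by rewrite comp_lfunE tassoc_inv_pure tassoc_pure id_lfunE.
Qed.

Lemma tmap1 V W : tmap \1%VF \1%VF = \1%VF :> 'Hom(tens V W, tens V W).
Proof. by apply: tens_ext => v w; rewrite tmap_pure !id_lfunE. Qed.

Lemma tmap_comp V V' V'' W W' W'' (f' : 'Hom(V', V'')) (f : 'Hom(V, V'))
    (g' : 'Hom(W', W'')) (g : 'Hom(W, W')) :
  tmap (f' \o f) (g' \o g) = (tmap f' g' \o tmap f g)%VF.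
Proof.
by apply: tens_ext => v w; rewrite comp_lfunE !tmap_pure !comp_lfunE.
Qed.

Lemma tmap_linl V V' W W' (g : 'Hom(W, W')) :
  linear (fun f : 'Hom(V, V') => tmap f g).
Proof.
move=> a f f'; apply: tens_ext => v w.
rewrite add_lfunE scale_lfunE !tmap_pure add_lfunE scale_lfunE.
exact: (pure_bilin _ _).1.
Qed.

Lemma tmap_linr V V' W W' (f : 'Hom(V, V')) :
  linear (fun g : 'Hom(W, W') => tmap f g).
Proof.
move=> a g g'; apply: tens_ext => v w.
rewrite add_lfunE scale_lfunE !tmap_pure add_lfunE scale_lfunE.
exact: (pure_bilin _ _).2.
Qed.

Lemma tassoc_nat U U' V V' W W'
    (f : 'Hom(U, U')) (g : 'Hom(V, V')) (h : 'Hom(W, W')) :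
  (tassoc U' V' W' \o tmap (tmap f g) h =
   tmap f (tmap g h) \o tassoc U V W)%VF.
Proof.
apply: tens_ext3l => u v w.
by rewrite !comp_lfunE !tmap_pure !tassoc_pure !tmap_pure.
Qed.

Lemma tunitl_nat V V' (f : 'Hom(V, V')) :
  (tunitl V' \o tmap \1 f = f \o tunitl V)%VF.
Proof.
apply: tens_ext => a v.
by rewrite !comp_lfunE tmap_pure !tunitl_pure id_lfunE linearZ.
Qed.

Lemma tunitr_nat V V' (f : 'Hom(V, V')) :
  (tunitr V' \o tmap f \1 = f \o tunitr V)%VF.
Proof.
apply: tens_ext => v a.
by rewrite !comp_lfunE tmap_pure !tunitr_pure id_lfunE linearZ.
Qed.

Lemma ttriangle V W :
  (tmap \1 (tunitl W) \o tassoc V k^o W = tmap (tunitr V) \1)%VF.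
Proof.
apply: tens_ext3l => v a w.
rewrite comp_lfunE tassoc_pure !tmap_pure tunitl_pure tunitr_pure !id_lfunE.
by rewrite pureZ.
Qed.

Lemma tpentagon U V W X :
  (tmap \1 (tassoc V W X) \o tassoc U (tens V W) X
     \o tmap (tassoc U V W) \1 =
   tassoc U V (tens W X) \o tassoc (tens U V) W X)%VF.
Proof.
apply: tens_ext4l => u v w x.
by rewrite !comp_lfunE !(tmap_pure, tassoc_pure, id_lfunE).
Qed.

Definition VecM : monoidal (Vec k) :=
  @Monoidal k (Vec k) k^o tens tmap tmap1 tmap_comp tmap_linl tmap_linr
    tassoc tunitl tunitr tassoc_iso tunitl_iso tunitr_iso
    tassoc_nat tunitl_nat tunitr_nat ttriangle tpentagon.

End Tensor.

Definition fiber_functor (k : fieldType) (C : kCat k) (M : monoidal C)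
    (F : kFunctor C (Vec k)) :=
  [/\ strong_monoidal M (VecM k) F, exact_functor F & faithful F].

Record coalgebra (k : fieldType) := Coalgebra {
  csp :> vectType k;
  comul : 'Hom(csp, tens csp csp);
  counit : 'Hom(csp, k^o);
  comulA : (tassoc csp csp csp \o tmap comul \1 \o comul =
            tmap \1 comul \o comul)%VF;
  counitl : (tunitl csp \o tmap counit \1 \o comul = \1)%VF;
  counitr : (tunitr csp \o tmap \1 counit \o comul = \1)%VF
}.

Section Comodules.
Context {k : fieldType} (D : coalgebra k).

Record comodule := Comodule {
  cmsp :> vectType k;
  coact : 'Hom(cmsp, tens cmsp D);
  coactA : (tassoc cmsp D D \o tmap coact \1 \o coact =
            tmap \1 (comul D) \o coact)%VF;
  coact1 : (tunitr cmsp \o tmap \1 (counit D) \o coact = \1)%VF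
}.

Section Hom.
Variables V W : comodule.

Definition colinear : pred 'Hom(V, W) := fun f =>
  (coact W \o f == tmap f \1 \o coact V)%VF.

Fact colinear_submod : submod_closed colinear.
Proof.
have l1 := vec_linr (coact W); have l2 := vec_linl (coact V).
have l3 := tmap_linl (\1%VF : 'Hom(D, D)).
split=> [|a f g /eqP cf /eqP cg]; apply/eqP; last by rewrite l1 l3 l2 cf cg.
have := l3 V W (-1) 0 0; rewrite scaler0 addr0 scaleN1r addNr => ->.
by rewrite comp_lfun0r comp_lfun0l.
Qed.

HB.instance Definition _ := GRing.isSubmodClosed.Build k _ colinear colinear_submod.

Record comod_hom := ComodHom { comod_fun :> 'Hom(V, W); _ : colinear comod_fun }.

HB.instance Definition _ := [isSub for comod_fun].
HB.instance Definition _ := [Choice of comod_hom by <:].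
HB.instance Definition _ := [SubChoice_isSubLmodule of comod_hom by <:].

End Hom.

Fact comod_idP V : colinear (\1%VF : 'Hom(cmsp V, cmsp V)).
Proof. by rewrite /colinear tmap1 comp_lfun1l comp_lfun1r. Qed.

Definition comod_id V : comod_hom V V := ComodHom (comod_idP V).

Fact comod_compP U V W (g : comod_hom V W) (f : comod_hom U V) :
  colinear (g \o f : 'Hom(cmsp U, cmsp W))%VF.
Proof.
have /eqP cg : colinear g by case: g.
have /eqP cf : colinear f by case: f.
apply/eqP => /=.
rewrite comp_lfunA cg -comp_lfunA cf comp_lfunA -tmap_comp.
by rewrite comp_lfun1l.
Qed.

Definition comod_comp U V W (g : comod_hom V W) (f : comod_hom U V) :
  comod_hom U W := ComodHom (comod_compP g f).

Fact comod_compA U V W X (h : comod_hom W X) (g : comod_hom V W)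
    (f : comod_hom U V) :
  comod_comp h (comod_comp g f) = comod_comp (comod_comp h g) f.
Proof. by apply: val_inj; apply: comp_lfunA. Qed.
Fact comod_comp1m U V (f : comod_hom U V) : comod_comp (comod_id V) f = f.
Proof. by apply: val_inj; apply: comp_lfun1l. Qed.
Fact comod_compm1 U V (f : comod_hom U V) : comod_comp f (comod_id U) = f.
Proof. by apply: val_inj; apply: comp_lfun1r. Qed.
Fact comod_linl U V W (f : comod_hom U V) :
  linear (fun g : comod_hom V W => comod_comp g f).
Proof. by move=> a g h; apply: val_inj; apply: (vec_linl (comod_fun f)). Qed.
Fact comod_linr U V W (g : comod_hom V W) :
  linear (fun f : comod_hom U V => comod_comp g f).
Proof. by move=> a f h; apply: val_inj; apply: (vec_linr (comod_fun g)). Qed.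

Definition Comod : kCat k :=
  @KCat k comodule (fun V W => comod_hom V W) comod_id comod_comp
    comod_compA comod_comp1m comod_compm1 comod_linl comod_linr.

End Comodules.

Definition finite_category (k : fieldType) (C : kCat k) :=
  exists D : coalgebra k, equivalent C (Comod D).

Section DirectSum.
Variables (k : fieldType) (I : finType) (V : I -> vectType k).

Definition dsum := {dffun forall i, V i}.

HB.instance Definition _ := Choice.on dsum.

Implicit Types f g h : dsum.

Definition dsum_zero : dsum := [ffun i : I => 0 : V i].
Definition dsum_opp f : dsum := [ffun i : I => - f i].
Definition dsum_add f g : dsum := [ffun i : I => f i + g i].
Definition dsum_scale (a : k) f : dsum := [ffun i : I => a *: f i].

Fact dsum_addA : associative dsum_add.
Proof. by move=> f g h; apply/ffunP => i; rewrite !ffunE addrA. Qed.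
Fact dsum_addC : commutative dsum_add.
Proof. by move=> f g; apply/ffunP => i; rewrite !ffunE addrC. Qed.
Fact dsum_add0 : left_id dsum_zero dsum_add.
Proof. by move=> f; apply/ffunP => i; rewrite !ffunE add0r. Qed.
Fact dsum_addN : left_inverse dsum_zero dsum_opp dsum_add.
Proof. by move=> f; apply/ffunP => i; rewrite !ffunE addNr. Qed.

HB.instance Definition _ :=
  GRing.isZmodule.Build dsum dsum_addA dsum_addC dsum_add0 dsum_addN.

Fact dsum_scaleA a b f : dsum_scale a (dsum_scale b f) = dsum_scale (a * b) f.
Proof. by apply/ffunP => i; rewrite !ffunE scalerA. Qed.
Fact dsum_scale1 : left_id 1 dsum_scale.
Proof. by move=> f; apply/ffunP => i; rewrite !ffunE scale1r. Qed.
Fact dsum_scaleDr : right_distributive dsum_scale +%R.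
Proof. by move=> a f g; apply/ffunP => i; rewrite !ffunE scalerDr. Qed.
Fact dsum_scaleDl f : {morph dsum_scale^~ f : a b / a + b}.
Proof. by move=> a b; apply/ffunP => i; rewrite !ffunE scalerDl. Qed.

HB.instance Definition _ := GRing.Zmodule_isLmodule.Build k dsum
  dsum_scaleA dsum_scale1 dsum_scaleDr dsum_scaleDl.

Lemma dsum_addE f g i : (f + g) i = f i + g i.
Proof. by rewrite ffunE. Qed.
Lemma dsum_scaleE a f i : (a *: f) i = a *: f i.
Proof. by rewrite ffunE. Qed.

Let rdim (j : 'I_#|I|) := dim (V (enum_val j)).

Definition dsum_v2r f : 'rV[k]_(\sum_j rdim j) :=
  \mxrow_j v2r (f (enum_val j)).

Definition dsum_r2v (u : 'rV[k]_(\sum_j rdim j)) : dsum :=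
  [ffun i : I => ecast z (V z) (enum_rankK i)
     (@r2v _ (V (enum_val (enum_rank i))) (submxrow u (enum_rank i)))].

Fact dsum_r2v_cast (u : 'rV[k]_(\sum_j rdim j)) j j'
    (e : enum_val j' = enum_val j) :
  ecast z (V z) e (@r2v _ (V (enum_val j')) (submxrow u j')) =
  @r2v _ (V (enum_val j)) (submxrow u j).
Proof.
have jj' := enum_val_inj e; case: _ / jj' e => e.
by rewrite (eq_irrelevance e erefl).
Qed.

Fact dsum_vect_iso : Vector.axiom (\sum_j rdim j) dsum.
Proof.
exists dsum_v2r.
  move=> a f g; apply/matrixP => i j.
  by rewrite !mxE dsum_addE dsum_scaleE linearP !mxE.
exists dsum_r2v => [f|u].
  apply/ffunP => i; rewrite ffunE mxrowK v2rK.
  suff cast_f z (e : z = i) : ecast x (V x) e (f z) = f i by apply: cast_f.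
  by case: _ / e.
apply/mxrowP => j; rewrite mxrowK ffunE.
by rewrite dsum_r2v_cast r2vK.
Qed.
HB.instance Definition _ := Lmodule_hasFinDim.Build k dsum dsum_vect_iso.

End DirectSum.

Record quiver := Quiver {
  vertex : finType;
  arrow : finType;
  src : arrow -> vertex;
  tgt : arrow -> vertex
}.

Arguments src {q}.
Arguments tgt {q}.

Section Representations.
Context {k : fieldType} (Q : quiver).

Record rep := Representation {
  rsp :> vertex Q -> vectType k;
  rmap : forall a : arrow Q, 'Hom(rsp (src a), rsp (tgt a))
}.

Section Hom.
Variables V W : rep.

Definition intertwines : pred (dsum (fun g => 'Hom(V g, W g))) := fun phi =>
  [forall a, rmap W a \o phi (src a) == phi (tgt a) \o rmap V a]%VF.

Fact intertwines_submod : submod_closed intertwines.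
Proof.
split=> [|c f g /forallP cf /forallP cg]; apply/forallP => a; apply/eqP.
  by rewrite !ffunE comp_lfun0r comp_lfun0l.
rewrite !dsum_addE !dsum_scaleE.
have l1 := vec_linr (rmap W a); have l2 := vec_linl (rmap V a).
by rewrite l1 l2 (eqP (cf a)) (eqP (cg a)).
Qed.

HB.instance Definition _ :=
  GRing.isSubmodClosed.Build k _ intertwines intertwines_submod.

Record rep_hom := RepHom {
  rep_fun : dsum (fun g => 'Hom(V g, W g));
  _ : intertwines rep_fun
}.

HB.instance Definition _ := [isSub for rep_fun].
HB.instance Definition _ := [Choice of rep_hom by <:].
HB.instance Definition _ := [SubChoice_isSubLmodule of rep_hom by <:].

Lemma rep_homP (phi : rep_hom) a :
  (rmap W a \o rep_fun phi (src a) = rep_fun phi (tgt a) \o rmap V a)%VF.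
Proof. by case: phi => f /= /forallP/(_ a)/eqP. Qed.

End Hom.

Definition rep_id_fun (V : rep) : dsum (fun g => 'Hom(V g, V g)) :=
  [ffun g : vertex Q => \1%VF : 'Hom(V g, V g)].

Fact rep_idP V : intertwines (rep_id_fun V).
Proof.
by apply/forallP => a; apply/eqP; rewrite !ffunE comp_lfun1r comp_lfun1l.
Qed.

Definition rep_id V : rep_hom V V := RepHom (rep_idP V).

Definition rep_comp_fun (U V W : rep) (psi : rep_hom V W) (phi : rep_hom U V) :
    dsum (fun g => 'Hom(U g, W g)) :=
  [ffun g : vertex Q => (rep_fun psi g \o rep_fun phi g)%VF : 'Hom(U g, W g)].

Fact rep_compP U V W (psi : rep_hom V W) (phi : rep_hom U V) :
  intertwines (rep_comp_fun psi phi).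
Proof.
apply/forallP => a; apply/eqP; rewrite !ffunE.
by rewrite comp_lfunA rep_homP -!comp_lfunA rep_homP.
Qed.

Definition rep_comp U V W (psi : rep_hom V W) (phi : rep_hom U V) :
  rep_hom U W := RepHom (rep_compP psi phi).

Fact rep_compA U V W X (h : rep_hom W X) (g : rep_hom V W) (f : rep_hom U V) :
  rep_comp h (rep_comp g f) = rep_comp (rep_comp h g) f.
Proof. by apply: val_inj; apply/ffunP => i; rewrite !ffunE comp_lfunA. Qed.
Fact rep_comp1m U V (f : rep_hom U V) : rep_comp (rep_id V) f = f.
Proof. by apply: val_inj; apply/ffunP => i; rewrite !ffunE comp_lfun1l. Qed.
Fact rep_compm1 U V (f : rep_hom U V) : rep_comp f (rep_id U) = f.
Proof. by apply: val_inj; apply/ffunP => i; rewrite !ffunE comp_lfun1r. Qed.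
Fact rep_linl U V W (f : rep_hom U V) :
  linear (fun g : rep_hom V W => rep_comp g f).
Proof.
move=> a g h; apply: val_inj; apply/ffunP => i.
by rewrite linearP /= !ffunE comp_lfunDl comp_lfunZl.
Qed.
Fact rep_linr U V W (g : rep_hom V W) :
  linear (fun f : rep_hom U V => rep_comp g f).
Proof.
move=> a f h; apply: val_inj; apply/ffunP => i.
by rewrite linearP /= !ffunE comp_lfunDr comp_lfunZr.
Qed.

Definition Rep : kCat k :=
  @KCat k rep (fun V W => rep_hom V W) rep_id rep_comp
    rep_compA rep_comp1m rep_compm1 rep_linl rep_linr.

Definition rep_total (V : rep) : vectType k := dsum V.

Definition rep_total_fun V W (phi : rep_hom V W) (v : rep_total V) :
    rep_total W :=
  [ffun g : vertex Q => rep_fun phi g (v g) : W g].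

Fact rep_total_fun_linear V W (phi : rep_hom V W) : linear (rep_total_fun phi).
Proof. by move=> a v w; apply/ffunP => g; rewrite !ffunE linearP. Qed.

HB.instance Definition _ V W (phi : rep_hom V W) :=
  GRing.isLinear.Build k (rep_total V) (rep_total W) *:%R (rep_total_fun phi)
    (rep_total_fun_linear phi).

Definition rep_total_map V W (phi : rep_hom V W) :
  'Hom(rep_total V, rep_total W) := linfun (rep_total_fun phi).

Fact rep_total1 V : rep_total_map (rep_id V) = \1%VF.
Proof.
by apply/lfunP => v; rewrite lfunE id_lfunE; apply/ffunP => g;
   rewrite !ffunE id_lfunE.
Qed.

Fact rep_total_comp U V W (psi : rep_hom V W) (phi : rep_hom U V) :
  rep_total_map (rep_comp psi phi) = (rep_total_map psi \o rep_total_map phi)%VF.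
Proof.
by apply/lfunP => v; rewrite comp_lfunE !lfunE; apply/ffunP => g;
   rewrite !ffunE comp_lfunE.
Qed.

Fact rep_total_lin V W : linear (@rep_total_map V W).
Proof.
move=> a f h; apply/lfunP => v; rewrite add_lfunE scale_lfunE !lfunE.
by apply/ffunP => g; rewrite !ffunE add_lfunE scale_lfunE.
Qed.

Definition forgetful : kFunctor Rep (Vec k) :=
  @KFunctor k Rep (Vec k) rep_total rep_total_map
    rep_total1 rep_total_comp rep_total_lin.

End Representations.

Arguments Rep k Q : clear implicits.
Arguments forgetful k Q : clear implicits.

Definition quiver_sum (I : finType) (Q : I -> quiver) : quiver :=
  {| vertex := {i : I & vertex (Q i)} : finType;
     arrow := {i : I & arrow (Q i)} : finType;
     src := fun a => Tagged (fun i => vertex (Q i)) (src (tagged a));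
     tgt := fun a => Tagged (fun i => vertex (Q i)) (tgt (tagged a)) |}.

Variant dynkin :=
  | DynA n of (0 < n)%N
  | DynD n of (3 < n)%N
  | DynE6
  | DynE7
  | DynE8.

Definition dynkin_rank (T : dynkin) : nat :=
  match T with
  | DynA n _ | DynD n _ => n
  | DynE6 => 6
  | DynE7 => 7
  | DynE8 => 8
  end.

(* the path 0 - 1 - ... - (n-2), with the vertex n-1 attached to b *)
Definition branched_edge (n b i j : nat) : bool :=
  ((j == i.+1) && (j < n.-1)%N) || ((i == b) && (j == n.-1)).

Definition dynkin_edge (T : dynkin) : nat -> nat -> bool :=
  match T with
  | DynA _ _ => fun i j => j == i.+1
  | DynD n _ => branched_edge n (n - 3)%N
  | DynE6 => branched_edge 6 2
  | DynE7 => branched_edge 7 2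
  | DynE8 => branched_edge 8 2
  end.

Definition dynkin_adj T i j := dynkin_edge T i j || dynkin_edge T j i.

(* The number of arrows joining two vertices, in either direction, is the
   number of edges (0 or 1) joining the corresponding nodes of the diagram; in
   particular there are no loops. *)
Definition ADE (Q : quiver) :=
  exists (T : dynkin) (sigma : vertex Q -> 'I_(dynkin_rank T)),
    bijective sigma /\
    forall x y : vertex Q,
      #|[set a : arrow Q | ((src a == x) && (tgt a == y))
                        || ((src a == y) && (tgt a == x))]|
      = dynkin_adj T (sigma x) (sigma y).

(* Main.v *)
(* Let F be the fiber functor. The dimension of F on the tensor powers of a simple
   object S is (dim F S)^n, and these powers are simple by pointedness; since
   there are finitely many indecomposables, dim F S = 1. Finite type also bounds
   the objects with a given simple top S_i, and one of maximal dimension is a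
   projective cover P_i. As the category is hereditary, the radical of P_i is a
   sum of P_j's; these summands are the arrows i -> j of a quiver Q. Then
   X |-> (hom (P_i, X))_i is an equivalence with Rep Q, F is the direct sum of the
   functors hom (P_i, _), and the monoidal structure is transported.

   If the Tits form of Q were not positive at a dimension vector d, the finitely
   many orbits of representations of dimension d would each satisfy a polynomial
   equation (count monomials), hence could not fill the representation space over
   an infinite field. A connected quiver with positive Tits form is Dynkin: a
   longest path misses at most one vertex, since otherwise the null root of an
   extended Dynkin diagram contradicts positivity. *)

From HB Require Import structures.
From mathcomp Require Import all_boot all_order all_algebra zify.
From Stdlib Require Import Classical ClassicalEpsilon.
Import GRing.Theory VectorInternalTheory.
Require Import Defs.

Set Implicit Arguments.
Unset Strict Implicit.
Unset Printing Implicit Defensive.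

Local Open Scope ring_scope.

(** * Linear and abelian categories *)

(** Three obstacles shape the argument. [hereditary] is stated with Yoneda classes, so it only
    provides a zigzag of maps of extensions; it is exploited through a property, [lifts], that
    travels along every such map in both directions. Next, hom spaces are a priori mere modules: a
    vector [gen i] of [F (P i)] that survives in the top makes [h |-> F h (gen i)] an embedding of
    [hom (P i) X] into [F X]. This gives finite dimension, and since [F (S i)] is a line,
    [hom (P i) (S i)] is spanned by the projection. Finally, orbit dimensions are replaced by
    counting: in [m] group variables there are at most [(L+1)^(m-1)] monomials of degree [L],
    whereas [N] coordinates have [n^N] monomials with exponents below [n]; if [m <= N], a large [n]
    forces a relation on each orbit. The exponent lost to homogeneity is what makes the inequality
    strict. Arrows strictly lower the dimension of [F (P i)], so induction on this number does the
    work of the path algebra. *)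

Section CompLinear.
Context {k : fieldType} {C : kCat k}.

Definition precomp (X Y Z : C) (f : hom X Y) (g : hom Y Z) := g \oc f.
Definition postcomp (X Y Z : C) (g : hom Y Z) (f : hom X Y) := g \oc f.

HB.instance Definition _ X Y Z (f : hom X Y) :=
  GRing.isLinear.Build k (hom Y Z) (hom X Z) *:%R (@precomp X Y Z f) (comp_linl f).
HB.instance Definition _ X Y Z (g : hom Y Z) :=
  GRing.isLinear.Build k (hom X Y) (hom X Z) *:%R (@postcomp X Y Z g) (comp_linr g).

Implicit Types X Y Z A B : C.

Lemma comp0m X Y Z (f : hom X Y) : (0 : hom Y Z) \oc f = 0.
Proof. exact: (raddf0 (@precomp X Y Z f)). Qed.
Lemma compm0 X Y Z (g : hom Y Z) : g \oc (0 : hom X Y) = 0.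
Proof. exact: (raddf0 (@postcomp X Y Z g)). Qed.
Lemma compDl X Y Z (f : hom X Y) (g h : hom Y Z) : (g + h) \oc f = g \oc f + h \oc f.
Proof. exact: (raddfD (@precomp X Y Z f)). Qed.
Lemma compDr X Y Z (g : hom Y Z) (f h : hom X Y) : g \oc (f + h) = g \oc f + g \oc h.
Proof. exact: (raddfD (@postcomp X Y Z g)). Qed.
Lemma compBl X Y Z (f : hom X Y) (g h : hom Y Z) : (g - h) \oc f = g \oc f - h \oc f.
Proof. exact: (raddfB (@precomp X Y Z f)). Qed.
Lemma compBr X Y Z (g : hom Y Z) (f h : hom X Y) : g \oc (f - h) = g \oc f - g \oc h.
Proof. exact: (raddfB (@postcomp X Y Z g)). Qed.
Lemma compZl X Y Z (f : hom X Y) c (g : hom Y Z) : (c *: g) \oc f = c *: (g \oc f).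
Proof. exact: (linearZ_LR (@precomp X Y Z f)). Qed.
Lemma compZr X Y Z (g : hom Y Z) c (f : hom X Y) : g \oc (c *: f) = c *: (g \oc f).
Proof. exact: (linearZ_LR (@postcomp X Y Z g)). Qed.
Lemma comp_suml X Y Z (f : hom X Y) I (r : seq I) (P : pred I) (g : I -> hom Y Z) :
  (\sum_(i <- r | P i) g i) \oc f = \sum_(i <- r | P i) g i \oc f.
Proof. exact: (raddf_sum (@precomp X Y Z f)). Qed.
Lemma comp_sumr X Y Z (g : hom Y Z) I (r : seq I) (P : pred I) (f : I -> hom X Y) :
  g \oc (\sum_(i <- r | P i) f i) = \sum_(i <- r | P i) g \oc f i.
Proof. exact: (raddf_sum (@postcomp X Y Z g)). Qed.

Lemma mono0 X Y (f : hom X Y) :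
  (forall A (g : hom A X), f \oc g = 0 -> g = 0) -> mono f.
Proof.
by move=> h A g g' e; apply/eqP; rewrite -subr_eq0; apply/eqP/h; rewrite compBr e subrr.
Qed.
Lemma epi0 X Y (f : hom X Y) :
  (forall A (g : hom Y A), g \oc f = 0 -> g = 0) -> epi f.
Proof.
by move=> h A g g' e; apply/eqP; rewrite -subr_eq0; apply/eqP/h; rewrite compBl e subrr.
Qed.
Lemma mono_eq0 X Y (f : hom X Y) A (g : hom A X) : mono f -> f \oc g = 0 -> g = 0.
Proof. by move=> m e; apply: m; rewrite e compm0. Qed.
Lemma epi_eq0 X Y (f : hom X Y) A (g : hom Y A) : epi f -> g \oc f = 0 -> g = 0.
Proof. by move=> m e; apply: m; rewrite e comp0m. Qed.

Lemma kernel_mono K X Y (m : hom K X) (f : hom X Y) : is_kernel m f -> mono m.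
Proof.
case=> e u A g h gh; have [|w [_ wu]] := u A (m \oc h).
  by rewrite compA e comp0m.
by rewrite -(wu g gh) -(wu h erefl).
Qed.
Lemma cokernel_epi X Y L (e : hom Y L) (f : hom X Y) : is_cokernel e f -> epi e.
Proof.
case=> z u A g h gh; have [|w [_ wu]] := u A (h \oc e).
  by rewrite -compA z compm0.
by rewrite -(wu g gh) -(wu h erefl).
Qed.
Lemma kernel_lift K X Y (m : hom K X) (f : hom X Y) A (g : hom A X) :
  is_kernel m f -> f \oc g = 0 -> exists u, m \oc u = g.
Proof. by case=> _ u /u[w [? _]]; exists w. Qed.
Lemma cokernel_lift X Y L (e : hom Y L) (f : hom X Y) A (g : hom Y A) :
  is_cokernel e f -> g \oc f = 0 -> exists u, u \oc e = g.
Proof. by case=> _ u /u[w [? _]]; exists w. Qed.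
Lemma kernelI K X Y (m : hom K X) (f : hom X Y) : mono m -> f \oc m = 0 ->
  (forall A (g : hom A X), f \oc g = 0 -> exists u, m \oc u = g) -> is_kernel m f.
Proof.
move=> mm e l; split=> // A g /l[u eu]; exists u; split=> // v ev.
by apply: mm; rewrite eu ev.
Qed.
Lemma cokernelI X Y L (e : hom Y L) (f : hom X Y) : epi e -> e \oc f = 0 ->
  (forall A (g : hom Y A), g \oc f = 0 -> exists u, u \oc e = g) -> is_cokernel e f.
Proof.
move=> mm z l; split=> // A g /l[u eu]; exists u; split=> // v ev.
by apply: mm; rewrite eu ev.
Qed.

Lemma kernel_of_coker X Y Z L (f : hom X Y) (g : hom Y Z) (e : hom Y L) :
  is_kernel f g -> is_cokernel e f -> is_kernel f e.
Proof.
move=> kf ce; apply: kernelI (kernel_mono kf) ce.1 _ => A h eh.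
have [u ue] := cokernel_lift ce kf.1.
by apply: (kernel_lift kf); rewrite -ue -compA eh compm0.
Qed.
Lemma coker_of_kernel X Y Z K (f : hom Y Z) (g : hom X Y) (m : hom K Y) :
  is_cokernel f g -> is_kernel m f -> is_cokernel f m.
Proof.
move=> cf km; apply: cokernelI (cokernel_epi cf) km.1 _ => A h eh.
have [u ue] := kernel_lift km cf.1.
by apply: (cokernel_lift cf); rewrite -ue compA eh comp0m.
Qed.

Lemma iso_mono X Y (f : hom X Y) : is_iso f -> mono f.
Proof.
case=> g [gf _]; apply: mono0 => A h e.
by rewrite -[h]comp1m -gf -compA e compm0.
Qed.
Lemma iso_epi X Y (f : hom X Y) : is_iso f -> epi f.
Proof.
case=> g [_ fg]; apply: epi0 => A h e.
by rewrite -[h]compm1 -fg compA e comp0m.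
Qed.
Lemma iso_id X : is_iso (idm X).
Proof. by exists (idm X); rewrite comp1m. Qed.
Lemma iso_comp X Y Z (g : hom Y Z) (f : hom X Y) : is_iso g -> is_iso f -> is_iso (g \oc f).
Proof.
case=> g' [a b] [f' [c d]]; exists (f' \oc g'); split.
  by rewrite compA -(compA f') a compm1 c.
by rewrite compA -(compA g) d compm1 b.
Qed.
Lemma isom_sym X Y : isomorphic X Y -> isomorphic Y X.
Proof. by case=> f [g [a b]]; exists g; exists f. Qed.
Lemma isom_trans X Y Z : isomorphic X Y -> isomorphic Y Z -> isomorphic X Z.
Proof. by case=> f hf [g hg]; exists (g \oc f); apply: iso_comp. Qed.

Lemma is_zero_id X : idm X = 0 -> is_zero X.
Proof.
move=> e; split=> A f g.
  by rewrite -[f]compm1 -[g]compm1 e !compm0.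
by rewrite -[f]comp1m -[g]comp1m e !comp0m.
Qed.

Lemma mono_comp_r X Y Z (g : hom Y Z) (f : hom X Y) : mono (g \oc f) -> mono f.
Proof. by move=> h A u v e; apply: h; rewrite -!compA e. Qed.
Lemma epi_comp_l X Y Z (g : hom Y Z) (f : hom X Y) : epi (g \oc f) -> epi g.
Proof. by move=> h A u v e; apply: h; rewrite !compA e. Qed.
Lemma mono_comp X Y Z (g : hom Y Z) (f : hom X Y) : mono g -> mono f -> mono (g \oc f).
Proof. by move=> hg hf A u v e; apply: hf; apply: hg; rewrite !compA. Qed.
Lemma epi_comp X Y Z (g : hom Y Z) (f : hom X Y) : epi g -> epi f -> epi (g \oc f).
Proof. by move=> hg hf A u v e; apply: hg; apply: hf; rewrite -!compA. Qed.

End CompLinear.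

Section Abelian.
Context {k : fieldType} {C : kCat k} (ab : abelian C).
Implicit Types X Y Z A B : C.

Lemma mono_epi_iso X Y (f : hom X Y) : mono f -> epi f -> is_iso f.
Proof.
move=> mf ef; have [Z [g kf]] := abelian_mono ab mf.
have g0 : g = 0 by apply: epi_eq0 ef kf.1.
have [|u fu] := @kernel_lift _ _ _ _ _ _ _ _ (idm Y) kf; first by rewrite g0 comp0m.
by exists u; split=> //; apply: mf; rewrite compA fu comp1m compm1.
Qed.

(** The key is that [i] is mono. If [i g = 0], let [q] be the cokernel of [g]; the epi [q e] is the
    cokernel of some [h], which [f] and hence [e] kill, so [e] factors through [q e]. Thus [q] is
    split mono and [g = 0]. *)
Lemma image_factor K X Y (f : hom X Y) (m : hom K X) : is_kernel m f ->
  exists I (e : hom X I) (i : hom I Y), [/\ is_cokernel e m, mono i & i \oc e = f].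
Proof.
move=> km; have [I [e ce]] := abelian_coker ab m.
have [i ie] := cokernel_lift ce km.1.
exists I, e, i; split=> //; apply: mono0 => A g ig.
have [J [q cq]] := abelian_coker ab g.
have [i' iq] := cokernel_lift cq ig.
have eqe : epi (q \oc e) by apply: epi_comp; [apply: cokernel_epi cq | apply: cokernel_epi ce].
have [Z [h ch]] := abelian_epi ab eqe.
have fh : f \oc h = 0.
  by rewrite -ie -iq -(compA i') -(compA i') ch.1 compm0.
have [h' hh] := kernel_lift km fh.
have eh : e \oc h = 0 by rewrite -hh compA ce.1 comp0m.
have [u ue] := cokernel_lift ch eh.
have uq : u \oc q = idm I.
  by apply: (cokernel_epi ce); rewrite -compA ue comp1m.
by rewrite -[g]comp1m -uq -compA cq.1 compm0.
Qed.

Lemma mono_kernel X Y L (f : hom X Y) (e : hom Y L) : mono f -> is_cokernel e f -> is_kernel f e.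
Proof. by move=> /(abelian_mono ab)[Z [g kg]] ce; apply: kernel_of_coker kg ce. Qed.
Lemma epi_cokernel X Y K (f : hom X Y) (m : hom K X) : epi f -> is_kernel m f -> is_cokernel f m.
Proof. by move=> /(abelian_epi ab)[Z [g kg]] ce; apply: coker_of_kernel kg ce. Qed.

Lemma pullback X Y Z (f : hom X Z) (g : hom Y Z) :
  exists P (a : hom P X) (b : hom P Y), f \oc a = g \oc b /\
    (forall T (s : hom T X) (t : hom T Y), f \oc s = g \oc t ->
       exists u, a \oc u = s /\ b \oc u = t) /\
    (forall T (u v : hom T P), a \oc u = a \oc v -> b \oc u = b \oc v -> u = v) /\
    (epi f -> epi b).
Proof.
have [S [i [j [p [q [pi qj pj qi ij]]]]]] := abelian_sum ab X Y.
have [P [m km]] := abelian_ker ab (f \oc p - g \oc q).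
exists P, (p \oc m), (q \oc m); split; last split; last split.
- by apply/eqP; rewrite -subr_eq0 !compA -compBl km.1.
- move=> T s t e; have [|u mu] := @kernel_lift _ _ _ _ _ _ _ _ (i \oc s + j \oc t) km.
    rewrite compBl !compDr -!compA [p \oc (i \oc s)]compA [p \oc (j \oc t)]compA.
    rewrite [q \oc (i \oc s)]compA [q \oc (j \oc t)]compA pi pj qi qj !comp1m !comp0m.
    by rewrite !compm0 addr0 add0r e subrr.
  exists u; rewrite -!compA mu !compDr !compA pi pj qi qj !comp1m !comp0m.
  by rewrite addr0 add0r.
- move=> T u v eu ev; apply: (kernel_mono km).
  rewrite -[m \oc u]comp1m -[m \oc v]comp1m -ij !compDl -!compA.
  by rewrite [p \oc (m \oc u)]compA [q \oc (m \oc u)]compA eu ev -!compA.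
- move=> ef; set d := f \oc p - g \oc q in km.
  have di : d \oc i = f by rewrite compBl -!compA pi qi compm1 compm0 subr0.
  have ed : epi d by apply: (@epi_comp_l _ _ _ _ _ _ i); rewrite di.
  apply: epi0 => A h hq; rewrite compA in hq.
  have [r rd] := cokernel_lift (epi_cokernel ed km) hq.
  have r0 : r = 0 by apply: (epi_eq0 ef); rewrite -di compA rd -compA qi compm0.
  by rewrite -[h]compm1 -qj compA -rd r0 !comp0m.
Qed.

(** Transport along an equality of indices. Equality on the index type is decidable, so transport
    along a loop is the identity. *)
Definition castm (T : eqType) (A : T -> C) s t (e : s = t) : hom (A s) (A t) :=
  ecast z (hom (A s) (A z)) e (idm (A s)).

Lemma castmK (T : eqType) (A : T -> C) s (e : s = s) : castm A e = idm (A s).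
Proof. by rewrite (eq_irrelevance e erefl). Qed.

(** The predicate [P] lets the families be indexed by all arrows of a quiver while the sum runs over
    those leaving one vertex, which spares a dependent index type. *)
Definition is_dsum (T : finType) (P : pred T) (A : T -> C) X
    (i : forall t, hom (A t) X) (p : forall t, hom X (A t)) :=
  [/\ forall t, P t -> p t \oc i t = idm (A t),
      forall s t, P s -> P t -> s != t -> p s \oc i t = 0
    & \sum_(t | P t) i t \oc p t = idm X].

Lemma dsum_exists (T : finType) (P : pred T) (A : T -> C) :
  exists X (i : forall t, hom (A t) X) (p : forall t, hom X (A t)), is_dsum P i p.
Proof.
suff H (r : seq T) : uniq r ->
  exists X (i : forall t, hom (A t) X) (p : forall t, hom X (A t)),
  [/\ forall t, t \in r -> p t \oc i t = idm (A t),
      forall s t, s \in r -> t \in r -> s != t -> p s \oc i t = 0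
    & \sum_(t <- r) i t \oc p t = idm X].
  have [X [i [p [h1 h2 h3]]]] := H _ (enum_uniq P).
  exists X, i, p; split.
  - by move=> t Pt; apply: h1; rewrite mem_enum.
  - by move=> s t Ps Pt; apply: h2; rewrite mem_enum.
  - by rewrite -h3 big_enum.
elim: r => [_|t r IH /= /andP[tr ur]].
  have [Z zZ] := abelian_zero ab; exists Z, (fun=> 0), (fun=> 0); split=> //.
  by rewrite big_nil; apply: zZ.1.
have [X [i [p [h1 h2 h3]]]] := IH ur.
have [S [j [l [a [b [aj bl al bj jl]]]]]] := abelian_sum ab (A t) X.
pose i' s := if s =P t is ReflectT e then j \oc castm A e else l \oc i s.
pose p' s := if s =P t is ReflectT e then castm A (esym e) \oc a else p s \oc b.
have i't : i' t = j by rewrite /i'; case: eqP => // e; rewrite castmK compm1.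
have p't : p' t = a by rewrite /p'; case: eqP => // e; rewrite castmK comp1m.
have i's s : s != t -> i' s = l \oc i s by rewrite /i'; case: eqP.
have p's s : s != t -> p' s = p s \oc b by rewrite /p'; case: eqP.
have nt s : s \in r -> s != t by move=> sr; apply: contraNneq tr => <-.
exists S, i', p'; split.
- move=> s; rewrite inE; case: (eqVneq s t) => [-> _|st /= sr].
    by rewrite i't p't.
  by rewrite i's ?p's // -compA (compA b) bl comp1m h1.
- move=> s u; rewrite !inE.
  case: (eqVneq s t) => [->|st] /=; case: (eqVneq u t) => [->|ut] //= sr ur' su.
  + by rewrite p't i's // compA al comp0m.
  + by rewrite i't p's // -compA bj compm0.
  + by rewrite i's ?p's // -compA (compA b) bl comp1m h2.
- rewrite big_cons i't p't -jl; congr (_ + _).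
  rewrite -[RHS](congr1 (fun x => x \oc b) (compm1 l)) -h3 comp_sumr comp_suml.
  apply: eq_big_seq => s sr; rewrite i's ?p's ?nt //.
  by rewrite !compA.
Qed.

End Abelian.

(** * Vector spaces, and diagram chases on elements of a fiber functor *)

Section VecCategory.
Variable k : fieldType.
Implicit Types U V W : vectType k.

Definition scale_on V (v : V) (a : k^o) : V := (a : k) *: v.

Fact scale_on_linear V (v : V) : linear (scale_on v).
Proof. by move=> c a b; rewrite /scale_on scalerDl scalerA. Qed.
HB.instance Definition _ V (v : V) :=
  GRing.isLinear.Build k k^o V *:%R (scale_on v) (scale_on_linear v).

(** A vector as a morphism from the ground field: monomorphisms and kernels of [Vec] are tested on
    vectors through it. *)
Definition line_map V (v : V) : 'Hom(k^o, V) := linfun (scale_on v).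

Lemma line_map1 V (v : V) : line_map v 1 = v.
Proof. by rewrite lfunE /= /scale_on scale1r. Qed.

Lemma comp_line_map V W (f : 'Hom(V, W)) v : (f \o line_map v)%VF = line_map (f v).
Proof. by apply/lfunP => a; rewrite comp_lfunE !lfunE /= /scale_on linearZ. Qed.

Lemma line_map0 V : line_map (0 : V) = 0.
Proof. by apply/lfunP => a; rewrite !lfunE /= /scale_on scaler0. Qed.

Lemma vec_mono_inj U V (f : 'Hom(U, V)) : @mono _ (Vec k) U V f -> injective f.
Proof.
move=> m u v e; suff E : line_map u = line_map v by rewrite -(line_map1 u) E line_map1.
by apply: m; rewrite /comp /= !comp_line_map e.
Qed.

Lemma vec_kernel_im U V W (m : 'Hom(U, V)) (f : 'Hom(V, W)) v :
  @is_kernel _ (Vec k) U V W m f -> f v = 0 -> exists u, m u = v.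
Proof.
move=> km fv; have [|w mw] := @kernel_lift _ _ _ _ _ _ _ _ (line_map v : @hom k (Vec k) k^o V) km.
  by rewrite /comp /= comp_line_map fv line_map0.
exists ((w : 'Hom(k^o, U)) 1); rewrite -comp_lfunE.
by move/(congr1 (fun h : 'Hom(k^o, V) => h 1)): mw; rewrite line_map1.
Qed.

Lemma vec_epi_surj U V (f : 'Hom(U, V)) : @epi _ (Vec k) U V f -> forall v, exists u, f u = v.
Proof.
move=> e v; suff /memv_imgP[u _ ->] : v \in limg f by exists u.
(* The projection onto a complement of the image kills [f], so it is zero and the image is
   everything. *)
pose g : 'Hom(V, V) := (\1 - projv (limg f))%VF.
suff g0 : g = 0.
  have : g v = 0 by rewrite g0 lfunE.
  by rewrite /g add_lfunE opp_lfunE id_lfunE => /eqP; rewrite subr_eq0 => /eqP->; apply: memv_proj.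
apply: (@epi_eq0 _ (Vec k) _ _ f _ g e); apply/lfunP => u.
rewrite /comp /= comp_lfunE add_lfunE opp_lfunE !lfunE /= projv_id ?subrr //.
exact: memv_img (memvf u).
Qed.

End VecCategory.

Section Fiber.
Context {k : fieldType} {C : kCat k} (ab : abelian C) (F : kFunctor C (Vec k)).
Hypotheses (Fex : exact_functor F) (Ff : faithful F).
Implicit Types X Y Z A B : C.

Definition el X : vectType k := F X.
Definition ap X Y (f : hom X Y) : 'Hom(el X, el Y) := fmap F f.

Fact ap_lin X Y : linear (@ap X Y).
Proof. exact: (@fmap_lin _ _ _ F X Y). Qed.
HB.instance Definition _ X Y :=
  GRing.isLinear.Build k (hom X Y) 'Hom(el X, el Y) *:%R (@ap X Y) (@ap_lin X Y).

Lemma ap1 X u : ap (idm X) u = u.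
Proof. by rewrite /ap fmap1 [LHS]id_lfunE. Qed.
Lemma ap_comp X Y Z (g : hom Y Z) (f : hom X Y) u : ap (g \oc f) u = ap g (ap f u).
Proof. by rewrite /ap fmap_comp [LHS]comp_lfunE. Qed.
Lemma apD X Y (f g : hom X Y) u : ap (f + g) u = ap f u + ap g u.
Proof. by rewrite linearD /= add_lfunE. Qed.
Lemma apZ X Y c (f : hom X Y) u : ap (c *: f) u = c *: ap f u.
Proof. by rewrite linearZ /= scale_lfunE. Qed.
Lemma ap0 X Y u : ap (0 : hom X Y) u = 0.
Proof. by rewrite linear0 lfunE. Qed.

Lemma ap_inj X Y (f g : hom X Y) : (forall u, ap f u = ap g u) -> f = g.
Proof. by move=> e; apply: Ff; apply/lfunP. Qed.
Lemma ap_eq0 X Y (f : hom X Y) : (forall u, ap f u = 0) -> f = 0.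
Proof. by move=> e; apply: ap_inj => u; rewrite e ap0. Qed.

Lemma ap_short X Y Z (f : hom X Y) (g : hom Y Z) : short_exact f g ->
  [/\ injective (ap f), forall v, exists u, ap g u = v & forall u, ap g u = 0 -> exists w, ap f w = u].
Proof.
move=> /Fex[kf cg]; split.
- exact: vec_mono_inj (kernel_mono kf).
- exact: vec_epi_surj (cokernel_epi cg).
- by move=> u; apply: vec_kernel_im.
Qed.

Lemma mono_inj X Y (f : hom X Y) : mono f -> injective (ap f).
Proof.
move=> mf; have [L [e ce]] := abelian_coker ab f.
by have [] := ap_short (conj (mono_kernel ab mf ce) ce).
Qed.
Lemma inj_mono X Y (f : hom X Y) : injective (ap f) -> mono f.
Proof.
move=> i; apply: mono0 => A g fg; apply: ap_eq0 => u; apply: i.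
by rewrite -ap_comp fg ap0 linear0.
Qed.
Lemma epi_surj X Y (f : hom X Y) : epi f -> forall v, exists u, ap f u = v.
Proof.
move=> ef; have [K [m km]] := abelian_ker ab f.
by have [] := ap_short (conj km (epi_cokernel ab ef km)).
Qed.
Lemma surj_epi X Y (f : hom X Y) : (forall v, exists u, ap f u = v) -> epi f.
Proof.
move=> s; apply: epi0 => A g gf; apply: ap_eq0 => v.
by have [u <-] := s v; rewrite -ap_comp gf ap0.
Qed.
Lemma bij_iso X Y (f : hom X Y) : injective (ap f) -> (forall v, exists u, ap f u = v) -> is_iso f.
Proof. by move=> /inj_mono ? /surj_epi ?; apply: mono_epi_iso. Qed.

(** [exact_functor] speaks of short exact sequences, so [f] is replaced by the epi part of its image
    factorisation; the mono part is injective under [F]. *)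
Lemma kernel_ap K X Y (m : hom K X) (f : hom X Y) u : is_kernel m f -> ap f u = 0 ->
  exists w, ap m w = u.
Proof.
move=> km fu; have [I [e [i [ce mi ie]]]] := image_factor ab km.
have [_ _] := ap_short (conj (kernel_of_coker km ce) ce); apply.
by apply: (mono_inj mi); rewrite -ap_comp ie fu linear0.
Qed.
Lemma cokernel_ap X Y L (f : hom X Y) (e : hom Y L) u : is_cokernel e f -> ap e u = 0 ->
  exists w, ap f w = u.
Proof.
move=> ce eu; have [K [m km]] := abelian_ker ab f.
have [I [e' [i [ce' mi ie]]]] := image_factor ab km.
have ci : is_cokernel e i.
  apply: cokernelI (cokernel_epi ce) _ _ => [|A g gi].
    by apply: (cokernel_epi ce'); rewrite -compA ie ce.1 comp0m.
  by apply: (cokernel_lift ce); rewrite -ie compA gi comp0m.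
have [_ _ /(_ u eu)[w iw]] := ap_short (conj (mono_kernel ab mi ci) ci).
have [v ev] := epi_surj (cokernel_epi ce') w.
by exists v; rewrite -ie ap_comp ev.
Qed.

(** Additive on short exact sequences and zero only at zero objects, this plays the role of length
    in the later inductions. *)
Definition dm X : nat := \dim (fullv : {vspace el X}).

Lemma mono_dim X Y (f : hom X Y) : mono f -> (dm X <= dm Y)%N.
Proof.
move=> /mono_inj/lker0P/eqP i; rewrite /dm.
by rewrite -(limg_dim_eq (f := ap f)) ?i ?capv0 ?dimvS ?subvf.
Qed.
Lemma mono_dim_iso X Y (f : hom X Y) : mono f -> (dm Y <= dm X)%N -> is_iso f.
Proof.
move=> mf le; apply: bij_iso (mono_inj mf) _ => v.
suff /memv_imgP[u _ ->] : v \in limg (ap f) by exists u.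
have /lker0P/eqP i := mono_inj mf.
have := limg_dim_eq (f := ap f) (U := fullv); rewrite i capv0 => /(_ erefl) d.
suff /eqP-> : limg (ap f) == fullv by apply: memvf.
by rewrite eqEdim subvf d.
Qed.
Lemma epi_dim X Y (f : hom X Y) : epi f -> (dm Y <= dm X)%N.
Proof.
move=> /epi_surj s; rewrite /dm; suff <- : limg (ap f) = fullv.
  by rewrite -(limg_ker_dim (ap f) fullv) leq_addl.
by apply/vspaceP => v; rewrite memvf; have [u <-] := s v; rewrite memv_img ?memvf.
Qed.
Lemma epi_dim_iso X Y (f : hom X Y) : epi f -> (dm X <= dm Y)%N -> is_iso f.
Proof.
move=> ef le; apply: bij_iso (epi_surj ef); apply/lker0P.
rewrite -dimv_eq0 -leqn0.
have := limg_ker_dim (ap f) fullv; rewrite capfv => e.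
have sf : limg (ap f) = fullv.
  by apply/vspaceP => v; rewrite memvf; have [u <-] := epi_surj ef v; rewrite memv_img ?memvf.
by move: e le; rewrite sf /dm => <-; rewrite -{2}[\dim fullv]add0n leq_add2r.
Qed.
Lemma iso_dim X Y (f : hom X Y) : is_iso f -> dm X = dm Y.
Proof.
by move=> i; apply/eqP; rewrite eqn_leq (mono_dim (iso_mono i)) (epi_dim (iso_epi i)).
Qed.
Lemma isom_dim X Y : isomorphic X Y -> dm X = dm Y.
Proof. by case=> f; apply: iso_dim. Qed.

Lemma dm0 X : dm X = 0%N -> is_zero X.
Proof.
move/eqP; rewrite /dm dimv_eq0 => /eqP z; apply: is_zero_id; apply: ap_eq0 => u.
by apply/eqP; rewrite -memv0 -z memvf.
Qed.
Lemma dm_gt0 X : ~ is_zero X -> (0 < dm X)%N.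
Proof. by move=> nz; rewrite lt0n; apply/eqP => /dm0. Qed.

Lemma cokernel_dim X Y L (f : hom X Y) (e : hom Y L) : mono f -> is_cokernel e f ->
  dm Y = (dm X + dm L)%N.
Proof.
move=> mf ce; have := limg_ker_dim (ap e) fullv; rewrite capfv.
have -> : limg (ap e) = fullv.
  apply/vspaceP => v; rewrite memvf.
  by have [u <-] := epi_surj (cokernel_epi ce) v; rewrite memv_img ?memvf.
have -> : lker (ap e) = limg (ap f).
  apply/vspaceP => v; apply/idP/idP.
    by rewrite memv_ker => /eqP/(cokernel_ap ce)[w <-]; rewrite memv_img ?memvf.
  by case/memv_imgP=> w _ ->; rewrite memv_ker -ap_comp ce.1 ap0.
have /lker0P/eqP i := mono_inj mf.
by rewrite limg_dim_eq /dm ?i ?capv0 // => ->.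
Qed.

Lemma sum_dim X A B : is_direct_sum X A B -> dm X = (dm A + dm B)%N.
Proof.
case=> i [j [p [q [pi qj pj qi ij]]]]; apply: (@cokernel_dim _ _ _ i q).
  by apply: (@mono_comp_r _ _ _ _ _ p); rewrite pi; apply: iso_mono (iso_id _).
have eq : epi q by apply: (@epi_comp_l _ _ _ _ _ _ j); rewrite qj; apply: iso_epi (iso_id _).
apply: cokernelI eq qi _ => T g gi; exists (g \oc j).
by rewrite -[RHS]compm1 -ij compDr !compA gi comp0m add0r.
Qed.

End Fiber.

(** * Simple and projective objects *)

Lemma ex_min_nat (P : nat -> Prop) : (exists n, P n) ->
  exists n, P n /\ forall m, P m -> (n <= m)%N.
Proof.
case=> n; elim/ltn_ind: n => n IH Pn.
case: (classic (exists2 m, (m < n)%N & P m)) => [[m mn Pm]|h]; first exact: IH Pm.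
by exists n; split=> // m Pm; rewrite leqNgt; apply/negP => mn; case: h; exists m.
Qed.

Lemma ex_max_nat (P : nat -> Prop) B : (exists n, P n) -> (forall n, P n -> (n <= B)%N) ->
  exists n, P n /\ forall m, P m -> (m <= n)%N.
Proof.
case=> n Pn hB; have [|d [[Pd dB] hd]] := @ex_min_nat (fun d => P (B - d)%N /\ (d <= B)%N).
  by exists (B - n)%N; rewrite subKn ?leq_subr ?hB.
exists (B - d)%N; split=> // m Pm.
have mB := hB m Pm; have : (d <= B - m)%N by apply: hd; rewrite subKn ?leq_subr.
by rewrite !leq_subRL // addnC.
Qed.

Section Schur.
Context {k : fieldType} {C : kCat k} (ab : abelian C).
Implicit Types X Y Z A B : C.

Lemma simple_mono X Y (f : hom X Y) : simple X -> f <> 0 -> mono f.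
Proof.
move=> [_ sX] f0; have [K [m km]] := abelian_ker ab f.
apply: mono0 => A g fg; have [u <-] := kernel_lift km fg.
case: (sX _ _ (kernel_mono km)) => [z|[m' [_ mm]]]; first by rewrite (z.2 _ u 0) compm0.
by case: f0; rewrite -[f]compm1 -mm compA km.1 comp0m.
Qed.

Lemma simple_epi X Y (f : hom X Y) : simple Y -> f <> 0 -> epi f.
Proof.
move=> [_ sY] f0; have [K [m km]] := abelian_ker ab f.
have [I [e [i [ce mi ie]]]] := image_factor ab km.
rewrite -ie; case: (sY _ _ mi) => [z|ii].
  by case: f0; rewrite -ie (z.2 _ e 0) compm0.
exact: epi_comp (iso_epi ii) (cokernel_epi ce).
Qed.

Lemma schur X Y (f : hom X Y) : simple X -> simple Y -> f <> 0 -> is_iso f.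
Proof. by move=> sX sY f0; apply: (mono_epi_iso ab); [apply: simple_mono | apply: simple_epi]. Qed.

Lemma simple_isom X Y : simple X -> isomorphic X Y -> simple Y.
Proof.
move=> [nz sX] [f fi]; have [g [gf fg]] := fi; split.
  move=> z; case: nz; apply: is_zero_id.
  by rewrite -gf (z.2 _ f 0) compm0.
move=> A m mm; case: (sX A (g \oc m)).
- by apply: mono_comp mm; apply: iso_mono; exists f.
- by left.
- by move=> i; right; rewrite -[m]comp1m -fg -compA; apply: iso_comp.
Qed.

Lemma simple_indecomposable X : simple X -> indecomposable X.
Proof.
move=> [nz sX]; split=> // A B [i [j [p [q [pi qj pj qi ij]]]]].
have mi : mono i.
  by apply: (@mono_comp_r _ _ _ _ _ p); rewrite pi; apply: iso_mono (iso_id _).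
case: (sX _ i mi) => [z|ii]; [by left | right].
 apply: is_zero_id; rewrite -qj.
by rewrite (epi_eq0 (iso_epi ii) qi) comp0m.
Qed.

End Schur.

Definition projective (k : fieldType) (C : kCat k) (P : C) :=
  forall (V W : C) (e : hom V W) (h : hom P W), epi e -> exists l, e \oc l = h.

(* The last clause says that the kernel of [t] is the unique maximal subobject
   of [P]. *)
Definition local_over (k : fieldType) (C : kCat k) (P S : C) (t : hom P S) :=
  [/\ simple S, t <> 0 & forall A (f : hom A P), t \oc f <> 0 -> epi f].

Section Projectives.
Context {k : fieldType} {C : kCat k} (ab : abelian C) (F : kFunctor C (Vec k)).
Hypotheses (Fex : exact_functor F) (Ff : faithful F).
Implicit Types X Y Z A B K P S : C.
Local Notation dm := (dm F).

(** A nonzero quotient [S] of least dimension is simple: for a proper subobject [A], the cokernel is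
    again a nonzero quotient, so it is as large as [S] and [A] is zero. *)
Lemma exists_simple_quotient X : ~ is_zero X -> exists S (e : hom X S), simple S /\ epi e.
Proof.
move=> nz; have [|n [[S [e [ee [nS dS]]]] hn]] := @ex_min_nat
  (fun n => exists S (e : hom X S), epi e /\ ~ is_zero S /\ dm S = n).
  by exists (dm X), X, (idm X); split=> //; apply: iso_epi (iso_id _).
exists S, e; split=> //; split=> // A m mm.
have [L [c cc]] := abelian_coker ab m.
case: (classic (is_zero L)) => [zL|nL].
  right; apply: (mono_epi_iso ab mm); apply: epi0 => T g gm.
  by have [u <-] := cokernel_lift cc gm; rewrite (zL.1 _ u 0) comp0m.
left; apply: (dm0 Ff); have : (dm S <= dm L)%N.
  rewrite dS; apply: hn; exists L, (c \oc e); split=> //.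
  by apply: epi_comp => //; apply: cokernel_epi cc.
by rewrite (cokernel_dim ab Fex mm cc) -{2}[dm L]add0n leq_add2r leqn0 => /eqP.
Qed.

Lemma exists_simple_sub X : ~ is_zero X -> exists S (e : hom S X), simple S /\ mono e.
Proof.
move=> nz; have [|n [[S [e [ee [nS dS]]]] hn]] := @ex_min_nat
  (fun n => exists S (e : hom S X), mono e /\ ~ is_zero S /\ dm S = n).
  by exists (dm X), X, (idm X); split=> //; apply: iso_mono (iso_id _).
exists S, e; split=> //; split=> // A m mm.
case: (classic (is_zero A)) => [|nA]; [by left | right].
apply: (mono_dim_iso ab Fex Ff mm); rewrite dS; apply: hn.
by exists A, (e \oc m); split=> //; apply: mono_comp.
Qed.

(** [t] is nonzero on one of the two summands; the inclusion of that summand is then epi, and the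
    projection to the other summand vanishes. *)
Lemma local_indecomposable P S (t : hom P S) : local_over t -> indecomposable P.
Proof.
move=> [sS t0 lt]; split=> [z|A B [i [j [p [q [pi qj pj qi ij]]]]]].
  by apply: t0; apply: z.1.
case: (classic (t \oc i = 0)) => [ti|/lt ei]; last first.
  by right; apply: is_zero_id; rewrite -qj (epi_eq0 ei qi) comp0m.
left; apply: is_zero_id; rewrite -pi.
suff /lt ej : t \oc j <> 0 by rewrite (epi_eq0 ej pj) comp0m.
by move=> tj; apply: t0; rewrite -[t]compm1 -ij compDr !compA ti tj !comp0m addr0.
Qed.

Lemma indecomposable_bounded : finite_type C ->
  exists b : nat, forall X, indecomposable X -> (dm X <= b)%N.
Proof.
case=> n [E hE]; exists (\max_(i < n) dm (E i))%N => X /hE[i /(isom_dim ab Fex)->].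
exact: (leq_bigmax i).
Qed.

(* A local object over [S] of maximal dimension is projective: a minimal
   subobject of a pullback mapping onto it is again local over [S]. *)
Lemma projective_cover S : finite_type C -> simple S ->
  exists P (t : hom P S), local_over t /\ projective P.
Proof.
move=> /indecomposable_bounded[bd hb] sS.
have [||n [[P [t [lt dP]]] hP]] := @ex_max_nat
  (fun n => exists P (t : hom P S), local_over t /\ dm P = n) bd.
- exists (dm S), S, (idm S); split=> //; split=> //.
    by move=> e; apply: sS.1; apply: is_zero_id.
  by move=> A f; rewrite comp1m; apply: (simple_epi ab).
- by move=> n [P [t [lt <-]]]; apply: hb; apply: local_indecomposable lt.
exists P, t; split=> // V W e h ee.
have [X [a [b [eab [_ [_ /(_ ee) eb]]]]]] := pullback ab e h.
have [|d [[X' [m [tbm dX']]] hd]] := @ex_min_nat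
  (fun n => exists X' (m : hom X' X), t \oc b \oc m <> 0 /\ dm X' = n).
  exists (dm X), X, (idm X); split=> //; rewrite compm1 => /(epi_eq0 eb).
  by case: lt.
have lt' : local_over (t \oc b \oc m).
  split=> // A f tf; have [K [l kl]] := abelian_ker ab f.
  have [I [e' [i [ce mi ie]]]] := image_factor ab kl.
  have ii : is_iso i.
    apply: (mono_dim_iso ab Fex Ff mi); rewrite dX'; apply: hd.
    exists I, (m \oc i); split=> // z; apply: tf.
    by rewrite -ie !compA in z *; rewrite z comp0m.
  by rewrite -ie; apply: epi_comp (iso_epi ii) (cokernel_epi ce).
have ebm : epi (b \oc m) by case: lt => _ _; apply; rewrite compA; apply: tbm.
have [|r [_ br]] := epi_dim_iso ab Fex Ff ebm.
  by rewrite dP; apply: hP; exists X', (t \oc b \oc m).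
by exists (a \oc m \oc r); rewrite !compA eab -!compA (compA b) br compm1.
Qed.

End Projectives.

(** * Two-fold Yoneda extensions and subobjects of projectives *)

Section Hereditary.
Context {k : fieldType} {C : kCat k} (ab : abelian C).
Implicit Types X Y Z A B K P S : C.

Lemma yinj_kernel X Y (E : yext 2 X Y) : is_kernel (yinj E) (ydiff E 0).
Proof.
have [K [m [e [km ee me]]]] := yexact_first E.
have [e' [_ ee']] : is_iso e.
  apply: (mono_epi_iso ab _ ee); apply: (@mono_comp_r _ _ _ _ _ m).
  by rewrite me; apply: yinj_mono.
rewrite -me; apply: kernelI.
- by rewrite me; apply: yinj_mono.
- by rewrite compA km.1 comp0m.
- move=> A g /(kernel_lift km)[u <-]; exists (e' \oc u).
  by rewrite -!compA (compA e) ee' comp1m.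
Qed.

Section Invariant.
Variables (K P X Y : C) (m : hom K P) (c : hom P X).
Hypotheses (projP : projective P) (cm : c \oc m = 0).

(* Vanishing of the class obtained from [E] by restricting along [c], read in
   [Ext^1(K, Y)]; it is invariant under Yoneda equivalence. *)
Definition lifts (E : yext 2 X Y) :=
  exists (h : hom P (yobj E 1)) (g : hom K (yobj E 0)),
    (yproj E : hom (yobj E 1) X) \oc h = c /\ ydiff E 0 \oc g = h \oc m.

(** Forwards one composes with the map. Backwards, a solution for [E'] is pulled back to [E]: both
    extensions start at [Y], where the map is the identity, so a discrepancy over [yobj E 0] can be
    corrected by a map into [Y]. *)
Lemma lifts_map (E E' : yext 2 X Y) : yext_map E E' -> lifts E <-> lifts E'.
Proof.
case=> f [f0 f1 f2]; have {}f1 := f1 0%N erefl; split=> [[h [g [ph dg]]]|[h' [g' [ph dg]]]].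
  exists (f 1%N \oc h), (f 0%N \oc g); split; first by rewrite compA f2.
  by rewrite compA -f1 -!compA dg.
have [h hE] := projP c (@yproj_epi _ _ _ _ _ E).
have [L [l [e [kl ee le]]]] := yexact_last E.
have [L' [l' [e' [kl' ee' le']]]] := yexact_last E'.
(* Two lifts of [c] to [yobj E' 1] differ by a map into the image of the differential, and
   projectivity of [P] lifts that map to [yobj E' 0]. *)
have [|x lx] := @kernel_lift _ _ _ _ _ _ _ _ (f 1%N \oc h - h') kl'.
  by rewrite compBr compA f2 hE ph subrr.
have [w ew] := projP x ee'.
have fh : f 1%N \oc h = h' + ydiff E' 0 \oc w.
  by rewrite -le' -compA ew lx addrC subrK.
have [|z lz] := @kernel_lift _ _ _ _ _ _ _ _ (h \oc m) kl.
  by rewrite compA hE cm.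
pose y := g' + w \oc m.
have dy : ydiff E' 0 \oc y = f 1%N \oc h \oc m.
  by rewrite /y compDr dg fh compDl !compA.
(* [K] is not known to be projective, so [z] is lifted over [e] only on the pullback [T]. Once
   corrected by a map into [Y], the lift [a'] kills the kernel of [b] and descends to [K]. *)
have [T [a [b [ezb [_ [_ /(_ ee) eb]]]]]] := pullback ab e z.
have [|r yr] := @kernel_lift _ _ _ _ _ _ _ _ (f 0%N \oc a - y \oc b) (yinj_kernel E').
  rewrite compBr !compA -f1 dy -(compA (f 1%N) h) -lz -!compA -ezb.
  by rewrite (compA l) le subrr.
have ey : e \oc yinj E = 0.
  by apply: (mono_eq0 (kernel_mono kl)); rewrite compA le (yinj_kernel E).1.
pose a' := a - yinj E \oc r.
have ea' : e \oc a' = z \oc b by rewrite /a' compBr compA ey comp0m subr0.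
have fa' : f 0%N \oc a' = y \oc b.
  by rewrite /a' compBr compA f0 yr opprB addrC subrK.
have [N [n kn]] := abelian_ker ab b.
have [|s ys] := @kernel_lift _ _ _ _ _ _ _ _ (a' \oc n) (yinj_kernel E).
  by rewrite -le -!compA (compA e) ea' -(compA z) kn.1 !compm0.
have s0 : s = 0.
  apply: (mono_eq0 (@yinj_mono _ _ _ _ _ E')).
  by rewrite -f0 -compA ys compA fa' -compA kn.1 compm0.
have [|g gb] := @cokernel_lift _ _ _ _ _ _ _ _ a' (epi_cokernel ab eb kn).
  by rewrite -ys s0 compm0.
exists h, g; split=> //; rewrite -le -lz -compA; congr (l \oc _).
by apply: eb; rewrite -compA gb.
Qed.

Lemma lifts_equiv (E E' : yext 2 X Y) : yext_equiv E E' -> lifts E <-> lifts E'.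
Proof.
elim=> [E1 E2 /lifts_map//|//|E1 E2 _ h|E1 E2 E3 _ h _ h']; first by rewrite h.
by rewrite h h'.
Qed.

End Invariant.

(** The zero class: identities of [Y] and of [X] joined by a zero differential. There [lifts] holds
    with [h = c] and [g = 0]. *)
Lemma trivial_yext X Y : exists E : yext 2 X Y,
  forall P K (m : hom K P) (c : hom P X), c \oc m = 0 -> lifts m c E.
Proof.
pose ob i := if i is 0 then Y else X.
have [Z zZ] := abelian_zero ab.
have e1 : exact_at (idm Y) (0 : hom (ob 0%N) (ob 1%N)).
  exists Y, (idm Y), (idm Y); split; last by rewrite comp1m.
    apply: kernelI; [exact: iso_mono (iso_id _) | by rewrite comp0m |].
    by move=> A g _; exists g; rewrite comp1m.
  exact: iso_epi (iso_id _).
have e2 : exact_at (0 : hom (ob 0%N) (ob 1%N)) (idm X).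
  exists Z, 0, 0; split; last by rewrite compm0.
    apply: kernelI; [by move=> A g h _; apply: zZ.2 | by rewrite compm0 |].
    by move=> A g; rewrite comp1m => ->; exists 0; rewrite comp0m.
  by move=> A g h _; apply: zZ.1.
exists (@YExt _ _ 2 X Y ob (idm Y) (fun i => 0) (idm X)
  (iso_mono (iso_id _)) e1 (fun i (h : (i.+2 < 2)%N) => False_rect _ (notF h)) e2 (iso_epi (iso_id _))).
move=> P K m c cm; exists c, 0; rewrite /= comp1m; split=> //.
by rewrite compm0 cm.
Qed.

(** By pullback it suffices to split every epi [p] from some [V] onto [K]. Splicing
    [ker p -> V -> K] with [K -> P -> coker m] gives a 2-extension; its equivalence with the zero
    class yields, through [lifts], maps [g : K -> V] and [h : P -> P] with [m p g = h m] and
    [c h = c]. *)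
Lemma sub_projective P K (m : hom K P) : hereditary C -> projective P -> mono m -> projective K.
Proof.
move=> her projP mm.
suff split V (p : hom V K) : epi p -> exists s, p \oc s = idm K.
  move=> V W e h ee; have [X [a [b [eab [_ [_ /(_ ee)/split[s bs]]]]]]] := pullback ab e h.
  by exists (a \oc s); rewrite compA eab -compA bs compm1.
move=> ep; have [Y [y ky]] := abelian_ker ab p.
have [X [c cc]] := abelian_coker ab m.
have km := mono_kernel ab mm cc.
pose ob i := if i is 0 then V else P.
pose df i : hom (ob i) (ob i.+1) := if i is 0 then m \oc p else 0.
have e1 : exact_at (y : hom Y (ob 0%N)) (df 0%N).
  exists Y, y, (idm Y); split; last by rewrite compm1.
    apply: kernelI; [exact: kernel_mono ky | by rewrite /= -compA ky.1 compm0 |].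
    by move=> A g; rewrite /= -compA => /(mono_eq0 mm)/(kernel_lift ky).
  exact: iso_epi (iso_id _).
have e2 : exact_at (df 0%N) (c : hom (ob 1%N) X) by exists K, m, p.
pose E := @YExt _ _ 2 X Y ob y df c (kernel_mono ky) e1
  (fun i (h : (i.+2 < 2)%N) => False_rect _ (notF h)) e2 (cokernel_epi cc).
have [E' /(_ _ _ m c cc.1) lE'] := trivial_yext X Y.
have [h [g [/= ch mg]]] := (lifts_equiv projP cc.1 (her 2 X Y erefl E E')).2 lE'.
(* [h] differs from the identity by [m r], and [r] lifts through [p] since [P] is projective;
   subtracting this lift, restricted to [K], turns [g] into a section of [p]. *)
have [|r mr] := @kernel_lift _ _ _ _ _ _ _ _ (h - idm P) km.
  by rewrite compBr ch compm1 subrr.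
have [r' pr] := projP _ _ _ r ep.
exists (g - r' \oc m); rewrite compBr compA pr; apply: mm.
rewrite compBr !compA mg mr compBl comp1m opprB addrC subrK compm1.
by [].
Qed.

End Hereditary.

Lemma dep_choice (I : Type) (T : I -> Type) (R : forall i, T i -> Prop) :
  (forall i, exists y, R i y) -> exists f : forall i, T i, forall i, R i (f i).
Proof.
move=> h; exists (fun i => proj1_sig (constructive_indefinite_description _ (h i))) => i.
exact: (proj2_sig (constructive_indefinite_description _ (h i))).
Qed.

Definition classical_bool (P : Prop) : bool :=
  if excluded_middle_informative P then true else false.

Lemma classical_boolP (P : Prop) : reflect P (classical_bool P).
Proof.
by rewrite /classical_bool; case: excluded_middle_informative => h; constructor.
Qed.

(** * Projectives as sums of projective covers *)

Section Decomposition.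
Context {k : fieldType} {C : kCat k} (ab : abelian C) (F : kFunctor C (Vec k)).
Hypotheses (Fex : exact_functor F) (Ff : faithful F).
Variables (J : finType) (P S : J -> C) (t : forall j, hom (P j) (S j)).
Hypotheses (Plocal : forall j, local_over (t j)) (Pproj : forall j, projective (P j)).
Hypothesis Ssurj : forall X, simple X -> exists j, isomorphic X (S j).

(** One cover splits off at a time. [K] maps onto some [S j]; lifting both ways between [P j] and
    [K] gives an endomorphism [v u] of [P j] over [S j], epi by locality and invertible by
    dimension. The complement is again projective and smaller. *)
Lemma projective_dsum K : projective K ->
  exists (T : finType) (c : T -> J) (i : forall s, hom (P (c s)) K)
    (p : forall s, hom K (P (c s))), is_dsum predT i p.
Proof.
move en : (dm F K) => n; elim/ltn_ind: n K en => n IH K en projK.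
case: (classic (is_zero K)) => [zK|nzK].
  exists void, (fun x : void => match x with end), (fun x : void => match x with end),
    (fun x : void => match x with end); split=> //.
  by apply: zK.1.
have [Q [q0 [sQ eq0]]] := exists_simple_quotient ab Fex Ff nzK.
have [j [u0 iu0]] := Ssurj sQ.
pose q := u0 \oc q0; have eq : epi q by apply: epi_comp (iso_epi iu0) eq0.
have [sS tn0 lt] := Plocal j.
have [u qu] := Pproj (t j) eq.
have et : epi (t j) by apply: (simple_epi ab).
have [v tv] := projK _ _ _ q et.
have evu : epi (v \oc u) by apply: lt; rewrite compA tv qu.
have [w [wvu vuw]] := epi_dim_iso ab Fex Ff evu (leqnn _).
pose v' := w \oc v; have v'u : v' \oc u = idm (P j) by rewrite -compA.
have [K' [m km]] := abelian_ker ab v'.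
have [|r mr] := @kernel_lift _ _ _ _ _ _ _ _ (idm K - u \oc v') km.
  by rewrite compBr compA v'u comp1m compm1 subrr.
have mm := kernel_mono km.
have rm : r \oc m = idm K'.
  apply: mm; rewrite compA mr compBl comp1m -(compA u) km.1 compm0 subr0.
  by rewrite compm1.
have ru : r \oc u = 0.
  apply: (mono_eq0 mm); rewrite compA mr compBl comp1m -compA v'u compm1.
  exact: subrr.
have projK' : projective K'.
  move=> V W e h ee; have [l el] := projK _ _ _ (h \oc r) ee.
  by exists (l \oc m); rewrite compA el -compA rm compm1.
have ds : is_direct_sum K (P j) K'.
  exists u, m, v', r; split=> //; first exact: km.1.
  by rewrite mr addrC subrK.
have ltK : (dm F K' < n)%N.
  rewrite -en (sum_dim ab Fex ds) -{1}[dm F K']add0n ltn_add2r.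
  by apply: (dm_gt0 Ff) => z; apply: tn0; apply: z.1.
have [T [c [i [p [h1 h2 h3]]]]] := IH _ ltK _ erefl projK'.
pose c' (x : option T) := if x is Some s then c s else j.
pose i' x : hom (P (c' x)) K := if x is Some s then m \oc i s else u.
pose p' x : hom K (P (c' x)) := if x is Some s then p s \oc r else v'.
exists (option T), c', i', p'; split.
- by case=> [s _|_] //=; rewrite -compA (compA r) rm comp1m h1.
- case=> [s|] [s'|] // _ _ ne /=.
  + by rewrite -compA (compA r) rm comp1m h2.
  + by rewrite -compA ru compm0.
  + by rewrite compA km.1 comp0m.
- rewrite (bigD1 None) //= (reindex_omap Some id) /=; last by case.
  under eq_bigl => s do rewrite eqxx.
  rewrite -[RHS](subrK (u \oc v')) -mr [RHS]addrC; congr (_ + _).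
  rewrite -[in RHS](comp1m r) -h3 comp_suml comp_sumr.
  by apply: eq_bigr => s _; rewrite !compA.
Qed.

End Decomposition.

Section OneDim.
Context {k : fieldType} {C : kCat k} (ab : abelian C) (F : kFunctor C (Vec k)).
Hypotheses (Fex : exact_functor F) (Ff : faithful F).

Lemma vec_iso_dim (U V : vectType k) (f : 'Hom(U, V)) : @is_iso _ (Vec k) U V f -> dim U = dim V.
Proof.
case=> g [gf fg]; rewrite -!dimvf.
have lk : lker f == 0%VS.
  by apply/lker0P/(@vec_mono_inj _ _ _ f)/iso_mono; exists g.
have <- : limg f = fullv.
  apply/vspaceP => v; rewrite memvf; have [|u <-] := @vec_epi_surj _ _ _ f _ v.
    by apply: iso_epi; exists g.
  by rewrite memv_img ?memvf.
by rewrite limg_dim_eq // (eqP lk) capv0.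
Qed.

Lemma ten_dim (M : monoidal C) X Y : strong_monoidal M (VecM k) F ->
  dm F (ten M X Y) = (dm F X * dm F Y)%N.
Proof.
case=> phi0 [phi [_ [iphi _]]].
by have := vec_iso_dim (iphi X Y); rewrite /dm !dimvf.
Qed.

Lemma simple_one_dim (M : monoidal C) S : strong_monoidal M (VecM k) F ->
  pointed M -> finite_type C -> simple S -> dm F S = 1%N.
Proof.
move=> sF [_ pM] /(indecomposable_bounded ab Fex)[b hb] sS.
pose T n := iter n (ten M S) S.
have sT n : simple (T n) by elim: n => //= n IH; apply: pM.
have dT n : dm F (T n) = (dm F S ^ n.+1)%N.
  by elim: n => [|n IH]; rewrite ?expn1 //= ten_dim // IH -expnS.
have := dm_gt0 Ff sS.1; case e: (dm F S) => [|[|d]] // _.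
have := hb _ (simple_indecomposable (sT b)); rewrite dT e.
rewrite leqNgt; case/negP; apply: leq_trans (ltn_expl b.+1 _) => //.
Qed.

End OneDim.

(** An arrow [i -> j] stands for one copy of [P j] in the radical [K i] of [P i]. The families
    [pin i] and [ppr i] range over all arrows, and [pK_sum] selects those with source [i]; this
    avoids types that depend on a proof of [src a = i]. *)
Record presentation (k : fieldType) (C : kCat k) (F : kFunctor C (Vec k)) (Q : quiver) := Presentation {
  pP : vertex Q -> C;
  pS : vertex Q -> C;
  pt : forall i, hom (pP i) (pS i);
  pt_local : forall i, local_over (pt i);
  pP_proj : forall i, projective (pP i);
  pS_dim : forall i, dm F (pS i) = 1%N;
  pS_surj : forall X : C, simple X -> exists i, isomorphic X (pS i);
  pS_inj : forall i j, isomorphic (pS i) (pS j) -> i = j;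
  pK : vertex Q -> C;
  pk : forall i, hom (pK i) (pP i);
  pk_ker : forall i, is_kernel (pk i) (pt i);
  pin : forall i a, hom (pP (tgt a)) (pK i);
  ppr : forall i a, hom (pK i) (pP (tgt a));
  pK_sum : forall i, is_dsum (fun a => src a == i) (pin i) (ppr i)
}.

Section Existence.
Context {k : fieldType} {C : kCat k} (ab : abelian C) (F : kFunctor C (Vec k)).
Hypotheses (Fex : exact_functor F) (Ff : faithful F).
Hypotheses (ft : finite_type C) (her : hereditary C).
Hypothesis one : forall S : C, simple S -> dm F S = 1%N.

Lemma simple_representatives : exists (J : finType) (S : J -> C),
  [/\ forall j, simple (S j), forall X, simple X -> exists j, isomorphic X (S j)
    & forall i j, isomorphic (S i) (S j) -> i = j].
Proof.
have [n [E hE]] := ft.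
pose good (i : 'I_n) := simple (E i) /\ forall j, isomorphic (E i) (E j) -> (i <= j)%N.
pose J := {i : 'I_n | classical_bool (good i)}.
have goodP (j : J) : good (val j) by have /classical_boolP := valP j.
exists J, (fun j => E (val j)); split=> [j|X sX|i j ij].
- by case: (goodP j).
- have [i0 i0X] := hE _ (simple_indecomposable sX).
  have [|m [[i [Xi im]] hm]] := @ex_min_nat
    (fun m => exists i : 'I_n, isomorphic X (E i) /\ m = i).
    by exists i0, i0.
  have gi : good i.
    split=> [|j ij]; first exact: simple_isom sX Xi.
    by rewrite -im; apply: hm; exists j; split=> //; exact: (isom_trans Xi ij).
  by exists (Sub i (introT (classical_boolP _) gi)); rewrite SubK.
- apply/val_inj/val_inj/anti_leq; have [[_ hi] [_ hj]] := (goodP i, goodP j).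
  by rewrite hi ?hj //; apply: isom_sym.
Qed.

Lemma presentation_exists : exists Q, inhabited (presentation F Q).
Proof.
have [J [S [sS Ssurj Sinj]]] := simple_representatives.
have [P hP] := dep_choice (fun j => projective_cover ab Fex Ff ft (sS j)).
have [t ht] := dep_choice hP.
have [K hK] := dep_choice (fun j => abelian_ker ab (t j)).
have [m hm] := dep_choice hK.
have Kproj j : projective (K j).
  by apply: (sub_projective ab her (ht j).2 (kernel_mono (hm j))).
have [T hT] := dep_choice (fun j => projective_dsum ab Fex Ff (fun j => (ht j).1)
  (fun j => (ht j).2) Ssurj (Kproj j)).
have [c hc] := dep_choice hT.
have [i hi] := dep_choice hc.
have [p hp] := dep_choice hi.
pose Q := @Quiver J {j : J & T j} (fun a => tag a) (fun a => c (tag a) (tagged a)).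
exists Q; constructor.
(* The source of an arrow is its tag, so the inclusion needs a transport when the tag equals [x];
   elsewhere it is set to zero. *)
pose pin (x : vertex Q) (a : arrow Q) : hom (P (tgt a)) (K x) :=
  if tag a =P x is ReflectT e then castm K e \oc i (tag a) (tagged a) else 0.
pose ppr (x : vertex Q) (a : arrow Q) : hom (K x) (P (tgt a)) :=
  if tag a =P x is ReflectT e then p (tag a) (tagged a) \oc castm K (esym e) else 0.
apply: (@Presentation k C F Q P S t (fun j => (ht j).1) (fun j => (ht j).2)
  (fun j => one (sS j)) Ssurj Sinj K m hm pin ppr) => x.
have pinE s : pin x (Tagged T s) = i x s.
  by rewrite /pin /=; case: eqP => // e; rewrite castmK comp1m.
have pprE s : ppr x (Tagged T s) = p x s.
  by rewrite /ppr /=; case: eqP => // e; rewrite castmK compm1.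
have [h1 h2 h3] := hp x.
split.
- by move=> [y s] /eqP /= e; subst y; rewrite pinE pprE h1.
- move=> [y s] [z s'] /eqP /= e /eqP /= e' ne; subst y; subst z; rewrite pinE pprE h2 //.
  by apply: contraNneq ne => ->.
rewrite -h3.
transitivity (\sum_(y | y == x) \sum_(s : T y) pin x (Tagged T s) \oc ppr x (Tagged T s)).
  rewrite sig_big_dep /=; apply: eq_big => [a|[y s] _] //=; first by rewrite andbT.
rewrite big_pred1_eq; apply: eq_bigr => s _.
by rewrite pinE pprE.
Qed.

End Existence.

(** * Equivalence with quiver representations *)

Section FiniteDimensional.
Variables (k : fieldType) (L : lmodType k) (V : vectType k) (j : {linear L -> V}).
Hypothesis inj_j : injective j.

(** A longest tuple of [L] whose image in [V] is free is a basis of [L]; its coordinates are read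
    off in [V]. *)
Lemma fin_dim : exists n (phi : L -> 'rV[k]_n), linear phi /\ bijective phi.
Proof.
have [||n [[b fb] hb]] := @ex_max_nat
  (fun n => exists b : n.-tuple L, free [seq j x | x <- b]) (\dim (fullv : {vspace V})).
- by exists 0%N, [tuple]; rewrite /= nil_free.
- move=> n [b]; rewrite /free => /eqP e.
  have -> : n = size [seq j x | x <- b] by rewrite size_map size_tuple.
  by rewrite -e dimvS ?subvf.
pose B := [tuple of [seq j x | x <- b]].
have jB l : j l \in <<B>>%VS.
  apply: contraT => nl; have /hb : exists c : n.+1.-tuple L, free [seq j x | x <- c].
    exists [tuple of l :: b]; rewrite /= free_cons nl; exact: fb.
  by rewrite ltnn.
exists n, (fun l => \row_i coord B i (j l)); split.
  by move=> a x y; apply/rowP => i; rewrite !mxE !linearP.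
exists (fun r : 'rV[k]_n => \sum_i r 0 i *: b`_i).
  move=> l; apply: inj_j; rewrite [in RHS](coord_span (jB l)) linear_sum.
  apply: eq_bigr => i _; rewrite linearZ mxE /=.
  by rewrite (nth_map 0) ?size_tuple.
move=> r; apply/rowP => i; rewrite mxE.
have -> : j (\sum_i r 0 i *: b`_i) = \sum_i r 0 i *: B`_i.
  rewrite linear_sum; apply: eq_bigr => i0 _.
  by rewrite linearZ /= (nth_map 0) ?size_tuple.
by rewrite coord_sum_free.
Qed.

Definition fin_dim_axiom : {n : nat & Vector.axiom n L}.
Proof.
have [n hn] := constructive_indefinite_description _ fin_dim.
have [phi hp] := constructive_indefinite_description _ hn.
by exists n; exists phi; [exact: hp.1 | exact: hp.2].
Qed.

(** The carrier remains [L], so that an element of [hv i X] below is by definition a morphism from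
    [P i] to [X]. *)
Definition vect_of_inj : vectType k :=
  HB.pack_for (vectType k) L (@Lmodule_hasFinDim.Build k L _ (projT2 fin_dim_axiom)).

End FiniteDimensional.

Section RepHom.
Context {k : fieldType} {Q : quiver}.
Implicit Types V W : @rep k Q.

Lemma rfun_id V i v : rep_fun (rep_id V) i v = v.
Proof. by rewrite ffunE id_lfunE. Qed.
Lemma rfun_comp U V W (psi : rep_hom V W) (phi : rep_hom U V) i v :
  rep_fun (rep_comp psi phi) i v = rep_fun psi i (rep_fun phi i v).
Proof. by rewrite ffunE comp_lfunE. Qed.
Lemma rfunD V W (phi psi : rep_hom V W) i v :
  rep_fun (phi + psi) i v = rep_fun phi i v + rep_fun psi i v.
Proof. by rewrite -[rep_fun _]/(val (phi + psi)) raddfD /= dsum_addE add_lfunE. Qed.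
Lemma rfunZ V W a (phi : rep_hom V W) i v :
  rep_fun (a *: phi) i v = a *: rep_fun phi i v.
Proof. by rewrite -[rep_fun _]/(val (a *: phi)) linearZ /= dsum_scaleE scale_lfunE. Qed.
Lemma rfun0 V W i v : rep_fun (0 : rep_hom V W) i v = 0.
Proof. by rewrite -(scale0r (0 : rep_hom V W)) rfunZ scale0r. Qed.
Lemma rfun_sum V W I (r : seq I) (P : pred I) (phi : I -> rep_hom V W) i v :
  rep_fun (\sum_(x <- r | P x) phi x) i v = \sum_(x <- r | P x) rep_fun (phi x) i v.
Proof.
by elim/big_rec2: _ => [|x y1 y2 _ e]; rewrite ?rfun0 // rfunD e.
Qed.
Lemma rfun_ext V W (phi psi : rep_hom V W) :
  (forall i v, rep_fun phi i v = rep_fun psi i v) -> phi = psi.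
Proof. by move=> e; apply/val_inj/ffunP => i; apply/lfunP => v; apply: e. Qed.
Lemma rfun_nat V W (phi : rep_hom V W) a v :
  rmap W a (rep_fun phi (src a) v) = rep_fun phi (tgt a) (rmap V a v).
Proof. by rewrite -!comp_lfunE rep_homP. Qed.

Lemma rep_homI V W (f : forall i, 'Hom(V i, W i)) :
  (forall a v, rmap W a (f (src a) v) = f (tgt a) (rmap V a v)) ->
  exists phi : rep_hom V W, forall i v, rep_fun phi i v = f i v.
Proof.
move=> nat; suff h : intertwines (V := V) (W := W) [ffun i => f i].
  by exists (RepHom h) => i v; rewrite ffunE.
by apply/forallP => a; apply/eqP/lfunP => v; rewrite !comp_lfunE !ffunE.
Qed.

Lemma rep_bij_iso V W (phi : rep_hom V W) :
  (forall i, injective (rep_fun phi i)) -> (forall i w, exists v, rep_fun phi i v = w) ->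
  @is_iso _ (Rep k Q) V W phi.
Proof.
move=> inj surj; have K i : cancel (rep_fun phi i) (rep_fun phi i)^-1%VF.
  by apply: lker0_lfunK; apply/lker0P.
have [|psi psiE] := @rep_homI W V (fun i => (rep_fun phi i)^-1%VF).
  move=> a w; have [v <-] := surj _ w.
  by rewrite rfun_nat !K.
exists psi; split; apply: rfun_ext => i v.
  by rewrite [LHS]rfun_comp psiE K [RHS]rfun_id.
have [u <-] := surj _ v.
by rewrite [LHS]rfun_comp psiE K [RHS]rfun_id.
Qed.

End RepHom.

Section Functor.
Context {k : fieldType} {C : kCat k} (ab : abelian C) (F : kFunctor C (Vec k)).
Hypotheses (Fex : exact_functor F) (Ff : faithful F).
Context {Q : quiver} (p : presentation F Q).
Local Notation P := (pP p).
Local Notation S := (pS p).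
Local Notation K := (pK p).
Local Notation t := (pt p).
Local Notation ki := (pk p).
Local Notation dm := (dm F).
Implicit Types X Y Z A B : C.

Lemma pS_simple i : simple (S i).
Proof. by case: (pt_local p i). Qed.
Lemma pt_neq0 i : t i <> 0.
Proof. by case: (pt_local p i). Qed.

Lemma generator_exists : exists g : forall i, el F (P i), forall i, ap F (t i) (g i) <> 0.
Proof.
apply: (dep_choice (R := fun i (g : el F (P i)) => ap F (t i) g <> 0)) => i; apply: NNPP => h; apply: (@pt_neq0 i); apply: (ap_eq0 Ff) => u.
by apply: NNPP => nz; apply: h; exists u.
Qed.

(** A vector surviving in the top of [P i]. It generates [P i], and [ev] below is the transformation
    from [hom (P i)] to [F] that corresponds to it under the Yoneda lemma. *)
Definition gen : forall i, el F (P i) :=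
  proj1_sig (constructive_indefinite_description _ generator_exists).
Lemma gen_neq0 i : ap F (t i) (gen i) <> 0.
Proof. exact: (proj2_sig (constructive_indefinite_description _ generator_exists)). Qed.

Definition ev i X (h : hom (P i) X) : el F X := ap F h (gen i).
Fact ev_linear i X : linear (@ev i X).
Proof. by move=> a f g; rewrite /ev apD apZ. Qed.
HB.instance Definition _ i X :=
  GRing.isLinear.Build k (hom (P i) X) (el F X) *:%R (@ev i X) (@ev_linear i X).

Lemma ev_comp i X Y (f : hom X Y) (h : hom (P i) X) : ev (f \oc h) = ap F f (ev h).
Proof. exact: ap_comp. Qed.

(** The kernel of [h] contains [gen i], so it is not killed by [t i]; [P i] being local, its
    inclusion is epi. *)
Lemma ev_eq0 i X (h : hom (P i) X) : ev h = 0 -> h = 0.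
Proof.
move=> h0; have [A [m km]] := abelian_ker ab h.
have [w mw] := kernel_ap ab Fex km h0.
have em : epi m.
  case: (pt_local p i) => _ _; apply => tm; apply: (@gen_neq0 i).
  by rewrite -mw -ap_comp tm ap0.
by apply: (epi_eq0 em); rewrite km.1.
Qed.
Lemma ev_inj i X : injective (@ev i X).
Proof.
by move=> f g e; apply/eqP; rewrite -subr_eq0; apply/eqP/ev_eq0; rewrite raddfB /= e subrr.
Qed.

(** [S j] is the only simple quotient of [P j]: by locality the kernel of [h] lies in that of [t j],
    so [t j] factors through [h] and gives a nonzero map from [S i] to [S j]. *)
Lemma hom_simple_index i j (h : hom (P j) (S i)) : h <> 0 -> j = i.
Proof.
move=> h0; have [A [m km]] := abelian_ker ab h.
have eh : epi h by apply: (simple_epi ab) h0; apply: pS_simple.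
have tm : t j \oc m = 0.
  apply: NNPP => /(let: And3 _ _ x := pt_local p j in x _ m) em.
  by apply: h0; apply: (epi_eq0 em); rewrite km.1.
have [r rh] := cokernel_lift (epi_cokernel ab eh km) tm.
apply/esym/(@pS_inj _ _ _ _ p); exists r; apply: (schur ab); try exact: pS_simple.
by move=> r0; apply: (@pt_neq0 j); rewrite -rh r0 comp0m.
Qed.

Lemma simple_span i (u : el F (S i)) : exists c, u = c *: ev (t i).
Proof.
have d : (\dim (fullv : {vspace el F (S i)}) <= 1)%N by rewrite [X in (X <= _)%N]pS_dim.
have nz : ev (t i) != 0 by apply/eqP/gen_neq0.
have : fullv = <[ev (t i)]>%VS.
  by apply/esym/eqP; rewrite eqEdim subvf dim_vline nz.
move=> e; have : u \in <[ev (t i)]>%VS by rewrite -e memvf.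
by case/vlineP => c ->; exists c.
Qed.

Lemma hom_top_scalar i (h : hom (P i) (S i)) : exists c, h = c *: t i.
Proof.
have [c e] := simple_span (ev h); exists c; apply: ev_inj.
by rewrite e linearZ.
Qed.

(* With ev_free below: F is the direct sum of the functors hom (P i) _. *)
Lemma ev_span X (u : el F X) : exists h : forall i, hom (P i) X, u = \sum_i ev (h i).
Proof.
move en : (dm X) => n; elim/ltn_ind: n X u en => n IH X u en.
case: (classic (is_zero X)) => [zX|nzX].
  exists (fun=> 0); rewrite big1 => [|i _]; last by rewrite linear0.
  by rewrite -(ap1 u) (zX.1 _ (idm X) 0) ap0.
have [S0 [s0 [sS ms0]]] := exists_simple_sub ab Fex Ff nzX.
have [j /isom_sym[r ir]] := pS_surj p sS.
pose s := s0 \oc r; have ms : mono s by apply: mono_comp ms0 (iso_mono ir).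
have [L [e ce]] := abelian_coker ab s.
have ltL : (dm L < n)%N.
  rewrite -en (cokernel_dim ab Fex ms ce) -{1}[dm L]add0n ltn_add2r.
  by rewrite pS_dim.
have [h' hE] := IH _ ltL L (ap F e u) erefl.
have [h hh] := dep_choice (fun i => pP_proj (h' i) (cokernel_epi ce)).
have [|w sw] := cokernel_ap ab Fex ce (u := u - \sum_i ev (h i)).
  rewrite linearB /= hE /= linear_sum -sumrB big1 // => i _.
  by rewrite /= -ev_comp hh subrr.
have [c wc] := simple_span w.
exists (fun i => if j =P i is ReflectT e then h i + c *: (s \oc t j \oc castm P (esym e)) else h i).
have -> : u = \sum_i ev (h i) + ap F s w by rewrite sw addrC subrK.
rewrite (bigD1 j) //= [in RHS](bigD1 j) //=; case: eqP => // e0.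
rewrite castmK compm1 linearD linearZ /= ev_comp wc linearZ /= addrAC; congr (_ + _).
apply: eq_bigr => i ij; case: eqP => // ji; by rewrite ji eqxx in ij.
Qed.

(** Induction along a simple subobject [S j] of [X]: modulo it all [h i] vanish, so they factor
    through [S j], where only [h j] can be nonzero; then [ev_eq0] applies. *)
Lemma ev_free X (h : forall i, hom (P i) X) : \sum_i ev (h i) = 0 -> forall i, h i = 0.
Proof.
move en : (dm X) => n; elim/ltn_ind: n X h en => n IH X h en h0.
case: (classic (is_zero X)) => [zX i|nzX]; first exact: zX.2.
have [S0 [s0 [sS ms0]]] := exists_simple_sub ab Fex Ff nzX.
have [j /isom_sym[r ir]] := pS_surj p sS.
pose s := s0 \oc r; have ms : mono s by apply: mono_comp ms0 (iso_mono ir).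
have [L [e ce]] := abelian_coker ab s.
have ltL : (dm L < n)%N.
  rewrite -en (cokernel_dim ab Fex ms ce) -{1}[dm L]add0n ltn_add2r.
  by rewrite pS_dim.
have eh i : e \oc h i = 0.
  apply: (IH _ ltL L (fun i => e \oc h i) erefl _ i).
  rewrite -[RHS](linear0 (ap F e)) -h0 linear_sum.
  by apply: eq_bigr => i0 _; rewrite /= ev_comp.
have [h' hh] := dep_choice (fun i => kernel_lift (mono_kernel ab ms ce) (eh i)).
have h'0 i : i != j -> h' i = 0.
  by move=> /eqP ij; apply: NNPP => /hom_simple_index.
have hj : h' j = 0.
  apply/ev_eq0/(mono_inj ab Fex ms); rewrite linear0 -ev_comp hh -[RHS]h0.
  rewrite [RHS](bigD1 j) //= big1 ?addr0 // => i ij.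
  by rewrite -hh h'0 // compm0 linear0.
move=> i; rewrite -hh; case: (eqVneq i j) => [->|/h'0->]; last by rewrite compm0.
by rewrite hj compm0.
Qed.

Lemma hom_jointly_faithful X Y (f g : hom X Y) :
  (forall i (h : hom (P i) X), f \oc h = g \oc h) -> f = g.
Proof.
move=> e; apply: (ap_inj Ff) => u; have [h ->] := ev_span u.
by rewrite !linear_sum; apply: eq_bigr => i _; rewrite /= -!ev_comp e.
Qed.

Definition hv i X : vectType k := vect_of_inj (@ev_inj i X).

Definition arr a : hom (P (tgt a)) (P (src a)) := ki (src a) \oc pin p (src a) a.

Definition hv_pre a X (h : hv (src a) X) : hv (tgt a) X := (h : hom _ X) \oc arr a.
Definition hv_post i X Y (f : hom X Y) (h : hv i X) : hv i Y := f \oc (h : hom _ X).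
Fact hv_pre_linear a X : linear (@hv_pre a X).
Proof. exact: (comp_linl (arr a)). Qed.
Fact hv_post_linear i X Y (f : hom X Y) : linear (@hv_post i X Y f).
Proof. exact: (comp_linr f). Qed.
HB.instance Definition _ a X :=
  GRing.isLinear.Build k (hv (src a) X) (hv (tgt a) X) *:%R (@hv_pre a X) (@hv_pre_linear a X).
HB.instance Definition _ i X Y (f : hom X Y) :=
  GRing.isLinear.Build k (hv i X) (hv i Y) *:%R (@hv_post i X Y f) (@hv_post_linear i X Y f).

Definition toRep X : @rep k Q :=
  Representation (rsp := fun i => hv i X) (fun a => linfun (@hv_pre a X)).

Definition toRep_fun X Y (f : hom X Y) : dsum (fun i => 'Hom(toRep X i, toRep Y i)) :=
  [ffun i : vertex Q => linfun (@hv_post i X Y f) : 'Hom(toRep X i, toRep Y i)].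

Fact toRep_intertwines X Y (f : hom X Y) : intertwines (V := toRep X) (W := toRep Y) (toRep_fun f).
Proof.
apply/forallP => a; apply/eqP/lfunP => v; rewrite !comp_lfunE !ffunE !lfunE /=.
by rewrite /hv_pre /hv_post -compA.
Qed.

Definition toRep_map X Y (f : hom X Y) : rep_hom (toRep X) (toRep Y) :=
  RepHom (toRep_intertwines f).

Lemma toRep_mapE X Y (f : hom X Y) i (h : hom (P i) X) : rep_fun (toRep_map f) i h = f \oc h.
Proof. by rewrite ffunE lfunE. Qed.

Fact toRep_map1 X : toRep_map (idm X) = rep_id (toRep X).
Proof. by apply: rfun_ext => i v; rewrite rfun_id [LHS]toRep_mapE comp1m. Qed.
Fact toRep_map_comp X Y Z (g : hom Y Z) (f : hom X Y) :
  toRep_map (g \oc f) = rep_comp (toRep_map g) (toRep_map f).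
Proof. by apply: rfun_ext => i v; rewrite rfun_comp !toRep_mapE compA. Qed.
Fact toRep_map_lin X Y : linear (@toRep_map X Y).
Proof.
move=> a f g; apply: rfun_ext => i v; rewrite rfunD rfunZ !toRep_mapE.
exact: (comp_linl (v : hom _ _)).
Qed.

Definition toRepF : kFunctor C (Rep k Q) :=
  @KFunctor k C (Rep k Q) toRep toRep_map toRep_map1 toRep_map_comp toRep_map_lin.

End Functor.

Definition single (k : fieldType) (I : finType) (T : I -> vectType k) i (w : T i) j : T j :=
  if i =P j is ReflectT e then ecast z (T z) e w else 0.

Lemma singleE (k : fieldType) (I : finType) (T : I -> vectType k) i (w : T i) :
  single w i = w.
Proof. by rewrite /single; case: eqP => // e; rewrite (eq_irrelevance e erefl). Qed.

Lemma single_neq (k : fieldType) (I : finType) (T : I -> vectType k) i (w : T i) j :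
  i <> j -> single w j = 0.
Proof. by rewrite /single; case: eqP. Qed.

(** * Full faithfulness, essential surjectivity and comparison with the forgetful functor *)

Section Equivalence.
Context {k : fieldType} {C : kCat k} (ab : abelian C) (F : kFunctor C (Vec k)).
Hypotheses (Fex : exact_functor F) (Ff : faithful F).
Context {Q : quiver} (p : presentation F Q).
Local Notation P := (pP p).
Local Notation S := (pS p).
Local Notation K := (pK p).
Local Notation t := (pt p).
Local Notation ki := (pk p).
Local Notation dm := (dm F).
Local Notation E := (toRep ab Fex Ff p).
Local Notation Em := (toRep_map ab Fex Ff p).
Local Notation arr := (arr p).
Implicit Types X Y Z A B : C.

Definition app X (W : rep Q) (phi : rep_hom (E X) W) i (h : hom (P i) X) : W i :=
  rep_fun phi i h.

Section App.
Variables (X : C) (W : @rep k Q).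
Implicit Type phi : rep_hom (E X) W.

Lemma appD phi i (h h' : hom (P i) X) : app phi (h + h') = app phi h + app phi h'.
Proof. exact: (linearD (rep_fun phi i)). Qed.
Lemma appZ phi i c (h : hom (P i) X) : app phi (c *: h) = c *: app phi h.
Proof. exact: (linearZ_LR (rep_fun phi i)). Qed.
Lemma app0 phi i : app phi (0 : hom (P i) X) = 0.
Proof. by rewrite -(scale0r (0 : hom (P i) X)) appZ scale0r. Qed.
Lemma app_sum phi i I (r : seq I) (R : pred I) (h : I -> hom (P i) X) :
  app phi (\sum_(x <- r | R x) h x) = \sum_(x <- r | R x) app phi (h x).
Proof. by elim/big_rec2: _ => [|x y z _ <-]; rewrite ?app0 ?appD. Qed.
Lemma app_arr phi a (h : hom (P (src a)) X) :
  rmap W a (app phi h) = app phi (h \oc arr a).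
Proof. by rewrite /app rfun_nat; congr (rep_fun phi _ _); exact: lfunE. Qed.
Lemma app_comp phi A (f : hom A X) i (h : hom (P i) A) :
  app (rep_comp phi (Em f)) h = app phi (f \oc h).
Proof. by rewrite /app rfun_comp toRep_mapE. Qed.
Lemma app_suml I (r : seq I) (R : pred I) (phi : I -> rep_hom (E X) W) i (h : hom (P i) X) :
  app (\sum_(x <- r | R x) phi x) h = \sum_(x <- r | R x) app (phi x) h.
Proof. exact: rfun_sum. Qed.
Lemma app_ext phi psi : (forall i (h : hom (P i) X), app phi h = app psi h) -> phi = psi.
Proof. by move=> e; apply: rfun_ext => i v; apply: e. Qed.

End App.

(** [P (tgt a)] embeds in the radical of [P i], which has codimension one. Hence [Q] has no oriented
    cycle, and the inductions over paths can run on [dm (P i)]. *)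
Lemma rank_arrow a i : src a = i -> (dm (P (tgt a)) < dm (P i))%N.
Proof.
move=> e; have [/(_ a) h1 _ _] := pK_sum p i; rewrite e eqxx in h1.
have mk := kernel_mono (pk_ker p i).
have m : mono (pin p i a).
  by apply: (@mono_comp_r _ _ _ _ _ (ppr p i a)); rewrite h1 //; apply: iso_mono (iso_id _).
apply: leq_ltn_trans (mono_dim ab Fex m) _.
have et : epi (t i) by apply: (simple_epi ab) (@pt_neq0 _ _ _ _ p i); apply: pS_simple.
rewrite (cokernel_dim ab Fex mk (epi_cokernel ab et (pk_ker p i))) pS_dim.
by rewrite addn1.
Qed.

Lemma radical_decomp i j (h : hom (P j) (K i)) :
  ki i \oc h = \sum_(a | src a == i) ki i \oc pin p i a \oc (ppr p i a \oc h).
Proof.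
have [_ _ h3] := pK_sum p i; rewrite -[in LHS](comp1m h) -h3 comp_suml comp_sumr.
by apply: eq_bigr => a _; rewrite !compA.
Qed.

Definition idsingle i j : hom (P j) (P i) := single (T := E (P i)) (idm (P i)) j.

Lemma top_idsingle i j (h : hom (P j) (P i)) : exists c, t i \oc h = t i \oc (c *: idsingle i j).
Proof.
case: (eqVneq i j) => [e|ij]; last first.
  exists 0; rewrite scale0r compm0; apply: NNPP => /(hom_simple_index ab) e.
  by rewrite e eqxx in ij.
subst j; have [c ce] := hom_top_scalar ab Fex Ff (t i \oc h).
by exists c; rewrite ce /idsingle singleE compZr compm1.
Qed.

Lemma kernel_decomp i j (h : hom (P j) (P i)) :
  exists c (h' : hom (P j) (K i)), h = c *: idsingle i j + ki i \oc h'.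
Proof.
have [c ce] := top_idsingle h; exists c.
have [|h' e] := @kernel_lift _ _ _ _ _ _ _ _ (h - c *: idsingle i j) (pk_ker p i).
  by rewrite compBr ce subrr.
by exists h'; rewrite e addrC subrK.
Qed.

(** With [app_exists] this says that [E (P i)] represents [W |-> W i]. A map into [P i] is a
    multiple of the identity plus a sum of maps through arrows, and those are covered by
    induction. *)
Lemma app_determined i (W : rep Q) (phi psi : rep_hom (E (P i)) W) :
  app phi (idm (P i)) = app psi (idm (P i)) -> phi = psi.
Proof.
move en : (dm (P i)) => n; elim/ltn_ind: n i W phi psi en => n IH i W phi psi en e.
have ea a j (h : hom (P j) (P (tgt a))) : src a = i ->
    app phi (ki i \oc pin p i a \oc h) = app psi (ki i \oc pin p i a \oc h).
  move=> ai; rewrite -!app_comp; congr (app _ h); apply: IH erefl _.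
    by rewrite -en; apply: rank_arrow.
  rewrite !app_comp compm1; subst i; have := app_arr phi (idm (P (src a))).
  by rewrite e app_arr !comp1m => <-.
apply: app_ext => j h; have [c [h' ->]] := kernel_decomp h.
rewrite !appD !appZ radical_decomp !app_sum; congr (c *: _ + _).
  case: (eqVneq i j) => [ij|/eqP ij]; last by rewrite /idsingle single_neq // !app0.
  by subst j; rewrite /idsingle singleE.
by apply: eq_bigr => a /eqP; apply: ea.
Qed.

(** Both sides, as functions of [y], are morphisms of representations out of [E (P i)] agreeing at
    the identity. So [phi] respects every map between the projectives, not only the arrows. *)
Lemma app_natural X (W : rep Q) (phi : rep_hom (E X) W) i j (x : hom (P i) X) (y : hom (P j) (P i))
    Y (psi : rep_hom (E Y) W) (x' : hom (P i) Y) : app phi x = app psi x' ->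
  app phi (x \oc y) = app psi (x' \oc y).
Proof.
move=> e; rewrite -!app_comp; congr (app _ y); apply: app_determined.
by rewrite !app_comp !compm1.
Qed.

(* The radical of P i is a sum of objects P j of smaller dimension, on which
   the morphism is known by induction; single w is the family equal to w at i
   and 0 elsewhere. *)
Lemma app_exists i (W : rep Q) (w : W i) :
  exists phi : rep_hom (E (P i)) W, app phi (idm (P i)) = w.
Proof.
move en : (dm (P i)) => n; elim/ltn_ind: n i W w en => n IH i W w en.
have [chi hchi] : exists chi : forall a, rep_hom (E (P (tgt a))) W, forall a, src a = i ->
    app (chi a) (idm (P (tgt a))) = rmap W a (single w (src a)).
  apply: (dep_choice (R := fun a (x : rep_hom (E (P (tgt a))) W) => src a = i ->
    app x (idm (P (tgt a))) = rmap W a (single w (src a)))) => a.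
  case: (eqVneq (src a) i) => [ai|/eqP ai]; last by exists 0.
  have [|x hx] := IH _ _ (tgt a) W (rmap W a (single w (src a))) erefl; last by exists x.
  by rewrite -en; apply: rank_arrow.
pose psi : rep_hom (E (K i)) W := \sum_(a | src a == i) rep_comp (chi a) (Em (ppr p i a)).
have psiE a : src a = i -> app psi (pin p i a) = rmap W a (single w (src a)).
  move=> ai; have [h1 h2 _] := pK_sum p i.
  rewrite app_suml (bigD1 a) ?ai //= big1 => [|b /andP[bi ba]].
    by rewrite addr0 app_comp h1 ?hchi ?ai.
  by rewrite app_comp h2 ?app0 ?ai.
(* The map to be built sends [c *: idsingle i j + ki i \oc h'] to [c *: single w j + app psi h'].
   The decomposition is known by mere existence, so the map is given by its graph, shown to be
   linear, single-valued and total. *)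
pose R j (h : hom (P j) (P i)) (y : W j) := exists c (h' : hom (P j) (K i)),
  h = c *: idsingle i j + ki i \oc h' /\ y = c *: single w j + app psi h'.
have R_lin j a h h' y y' : R j h y -> R j h' y' -> R j (a *: h + h') (a *: y + y').
  move=> [c [x [-> ->]]] [c' [x' [-> ->]]]; exists (a * c + c'), (a *: x + x'); split.
    by rewrite compDr compZr scalerDl -scalerA !scalerDr addrACA.
  by rewrite appD appZ scalerDl -scalerA !scalerDr addrACA.
have R0 j y : R j 0 y -> y = 0.
  move=> [c [x [e ->]]].
  have z : c *: idsingle i j = 0 /\ c *: single w j = 0.
    case: (eqVneq i j) => [ij|/eqP ij]; last by rewrite /idsingle !single_neq // !scaler0.
    subst j; move/(congr1 (fun f => t i \oc f)): e.
    rewrite /idsingle !singleE compm0 compDr compZr compm1 compA (pk_ker p i).1 comp0m addr0.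
    move/esym/eqP; rewrite scaler_eq0 => /orP[/eqP->|/eqP/(@pt_neq0 _ _ _ _ p i)//].
    by rewrite !scale0r.
  have -> : x = 0.
    by apply: (mono_eq0 (kernel_mono (pk_ker p i))); rewrite e z.1 add0r.
  by rewrite z.2 app0 addr0.
have R_uniq j h y y' : R j h y -> R j h y' -> y = y'.
  move=> r r'; have := R_lin _ (-1) _ _ _ _ r r'.
  rewrite !scaleN1r addNr => /R0/eqP; rewrite addrC subr_eq0 => /eqP.
  by [].
have R_ex j (h : hom (P j) (P i)) : exists y, R j h y.
  by have [c [h' e]] := kernel_decomp h; exists (c *: single w j + app psi h'), c, h'.
have [f hf] := dep_choice (fun jh : {j : vertex Q & hom (P j) (P i)} => R_ex _ (tagged jh)).
pose fj j (h : E (P i) j) : W j := f (Tagged (fun j => hom (P j) (P i)) (h : hom (P j) (P i))).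
have fjR j h : R j h (@fj j h) by apply: (hf (Tagged _ _)).
have fl j : linear (@fj j).
  by move=> a x y; apply: R_uniq (fjR _ _) _; apply: R_lin.
pose fjl j : {linear E (P i) j -> W j} :=
  HB.pack_for {linear E (P i) j -> W j} (@fj j) (GRing.isLinear.Build _ _ _ _ _ (fl j)).
have [|phi hphi] := @rep_homI _ _ (E (P i)) W (fun j => linfun (fjl j)).
  move=> a h; rewrite !lfunE /=.
  have [c [x [hE ->]]] := fjR _ h.
  apply/esym/(R_uniq _ _ _ _ (fjR _ _)).
  case: (eqVneq (src a) i) => [ai|/eqP ai].
    exists 0, (c *: pin p i a + x \oc arr a); split.
      rewrite scale0r add0r compDr compZr compA /hv_pre hE compDl compZl; congr (c *: _ + _).
      by subst i; rewrite /idsingle singleE comp1m.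
    by rewrite scale0r add0r appD appZ psiE // linearD linearZ /= app_arr.
  have ia : i <> src a by move=> e; apply: ai.
  exists 0, (x \oc arr a); rewrite !scale0r !add0r; split.
    by rewrite /hv_pre hE /idsingle (single_neq _ ia) scaler0 add0r compA.
  by rewrite (single_neq _ ia) scaler0 add0r app_arr.
exists phi; rewrite /app hphi lfunE /=; apply: R_uniq (fjR _ _) _.
by exists 1, 0; rewrite /idsingle !singleE compm0 app0 !addr0 !scale1r.
Qed.

(** By [ev_span] each basis vector of [F X] is a sum of values of [ev]; one summand for each pair of
    a vertex and a basis vector therefore covers [X]. *)
Lemma epi_cover X : exists (T : finType) (c : T -> vertex Q) Z
    (i : forall s, hom (P (c s)) Z) (q : forall s, hom Z (P (c s))) (pi : hom Z X),
  is_dsum predT i q /\ epi pi.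
Proof.
pose b := vbasis (fullv : {vspace el F X}).
have [h hh] := dep_choice (fun s : 'I_(dm X) => ev_span ab Fex Ff p b`_s).
pose T : finType := (vertex Q * 'I_(dm X))%type; pose c (x : T) := x.1.
have [Z [i [q ds]]] := dsum_exists ab predT (fun s => P (c s)).
pose pi : hom Z X := \sum_s h s.2 s.1 \oc q s.
exists T, c, Z, i, q, pi; split=> //; have [h1 h2 _] := ds.
have hi s : pi \oc i s = h s.2 s.1.
  rewrite /pi comp_suml (bigD1 s) //= -compA h1 // compm1 big1 ?addr0 // => s' ss'.
  by rewrite -compA h2 // compm0.
apply: (surj_epi Ff) => v; rewrite (coord_vbasis (memvf v)) -/b.
exists (\sum_s coord b s v *: \sum_j ap F (i (j, s)) (gen Ff p j)).
rewrite linear_sum; apply: eq_bigr => s _; rewrite linearZ /= linear_sum hh.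
by congr (_ *: _); apply: eq_bigr => j _; rewrite /= -ap_comp (hi (j, s) : pi \oc i (j, s) = h s j).
Qed.

(** By [app_natural], [phi] commutes with all maps between the [P i] and so defines a map on a
    projective cover [Z] of [X]; it dies on the kernel of the covering map and descends. *)
Lemma toRep_full X Y (phi : rep_hom (E X) (E Y)) : exists f : hom X Y, Em f = phi.
Proof.
have nat i j (x : hom (P i) X) (r : hom (P j) (P i)) : app phi (x \oc r) = app phi x \oc r.
  have -> : (app phi x : hom (P i) Y) \oc r = app (rep_id (E Y)) ((app phi x : hom (P i) Y) \oc r).
    by rewrite /app rfun_id.
  by apply: app_natural; rewrite {2}/app rfun_id.
have [T [c [Z [i [q [pi [[h1 h2 h3] epi_pi]]]]]]] := epi_cover X.
pose h0 : hom Z Y := \sum_s app phi (pi \oc i s) \oc q s.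
have h0E j (y : hom (P j) Z) : h0 \oc y = app phi (pi \oc y).
  rewrite -{2}(comp1m y) -h3 comp_suml comp_sumr app_sum comp_suml.
  by apply: eq_bigr => s _; rewrite -!compA (compA pi) nat.
have [N [m km]] := abelian_ker ab pi.
have [|f fpi] := @cokernel_lift _ _ _ _ _ _ _ _ h0 (epi_cokernel ab epi_pi km).
  apply: (hom_jointly_faithful ab Fex Ff (p := p)) => j y.
  by rewrite -compA h0E compA km.1 !comp0m app0.
exists f; apply: app_ext => j x; have [y <-] := pP_proj x epi_pi.
by rewrite -h0E -fpi -compA /app [LHS]toRep_mapE.
Qed.

Lemma toRep_faithful X Y (f g : hom X Y) : Em f = Em g -> f = g.
Proof.
move=> e; apply: (hom_jointly_faithful ab Fex Ff (p := p)) => i h.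
by have := congr1 (fun phi => app phi h) e; rewrite /app !toRep_mapE.
Qed.

(** [W] is presented by projectives: [Z] covers it along a basis, [Z1] covers the kernel, and [X] is
    the cokernel of [Z1 -> Z] formed in [C]. By [e0], [e] and [th] kill the same maps from the
    [P j], which identifies [E X] with [W]. *)
Lemma toRep_ess_surj (W : rep Q) : exists X, @isomorphic _ (Rep k Q) (E X) W.
Proof.
pose b i := vbasis (fullv : {vspace W i}).
pose T : finType := {i : vertex Q & 'I_(\dim (fullv : {vspace W i}))}.
pose w (s : T) : W (tag s) := (b (tag s))`_(tagged s).
have [chi hchi] := dep_choice (fun s : T => app_exists (w s)).
have [Z [i [q [h1 h2 h3]]]] := dsum_exists ab predT (fun s : T => P (tag s)).
pose th : rep_hom (E Z) W := \sum_s rep_comp (chi s) (Em (q s)).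
have thE s : app th (i s) = w s.
  rewrite app_suml (bigD1 s) //= big1 => [|s' ss']; last by rewrite app_comp h2 ?app0.
  by rewrite addr0 app_comp h1 ?hchi.
have th_surj j (v : W j) : exists h, app th h = v.
  pose tg (x : 'I_(\dim (fullv : {vspace W j}))) : T := existT _ j x.
  pose ij x : hom (P j) Z := i (tg x).
  exists (\sum_x coord (b j) x v *: ij x).
  rewrite app_sum [RHS](coord_vbasis (memvf v)); apply: eq_bigr => x _.
  by rewrite appZ; congr (_ *: _); exact: (thE (tg x)).
pose U j := lker (rep_fun th j).
pose T1 : finType := {j : vertex Q & 'I_(\dim (U j))}.
pose u (s : T1) : hom (P (tag s)) Z := (vbasis (U (tag s)))`_(tagged s).
have [Z1 [i1 [q1 [g1 g2 g3]]]] := dsum_exists ab predT (fun s : T1 => P (tag s)).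
pose d : hom Z1 Z := \sum_s u s \oc q1 s.
have di s : d \oc i1 s = u s.
  rewrite comp_suml (bigD1 s) //= -compA g1 // compm1 big1 ?addr0 // => s' ss'.
  by rewrite -compA g2 // compm0.
have thu s : app th (u s) = 0.
  apply/eqP; rewrite -[app th _]/(rep_fun th _ _) -memv_ker; apply: vbasis_mem.
  by apply: mem_nth; rewrite size_tuple.
have [X [e ce]] := abelian_coker ab d.
have ee := cokernel_epi ce.
have eu s : e \oc u s = 0 by rewrite -di compA ce.1 comp0m.
have e0 j (h : hom (P j) Z) : e \oc h = 0 <-> app th h = 0.
  (* A map killed by [e] lands in the image of [d] and lifts to [Z1] because [P j] is projective.
     Conversely, a vector in the kernel of [th] is expanded in the basis [u], which [e] kills. *)
  split=> [eh|th0].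
    have [I [e' [l [ce' ml le]]]] : exists I (e' : hom Z1 I) (l : hom I Z),
        [/\ epi e', mono l & l \oc e' = d].
      have [N [m km]] := abelian_ker ab d.
      have [I [e' [l [ce' ml le]]]] := image_factor ab km.
      by exists I, e', l; split=> //; apply: cokernel_epi ce'.
    have kl : is_kernel l e.
      apply: (mono_kernel ab ml); apply: cokernelI ee _ _.
        by apply: ce'; rewrite -compA le ce.1 comp0m.
      by move=> A g gl; apply: (cokernel_lift ce); rewrite -le compA gl comp0m.
    have [h' <-] := kernel_lift kl eh.
    have [y <-] := pP_proj h' ce'.
    rewrite compA le -(comp1m y) -g3 comp_suml comp_sumr app_sum big1 // => s _.
    rewrite !compA di -compA.
    have -> : app th (u s \oc (q1 s \oc y)) = app (0 : rep_hom (E Z) W) (u s \oc (q1 s \oc y)).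
      by apply: app_natural; rewrite thu /app rfun0.
    by rewrite /app rfun0.
  have hU : (h : E Z j) \in U j by rewrite memv_ker; apply/eqP.
  pose tg (x : 'I_(\dim (U j))) : T1 := existT _ j x.
  pose uj x : hom (P j) Z := u (tg x).
  have -> : h = \sum_x coord (vbasis (U j)) x (h : E Z j) *: uj x.
    exact: (coord_vbasis hU).
  rewrite comp_sumr big1 // => x _.
  by rewrite compZr [X in _ *: X](eu (tg x) : e \oc uj x = 0) scaler0.
(* By [e0], [th] is constant on the fibres of [Em e]; composing it with a linear pseudo-inverse of
   [Em e] yields the descended map. *)
have inv_ex j : exists f : 'Hom(E X j, W j), forall h : hom (P j) Z, f (e \oc h : hom _ X) = app th h.
  exists (rep_fun th j \o (rep_fun (Em e) j)^-1)%VF => h; rewrite comp_lfunE.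
  have lim : (e \oc h : E X j) \in limg (rep_fun (Em e) j).
    by rewrite -(toRep_mapE ab Fex Ff e h) memv_img ?memvf.
  pose h' : hom (P j) Z := ((rep_fun (Em e) j)^-1)%VF (e \oc h : E X j).
  rewrite -[LHS]/(app th h').
  have eh : e \oc h' = e \oc h by rewrite -(toRep_mapE ab Fex Ff e h') limg_lfunVK.
  have /e0 : e \oc (h' - h) = 0 by rewrite compBr eh subrr.
  rewrite -[h' - h]/(h' + - h) appD -scaleN1r appZ scaleN1r => /eqP.
  by rewrite subr_eq0 => /eqP.
have [f fE] := dep_choice inv_ex.
have lift j (x : hom (P j) X) := pP_proj x ee.
have [|phi hphi] := @rep_homI _ _ (E X) W f.
  move=> a v; have [h <-] := lift _ v; rewrite fE app_arr -fE compA.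
  by congr (f _ _); apply/esym; exact: lfunE.
exists X, phi; apply: rep_bij_iso => j.
  move=> x y; have [x' <-] := lift _ x; have [y' <-] := lift _ y.
  rewrite !hphi !fE => exy; apply/eqP; rewrite -subr_eq0; apply/eqP.
  rewrite -[LHS]/(e \oc x' - e \oc y') -compBr; apply/e0.
  by rewrite -[x' - y']/(x' + - y') appD -scaleN1r appZ scaleN1r exy subrr.
by move=> v; have [h <-] := th_surj j v; exists (e \oc h); rewrite hphi fE.
Qed.

Definition total_sum X (v : dsum (E X)) : el F X :=
  \sum_i ev Ff (v i : hom (P i) X).
Fact total_sum_linear X : linear (@total_sum X).
Proof.
move=> a v w; rewrite /total_sum scaler_sumr -big_split; apply: eq_bigr => i _.
by rewrite dsum_addE dsum_scaleE; exact: (ev_linear Ff a (v i : hom (P i) X) (w i)).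
Qed.
HB.instance Definition _ X :=
  GRing.isLinear.Build k (dsum (E X)) (el F X) *:%R (@total_sum X) (@total_sum_linear X).

Definition forget_iso X : @hom k (Vec k) (forgetful k Q (E X)) (F X) := linfun (@total_sum X).

Lemma forget_iso_is_iso X : is_iso (forget_iso X).
Proof.
pose f : 'Hom(dsum (E X), el F X) := linfun (@total_sum X).
have fi : injective f.
  apply/lker0P; rewrite -subv0; apply/subvP => v.
  rewrite memv_ker memv0 lfunE /= => /eqP/(ev_free) v0.
  by apply/eqP/ffunP => i; rewrite ffunE; apply: v0.
have fs v : exists u, f u = v.
  have [h ->] := ev_span ab Fex Ff p v; exists [ffun i => h i : E X i].
  by rewrite lfunE /= /total_sum; apply: eq_bigr => i _; rewrite ffunE.
exists (f^-1)%VF; split; apply/lfunP => v; rewrite [LHS]comp_lfunE [RHS]id_lfunE.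
  by apply: lker0_lfunK; apply/lker0P.
have [u <-] := fs v; congr (f _); apply: lker0_lfunK; exact/lker0P.
Qed.

Lemma forget_iso_nat X Y (f : hom X Y) :
  forget_iso Y \oc fmap (forgetful k Q) (fmap (toRepF ab Fex Ff p) f) = fmap F f \oc forget_iso X.
Proof.
apply/lfunP => v; rewrite [LHS]comp_lfunE [RHS]comp_lfunE !lfunE /=.
rewrite -[fmap F f]/(ap F f) linear_sum; apply: eq_bigr => i _.
by rewrite ffunE toRep_mapE /= ev_comp.
Qed.

End Equivalence.

(** * Transport of monoidal structures *)

Section Compose.
Context {k : fieldType} {C : kCat k}.
Implicit Types X Y Z W A B : C.

(** Composites are kept nested to the right; this form and the next two apply an equation at the
    head of a longer composite. *)
Lemma comp_eqR W X Y Z Z' (a : hom Y Z) (b : hom X Y) (c : hom Z' Z) (d : hom X Z') (x : hom W X) :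
  a \oc b = c \oc d -> a \oc (b \oc x) = c \oc (d \oc x).
Proof. by move=> e; rewrite !compA e. Qed.

Lemma comp_eqR1 W X Y Z (a : hom Y Z) (b : hom X Y) (c : hom X Z) (x : hom W X) :
  a \oc b = c -> a \oc (b \oc x) = c \oc x.
Proof. by move=> <-; rewrite !compA. Qed.

Lemma comp_idR X Y W (a : hom Y X) (b : hom X Y) (x : hom W X) :
  a \oc b = idm X -> a \oc (b \oc x) = x.
Proof. by move=> e; rewrite compA e comp1m. Qed.

Lemma is_iso_inv X Y (f : hom X Y) : is_iso f -> exists g, [/\ g \oc f = idm X, f \oc g = idm Y & is_iso g].
Proof. by case=> g [a b]; exists g; split=> //; exists f. Qed.

Variable M : monoidal C.
Local Notation "f ** g" := (tenm M f g) (at level 40, left associativity).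

Lemma tenmC X X' X'' Y Y' Y'' (f' : hom X' X'') (f : hom X X') (g' : hom Y' Y'') (g : hom Y Y') :
  (f' ** g') \oc (f ** g) = (f' \oc f) ** (g' \oc g).
Proof. by rewrite tenm_comp. Qed.
Lemma tenmR X X' X'' Y Y' Y'' W (f' : hom X' X'') (f : hom X X') (g' : hom Y' Y'') (g : hom Y Y')
  (x : hom W (ten M X Y)) :
  (f' ** g') \oc ((f ** g) \oc x) = (f' \oc f) ** (g' \oc g) \oc x.
Proof. exact/comp_eqR1/tenmC. Qed.
Lemma tenm_iso X X' Y Y' (f : hom X X') (g : hom Y Y') : is_iso f -> is_iso g -> is_iso (f ** g).
Proof.
by case=> f' [a b] [g' [c d]]; exists (f' ** g'); rewrite !tenmC a b c d !tenm1.
Qed.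
Lemma tenm_splitl X X' Y Y' (f : hom X X') (g : hom Y Y') :
  f ** g = (f ** idm Y') \oc (idm X ** g).
Proof. by rewrite tenmC comp1m compm1. Qed.

End Compose.

Section FullyFaithful.
Context {k : fieldType} {C R : kCat k} (G : kFunctor R C).
Hypotheses (Gf : faithful G) (Gfull : forall X Y (f : hom (G X) (G Y)), exists g : hom X Y, fmap G g = f).

Lemma fmap_iso X Y (f : hom X Y) : is_iso f -> is_iso (fmap G f).
Proof. by case=> g [a b]; exists (fmap G g); rewrite -!fmap_comp a b !fmap1. Qed.

Lemma reflect_iso X Y (f : hom X Y) : is_iso (fmap G f) -> is_iso f.
Proof.
case=> g [a b]; have [g' e] := Gfull g; exists g'.
by split; apply: Gf; rewrite fmap_comp e fmap1.
Qed.
End FullyFaithful.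

Section Transport.
Context {k : fieldType} {C R : kCat k} (M : monoidal C) (G : kFunctor R C).
Hypotheses (Gf : faithful G) (Gfull : forall X Y (f : hom (G X) (G Y)), exists g : hom X Y, fmap G g = f).
Variables (I : R) (T : R -> R -> R) (u : hom (G I) (unit_ob M))
  (mu : forall X Y, hom (G (T X Y)) (ten M (G X) (G Y))).
Hypotheses (iu : is_iso u) (imu : forall X Y, is_iso (mu X Y)).
Local Notation "f ** g" := (tenm M f g) (at level 40, left associativity).
Local Notation one := (idm _).
Local Notation a := (massoc M).

(** Full faithfulness allows each structure map of [R] to be defined by its image in [C], conjugated
    by [mu], and each axiom to be checked there after cancelling [mu]. *)
Lemma transport_monoidal : exists N : monoidal R, strong_monoidal N M G.
Proof.
have [mu0 mu0P] := dep_choice (fun XY : R * R => imu XY.1 XY.2).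
pose nu X Y : hom (ten M (G X) (G Y)) (G (T X Y)) := mu0 (X, Y).
have numu X Y : nu X Y \oc mu X Y = one by have [] := mu0P (X, Y).
have munu X Y : mu X Y \oc nu X Y = one by have [] := mu0P (X, Y).
have [u' [u'u uu' iu']] := is_iso_inv iu.
have inu X Y : is_iso (nu X Y) by exists (mu X Y).
have mono_mu X Y := iso_mono (imu X Y).
pose tG X X' Y Y' (f : hom X X') (g : hom Y Y') : hom (G (T X Y)) (G (T X' Y')) :=
  nu X' Y' \oc (fmap G f ** fmap G g \oc mu X Y).
pose aG X Y Z : hom (G (T (T X Y) Z)) (G (T X (T Y Z))) :=
  nu X (T Y Z) \oc (one ** nu Y Z \oc (a (G X) (G Y) (G Z) \oc (mu X Y ** one \oc mu (T X Y) Z))).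
pose lG X : hom (G (T I X)) (G X) := munitl M (G X) \oc (u ** one \oc mu I X).
pose rG X : hom (G (T X I)) (G X) := munitr M (G X) \oc (one ** u \oc mu X I).
pose tens X X' Y Y' (f : hom X X') (g : hom Y Y') : hom (T X Y) (T X' Y') :=
  proj1_sig (constructive_indefinite_description _ (Gfull (tG X X' Y Y' f g))).
have tE0 X X' Y Y' (f : hom X X') (g : hom Y Y') : fmap G (tens X X' Y Y' f g) = tG X X' Y Y' f g.
  exact: (proj2_sig (constructive_indefinite_description _ (Gfull (tG X X' Y Y' f g)))).
pose al X Y Z := proj1_sig (constructive_indefinite_description _ (Gfull (aG X Y Z))).
have aE0 X Y Z : fmap G (al X Y Z) = aG X Y Z.
  exact: (proj2_sig (constructive_indefinite_description _ (Gfull (aG X Y Z)))).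
pose ul X := proj1_sig (constructive_indefinite_description _ (Gfull (lG X))).
have lE X : fmap G (ul X) = lG X.
  exact: (proj2_sig (constructive_indefinite_description _ (Gfull (lG X)))).
pose ur X := proj1_sig (constructive_indefinite_description _ (Gfull (rG X))).
have rE X : fmap G (ur X) = rG X.
  exact: (proj2_sig (constructive_indefinite_description _ (Gfull (rG X)))).
have tE X X' Y Y' (f : hom X X') (g : hom Y Y') :
    mu X' Y' \oc fmap G (tens X X' Y Y' f g) = fmap G f ** fmap G g \oc mu X Y.
  by rewrite tE0 /tG (comp_idR _ (munu _ _)).
have aE X Y Z : one ** mu Y Z \oc (mu X (T Y Z) \oc fmap G (al X Y Z)) =
    a (G X) (G Y) (G Z) \oc (mu X Y ** one \oc mu (T X Y) Z).
  by rewrite aE0 /aG (comp_idR _ (munu _ _)) tenmR comp1m munu tenm1 comp1m.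
have t1 X Y : tens X X Y Y one one = one.
  by apply: Gf; rewrite tE0 /tG !fmap1 tenm1 comp1m numu.
have tc X X' X'' Y Y' Y'' (f' : hom X' X'') (f : hom X X') (g' : hom Y' Y'') (g : hom Y Y') :
    tens X X'' Y Y'' (f' \oc f) (g' \oc g) = tens _ _ _ _ f' g' \oc tens _ _ _ _ f g.
  apply: Gf; apply: mono_mu.
  rewrite tE !fmap_comp (comp_eqR _ (tE _ _ _ _ _ _)) tE !compA tenmC.
  by [].
have tll X X' Y Y' (g : hom Y Y') : linear (fun f : hom X X' => tens _ _ _ _ f g).
  move=> c f f'; apply: Gf; apply: mono_mu.
  rewrite tE !(fmap_lin G c) (tenm_linl M _ c) compDl compZl compDr compZr !tE.
  by [].
have tlr X X' Y Y' (f : hom X X') : linear (fun g : hom Y Y' => tens _ _ _ _ f g).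
  move=> c g g'; apply: Gf; apply: mono_mu.
  rewrite tE !(fmap_lin G c) (tenm_linr M _ c) compDl compZl compDr compZr !tE.
  by [].
have ia X Y Z : is_iso (al X Y Z).
  apply: (reflect_iso Gf Gfull); rewrite aE0; apply: iso_comp; first exact: inu.
  apply: iso_comp; first by apply: tenm_iso; [apply: iso_id | apply: inu].
  apply: iso_comp; first exact: massoc_iso.
  by apply: iso_comp; [apply: tenm_iso; [|apply: iso_id] |]; apply: imu.
have il X : is_iso (ul X).
  apply: (reflect_iso Gf Gfull); rewrite lE; apply: iso_comp; first exact: munitl_iso.
  by apply: iso_comp; [apply: tenm_iso; [|apply: iso_id] |].
have ir X : is_iso (ur X).
  apply: (reflect_iso Gf Gfull); rewrite rE; apply: iso_comp; first exact: munitr_iso.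
  by apply: iso_comp; [apply: tenm_iso; [apply: iso_id|] |].
have mono_mu2 X Y Z : mono (one ** mu Y Z \oc mu X (T Y Z)).
  by apply: iso_mono; apply: iso_comp; [apply: tenm_iso; [apply: iso_id|] |].
have an X X' Y Y' Z Z' (f : hom X X') (g : hom Y Y') (h : hom Z Z') :
    al X' Y' Z' \oc tens _ _ _ _ (tens _ _ _ _ f g) h =
    tens _ _ _ _ f (tens _ _ _ _ g h) \oc al X Y Z.
  apply: Gf; apply: mono_mu2; rewrite !fmap_comp -!compA.
  rewrite [mu X' _ \oc (fmap G (al _ _ _) \oc _)]compA [LHS]compA aE -!compA tE tenmR tE comp1m.
  rewrite (comp_eqR _ (tE _ _ _ _ _ _)) tenmR tE comp1m.
  rewrite -[fmap G h]compm1 -tenmC -!compA (comp_eqR _ (massoc_nat _ _ _ _)) -aE.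
  by rewrite tenmR compm1 compm1.
have ln X X' (f : hom X X') : ul X' \oc tens _ _ _ _ one f = f \oc ul X.
  apply: Gf; rewrite !fmap_comp !lE /lG -!compA tE fmap1 tenmR compm1 comp1m.
  rewrite -[X in X ** fmap G f]comp1m -[X in _ ** X \oc _]compm1 -tenmC -!compA.
  by rewrite (comp_eqR _ (munitl_nat _ _)).
have rn X X' (f : hom X X') : ur X' \oc tens _ _ _ _ f one = f \oc ur X.
  apply: Gf; rewrite !fmap_comp !rE /rG -!compA tE fmap1 tenmR compm1 comp1m.
  rewrite -[X in fmap G f ** X]comp1m -[X in X ** _ \oc _]compm1 -tenmC -!compA.
  by rewrite (comp_eqR _ (munitr_nat _ _)).
have tri X Y : tens _ _ _ _ one (ul Y) \oc al X I Y = tens _ _ _ _ (ur X) one.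
  apply: Gf; apply: mono_mu; rewrite fmap_comp (comp_eqR _ (tE _ _ _ _ _ _)) tE !fmap1 lE rE.
  rewrite /lG /rG compA.
  have -> : idm (G X) ** (munitl M (G Y) \oc (u ** one \oc mu I Y)) =
      (one ** munitl M (G Y)) \oc ((one ** (u ** one)) \oc (one ** mu I Y)) by rewrite !tenmC !comp1m.
  rewrite -!compA aE -(comp_eqR _ (massoc_nat M _ _ _)) (comp_eqR1 _ (mtriangle _ _ _)).
  by rewrite !tenmR !comp1m !compA.
have pent W X Y Z :
    tens _ _ _ _ one (al X Y Z) \oc al W (T X Y) Z \oc tens _ _ _ _ (al W X Y) one =
    al W X (T Y Z) \oc al (T W X) Y Z.
  (* Three maps [mu] are composed on, to reach the fourfold product of the [G]-images where
     [mpentagon] lives. Below, [aR], [aT] and [bT] are the equation [aE] with a tail, plain or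
     tensored with an identity. *)
  apply: Gf; apply: mono_mu.
  apply: (iso_mono (tenm_iso M (iso_id (G W)) (imu X (T Y Z)))).
  apply: (iso_mono (tenm_iso M (iso_id (G W)) (tenm_iso M (iso_id (G X)) (imu Y Z)))).
  have aR X0 Y0 Z0 A (x : hom A (G (T (T X0 Y0) Z0))) : one ** mu Y0 Z0 \oc (mu X0 (T Y0 Z0) \oc (fmap G (al X0 Y0 Z0) \oc x)) =
    a (G X0) (G Y0) (G Z0) \oc (mu X0 Y0 ** one \oc (mu (T X0 Y0) Z0 \oc x)).
    by rewrite [mu _ _ \oc _]compA [LHS]compA aE -!compA.
  have aT A (x : hom A (ten M (G W) (G (T (T X Y) Z)))) : one ** (one ** mu Y Z) \oc
      (one ** mu X (T Y Z) \oc (one ** fmap G (al X Y Z) \oc x)) =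
      idm (G W) ** a (G X) (G Y) (G Z) \oc (one ** (mu X Y ** one) \oc (one ** mu (T X Y) Z \oc x)).
    by rewrite !tenmR !comp1m -!compA aE.
  have bT A (x : hom A (ten M (G (T (T W X) Y)) (G Z))) : one ** mu X Y ** one \oc
      (mu W (T X Y) ** one \oc (fmap G (al W X Y) ** one \oc x)) =
      a (G W) (G X) (G Y) ** idm (G Z) \oc (mu W X ** one ** one \oc (mu (T W X) Y ** one \oc x)).
    by rewrite !tenmR !comp1m -!compA aE.
  rewrite !fmap_comp -!compA (comp_eqR _ (tE _ _ _ _ _ _)) fmap1 aT aR.
  rewrite -(comp_eqR _ (massoc_nat M _ _ _)) tE fmap1 bT.
  rewrite [one ** _ \oc _]compA [one ** _ \oc _ \oc _]compA mpentagon -!compA.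
  rewrite aR -(comp_eqR _ (massoc_nat M _ _ _)) tenm1 [in RHS]tenmR comp1m compm1.
  rewrite [in RHS](tenm_splitl M (mu W X)) -[in RHS]compA aE.
  rewrite -[idm (ten M (G Y) (G Z))]tenm1 -(comp_eqR _ (massoc_nat M _ _ _)).
  by [].
exists (@Monoidal k R I T tens t1 tc tll tlr al ul ur ia il ir an ln rn tri pent).
exists u', nu; do !split=> //=.
- move=> X X' Y Y' f g; apply: mono_mu.
  by rewrite (comp_idR _ (munu _ _)) (comp_eqR _ (tE _ _ _ _ _ _)) munu compm1.
- move=> X Y Z; apply: mono_mu2; rewrite -!compA [mu _ _ \oc (fmap G _ \oc _)]compA.
  rewrite [LHS]compA aE -!compA (comp_idR _ (munu _ _)) tenmC comp1m munu tenm1 compm1.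
  by rewrite (comp_idR _ (munu _ _)) tenmR comp1m munu tenm1 comp1m.
- by move=> X; rewrite lE /lG -!compA (comp_idR _ (munu _ _)) tenmC comp1m uu' tenm1 compm1.
- by move=> X; rewrite rE /rG -!compA (comp_idR _ (munu _ _)) tenmC comp1m uu' tenm1 compm1.
Qed.
End Transport.

Section Inverse.
Context {k : fieldType} {C R : kCat k} (M : monoidal C) (N : monoidal R).
Variables (G : kFunctor R C) (E : kFunctor C R).
Hypotheses (Gf : faithful G) (Gfull : forall X Y (f : hom (G X) (G Y)), exists g : hom X Y, fmap G g = f).
Variable nu : forall X : C, hom (G (E X)) X.
Hypotheses (inu : forall X, is_iso (nu X))
  (nu_nat : forall X Y (f : hom X Y), f \oc nu X = nu Y \oc fmap G (fmap E f)).
Local Notation "f ** g" := (tenm M f g) (at level 40, left associativity).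
Local Notation one := (idm _).

(** The coherence maps of [E] are the mates of those of [G]: fullness produces [q] from the inverse
    of [p] conjugated by [nu]. The axioms are tested after applying [G] and precomposing with
    [p]. *)
Lemma inverse_strong : strong_monoidal N M G -> strong_monoidal M N E.
Proof.
case=> p0 [p [ip0 [ip [pn [pa [pl pr]]]]]].
have [nu' nu'P] := dep_choice inu.
have nn' X : nu X \oc nu' X = one := (nu'P X).2.
have n'n X : nu' X \oc nu X = one := (nu'P X).1.
have [p' p'P] := dep_choice (fun X => dep_choice (fun Y => ip X Y)).
have p'p X Y : p' X Y \oc p X Y = one := (p'P X Y).1.
have [p0' [p0'p p0p' ip0']] := is_iso_inv ip0.
have [q hq] := dep_choice (fun X => dep_choice (fun Y => Gfull
  (nu' (ten M X Y) \oc (nu X ** nu Y \oc p' (E X) (E Y))))).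
have [q0 hq0] := Gfull (nu' (unit_ob M) \oc p0').
have qE X Y : nu (ten M X Y) \oc (fmap G (q X Y) \oc p (E X) (E Y)) = nu X ** nu Y.
  by rewrite hq -!compA (comp_idR _ (nn' _)) p'p compm1.
have qR X Y A (x : hom A (ten M (G (E X)) (G (E Y)))) :
    nu (ten M X Y) \oc (fmap G (q X Y) \oc (p (E X) (E Y) \oc x)) = nu X ** nu Y \oc x.
  by rewrite -qE !compA.
have q0E : nu (unit_ob M) \oc (fmap G q0 \oc p0) = one.
  by rewrite hq0 -!compA (comp_idR _ (nn' _)) p0'p.
have nuR X Y (f : hom X Y) A (x : hom A (G (E X))) :
    nu Y \oc (fmap G (fmap E f) \oc x) = f \oc (nu X \oc x).
  by apply: comp_eqR; rewrite nu_nat.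
have pR X X' Y Y' (f : hom X X') (g : hom Y Y') A (x : hom A (ten M (G X) (G Y))) :
    fmap G (tenm N f g) \oc (p X Y \oc x) = p X' Y' \oc (fmap G f ** fmap G g \oc x).
  by apply: comp_eqR; rewrite pn.
have mono_nu X := iso_mono (inu X).
have epi_p X Y := iso_epi (ip X Y).
have in' X : is_iso (nu' X) by exists (nu X).
exists q0, q; split.
  by apply: (reflect_iso Gf Gfull); rewrite hq0; apply: iso_comp.
split.
  move=> X Y; apply: (reflect_iso Gf Gfull); rewrite hq; apply: iso_comp; first exact: in'.
  apply: iso_comp; first by apply: tenm_iso; apply: inu.
  by have [? ?] := p'P (E X) (E Y); exists (p (E X) (E Y)).
split; last split; last split.
- move=> X X' Y Y' f g; apply: Gf; apply: mono_nu; apply: epi_p.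
  by rewrite !fmap_comp -!compA -pn qR tenmC -!nu_nat -tenmC nuR qE.
- move=> X Y Z; apply: Gf; apply: mono_nu; apply: epi_p.
  apply: (iso_epi (tenm_iso M (ip (E X) (E Y)) (iso_id (G (E Z))))).
  have paR := pa (E X) (E Y) (E Z); rewrite -!compA in paR.
  rewrite !fmap_comp -!compA nuR paR !pR !qR !fmap1 !tenmC !tenmR -!compA.
  by rewrite !comp1m !compm1 !qE massoc_nat.
- move=> X; apply: Gf; apply: mono_nu; apply: epi_p.
  apply: (iso_epi (tenm_iso M ip0 (iso_id (G (E X))))).
  have plR := pl (E X); rewrite -!compA in plR.
  rewrite !fmap_comp -!compA nuR plR pR qR !fmap1 !tenmC -?compA !q0E.
  by rewrite !compm1 munitl_nat.
- move=> X; apply: Gf; apply: mono_nu; apply: epi_p.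
  apply: (iso_epi (tenm_iso M (iso_id (G (E X))) ip0)).
  have prR := pr (E X); rewrite -!compA in prR.
  rewrite !fmap_comp -!compA nuR prR pR qR !fmap1 !tenmC -?compA !q0E.
  by rewrite !compm1 munitr_nat.
Qed.
End Inverse.

Section ComposeStrong.
Context {k : fieldType} {R C D : kCat k}.
Variables (N : monoidal R) (M : monoidal C) (V : monoidal D).
Variables (G : kFunctor R C) (F : kFunctor C D) (U : kFunctor R D).
Variable sg : forall X : R, hom (F (G X)) (U X).
Hypotheses (isg : forall X, is_iso (sg X))
  (sg_nat : forall X Y (f : hom X Y), fmap U f \oc sg X = sg Y \oc fmap F (fmap G f)).
Local Notation "f ** g" := (tenm V f g) (at level 40, left associativity).
Local Notation one := (idm _).

(** The usual structure on the composite of [G] and [F], conjugated by [sg] to become one on [U]. *)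
Lemma compose_strong : strong_monoidal N M G -> strong_monoidal M V F ->
  strong_monoidal N V U.
Proof.
case=> p0 [p [ip0 [ip [pn [pa [pl pr]]]]]] [q0 [q [iq0 [iq [qn [qa [ql qr]]]]]]].
have [sg' sgP] := dep_choice isg.
have ss' X : sg X \oc sg' X = one := (sgP X).2.
have s's X : sg' X \oc sg X = one := (sgP X).1.
have is' X : is_iso (sg' X) by exists (sg X).
have sR X Y (f : hom X Y) A (x : hom A (F (G X))) :
    fmap U f \oc (sg X \oc x) = sg Y \oc (fmap F (fmap G f) \oc x).
  by apply: comp_eqR; rewrite sg_nat.
have s'n X Y (f : hom X Y) : sg' Y \oc fmap U f = fmap F (fmap G f) \oc sg' X.
  apply: (iso_mono (isg Y)); rewrite (comp_idR _ (ss' _)) compA -sg_nat -compA ss'.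
  by rewrite compm1.
exists (sg (unit_ob N) \oc (fmap F p0 \oc q0)).
exists (fun X Y => sg (ten N X Y) \oc (fmap F (p X Y) \oc (q (G X) (G Y) \oc (sg' X ** sg' Y)))).
split.
  by apply: iso_comp => //; apply: iso_comp => //; apply: fmap_iso.
split.
  move=> X Y; apply: iso_comp => //; apply: iso_comp; first exact: fmap_iso.
  by apply: iso_comp => //; apply: tenm_iso.
have qR X X' Y Y' (f : hom X X') (g : hom Y Y') A (x : hom A (ten V (F X) (F Y))) :
    q X' Y' \oc (fmap F f ** fmap F g \oc x) = fmap F (tenm M f g) \oc (q X Y \oc x).
  by apply: comp_eqR; rewrite qn.
have FR X Y Z (g : hom Y Z) (f : hom X Y) A (x : hom A (F X)) :
    fmap F g \oc (fmap F f \oc x) = fmap F (g \oc f) \oc x.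
  by apply: comp_eqR1; rewrite fmap_comp.
split; last split; last split.
- move=> X X' Y Y' f g; rewrite -!compA tenmC !s'n -tenmC sR; congr (_ \oc _).
  by rewrite FR -pn -FR qR.
- move=> X Y Z; rewrite -!compA sR; congr (_ \oc _).
  rewrite !tenmC !tenmR !compm1 !(comp_idR _ (s's _)).
  have -> : (fmap F (p X Y) \oc (q (G X) (G Y) \oc (sg' X ** sg' Y))) ** sg' Z =
      (fmap F (p X Y) ** fmap F one) \oc ((q (G X) (G Y) ** one) \oc ((sg' X ** sg' Y) ** sg' Z)).
    by rewrite !tenmC fmap1 !comp1m.
  have -> : sg' X ** (fmap F (p Y Z) \oc (q (G Y) (G Z) \oc (sg' Y ** sg' Z))) =
      (fmap F one ** fmap F (p Y Z)) \oc ((one ** q (G Y) (G Z)) \oc (sg' X ** (sg' Y ** sg' Z))).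
    by rewrite !tenmC fmap1 !comp1m.
  rewrite -!compA !qR !FR -massoc_nat pa -!FR; congr (_ \oc (_ \oc _)).
  by rewrite !compA qa.
- move=> X; rewrite -!compA sR tenmC !(comp_idR _ (s's _)) compm1.
  have -> : (fmap F p0 \oc q0) ** sg' X = (fmap F p0 ** fmap F one) \oc ((q0 ** one) \oc (one ** sg' X)).
    by rewrite !tenmC fmap1 !comp1m !compm1.
  rewrite qR !FR pl (compA (q _ _)) (compA (fmap F _)) (compA (fmap F _)) ql.
  by rewrite munitl_nat compA ss' comp1m.
- move=> X; rewrite -!compA sR tenmC !(comp_idR _ (s's _)) compm1.
  have -> : sg' X ** (fmap F p0 \oc q0) = (fmap F one ** fmap F p0) \oc ((one ** q0) \oc (sg' X ** one)).
    by rewrite !tenmC fmap1 !comp1m !compm1.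
  rewrite qR !FR pr (compA (q _ _)) (compA (fmap F _)) (compA (fmap F _)) qr.
  by rewrite munitr_nat compA ss' comp1m.
Qed.
End ComposeStrong.

(** * Quasi-inverses and invariance of exactness *)

Section ShortExactIso.
Context {k : fieldType} {C : kCat k}.
Implicit Types X Y Z A : C.

Lemma kernel_iso X Y Z X' Y' Z' (f : hom X Y) (g : hom Y Z) (f' : hom X' Y') (g' : hom Y' Z')
    (a : hom X X') (b : hom Y Y') (c : hom Z Z') :
  is_iso a -> is_iso b -> is_iso c -> f' \oc a = b \oc f -> g' \oc b = c \oc g ->
  is_kernel f g -> is_kernel f' g'.
Proof.
move=> ia [b' [b'b bb']] ic fa gb kf; have [a' [a'a aa']] := ia.
have f'E : f' = b \oc f \oc a' by rewrite -fa -compA aa' compm1.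
apply: kernelI.
- rewrite f'E; apply: mono_comp; last by apply: iso_mono; exists a.
  by apply: mono_comp (kernel_mono kf); apply: iso_mono; exists b'.
- by rewrite f'E !compA gb -(compA c) kf.1 compm0 comp0m.
- move=> A h gh; have [|u fu] := @kernel_lift _ _ _ _ _ _ _ _ (b' \oc h) kf.
    apply: (iso_mono ic); rewrite compA -gb compm0 -compA (compA b) bb' comp1m.
    exact: gh.
  by exists (a \oc u); rewrite compA fa -compA fu compA bb' comp1m.
Qed.

Lemma cokernel_iso X Y Z X' Y' Z' (f : hom X Y) (g : hom Y Z) (f' : hom X' Y') (g' : hom Y' Z')
    (a : hom X X') (b : hom Y Y') (c : hom Z Z') :
  is_iso a -> is_iso b -> is_iso c -> f' \oc a = b \oc f -> g' \oc b = c \oc g ->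
  is_cokernel g f -> is_cokernel g' f'.
Proof.
move=> ia [b' [b'b bb']] ic fa gb kf; have [c' [c'c cc']] := ic.
have g'E : g' = c \oc g \oc b' by rewrite -gb -compA bb' compm1.
apply: cokernelI.
- rewrite g'E; apply: epi_comp; last by apply: iso_epi; exists b.
  by apply: epi_comp (cokernel_epi kf); apply: iso_epi; exists c'.
- apply: (iso_epi ia); rewrite -compA fa g'E -!compA (compA b') b'b comp1m kf.1.
  by rewrite compm0 comp0m.
- move=> A h hf; have [|u ug] := @cokernel_lift _ _ _ _ _ _ _ _ (h \oc b) kf.
    by rewrite -compA -fa compA hf comp0m.
  by exists (u \oc c'); rewrite g'E -!compA (compA c') c'c comp1m compA ug -compA bb' compm1.
Qed.

End ShortExactIso.

Lemma fmap0 (k : fieldType) (C D : kCat k) (G : kFunctor C D) (X Y : C) :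
  fmap G (0 : hom X Y) = 0.
Proof.
have := fmap_lin G (-1) (0 : hom X Y) 0.
by rewrite scaler0 addr0 scaleN1r addNr.
Qed.

Section InverseFunctor.
Context {k : fieldType} {C R : kCat k} (E : kFunctor C R).
Hypotheses (Ef : faithful E) (Efull : forall X Y (f : hom (E X) (E Y)), exists g : hom X Y, fmap E g = f)
  (Ess : forall Y : R, exists X : C, isomorphic (E X) Y).

Lemma inverse_functor : exists (G : kFunctor R C) (ep : forall Y : R, hom (E (G Y)) Y),
  (forall Y, is_iso (ep Y)) /\ forall X Y (f : hom X Y), f \oc ep X = ep Y \oc fmap E (fmap G f).
Proof.
have [g0 hg0] := dep_choice Ess.
have [ep iep] := dep_choice hg0.
have [ep' epP] := dep_choice iep.
have [gm gmE] := dep_choice (fun X => dep_choice (fun Y => dep_choice (fun f : hom X Y =>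
  Efull (ep' Y \oc f \oc ep X)))).
have nat X Y (f : hom X Y) : f \oc ep X = ep Y \oc fmap E (gm X Y f).
  by rewrite gmE !compA (epP Y).2 comp1m.
have m1 X : gm X X (idm X) = idm (g0 X).
  by apply: Ef; rewrite gmE compm1 (epP X).1 fmap1.
have mc X Y Z (g : hom Y Z) (f : hom X Y) : gm X Z (g \oc f) = gm Y Z g \oc gm X Y f.
  apply: Ef; apply: (iso_mono (iep Z)).
  by rewrite -nat fmap_comp compA -nat -!compA nat.
have ml X Y : linear (gm X Y).
  move=> a f g; apply: Ef; apply: (iso_mono (iep Y)).
  by rewrite -nat (fmap_lin E a) compDl compZl compDr compZr !nat.
by exists (KFunctor m1 mc ml), ep.
Qed.

Variables (G : kFunctor R C) (ep : forall Y : R, hom (E (G Y)) Y).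
Hypotheses (iep : forall Y, is_iso (ep Y))
  (ep_nat : forall X Y (f : hom X Y), f \oc ep X = ep Y \oc fmap E (fmap G f)).

Lemma inverse_faithful : faithful G.
Proof. by move=> X Y f g e; apply: (iso_epi (iep X)); rewrite !ep_nat e. Qed.

Lemma inverse_full X Y (f : hom (G X) (G Y)) : exists g : hom X Y, fmap G g = f.
Proof.
have [e' [e'e ee' _]] := is_iso_inv (iep X).
exists (ep Y \oc fmap E f \oc e'); apply: Ef; apply: (iso_mono (iep Y)).
by rewrite -ep_nat -compA e'e compm1.
Qed.

Lemma inverse_unit : exists nu : forall X : C, hom (G (E X)) X,
  (forall X, is_iso (nu X)) /\ forall X Y (f : hom X Y), f \oc nu X = nu Y \oc fmap G (fmap E f).
Proof.
have [nu nuE] := dep_choice (fun X => Efull (ep (E X))).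
exists nu; split=> [X|X Y f].
  by apply: (reflect_iso Ef Efull); rewrite nuE.
by apply: Ef; rewrite !fmap_comp !nuE ep_nat.
Qed.

Lemma inverse_equivalence : is_equivalence E.
Proof.
have [nu [inu nuN]] := inverse_unit; exists G; split; last by exists ep.
have [nu' nuP] := dep_choice inu; exists nu'; split=> [X|X Y f].
  by exists (nu X); have [] := nuP X.
apply: (iso_mono (inu Y)); rewrite !compA -nuN (nuP Y).2 comp1m -compA (nuP X).2.
by rewrite compm1.
Qed.

(** The universal properties are moved by hand: through [nu], every test map into or out of an
    object [G B] becomes [G] of a map. *)
Lemma inverse_short_exact X Y Z (f : hom X Y) (g : hom Y Z) :
  short_exact f g -> short_exact (fmap G f) (fmap G g).
Proof.
have [nu [inu nuN]] := inverse_unit.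
have Gf := inverse_faithful; have Gfull := inverse_full.
have lift A B (h : hom A (G B)) : exists h' : hom (E A) B, h \oc nu A = fmap G h'.
  by have [h' e] := Gfull _ _ (h \oc nu A); exists h'.
have colift A B (h : hom (G B) A) : exists h' : hom B (E A), h = nu A \oc fmap G h'.
  have [n [_ nn _]] := is_iso_inv (inu A).
  by have [h' e] := Gfull _ _ (n \oc h); exists h'; rewrite e compA nn comp1m.
case=> kf cg; split.
  apply: kernelI.
  - apply: mono0 => A h fh; have [h' e] := lift _ _ h.
    apply: (iso_epi (inu A)); rewrite e comp0m (_ : h' = 0) ?fmap0 //.
    apply: (mono_eq0 (kernel_mono kf)); apply: Gf.
    by rewrite fmap_comp -e compA fh comp0m fmap0.
  - by rewrite -fmap_comp kf.1 fmap0.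
  - move=> A h gh; have [h' e] := lift _ _ h; have [n [_ nn _]] := is_iso_inv (inu A).
    have [|u fu] := @kernel_lift _ _ _ _ _ _ _ _ h' kf.
      by apply: Gf; rewrite fmap_comp -e compA gh comp0m fmap0.
    by exists (fmap G u \oc n); rewrite compA -fmap_comp fu -e -compA nn compm1.
apply: cokernelI.
- apply: epi0 => A h hg; have [h' e] := colift _ _ h.
  rewrite e (_ : h' = 0) ?fmap0 ?compm0 //; apply: (epi_eq0 (cokernel_epi cg)); apply: Gf.
  by apply: (iso_mono (inu A)); rewrite fmap_comp compA -e hg fmap0 compm0.
- by rewrite -fmap_comp cg.1 fmap0.
- move=> A h hf; have [h' e] := colift _ _ h.
  have [|u ug] := @cokernel_lift _ _ _ _ _ _ _ _ h' cg.
    by apply: Gf; apply: (iso_mono (inu A)); rewrite fmap_comp compA -e hf fmap0 compm0.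
  by exists (nu A \oc fmap G u); rewrite -compA -fmap_comp ug -e.
Qed.
End InverseFunctor.

Theorem transport_fiber_functor (k : fieldType) (C R : kCat k) (M : monoidal C)
    (E : kFunctor C R) (F : kFunctor C (Vec k)) (U : kFunctor R (Vec k))
    (sg : forall X : C, hom (U (E X)) (F X)) :
  faithful E -> (forall X Y (f : hom (E X) (E Y)), exists g : hom X Y, fmap E g = f) ->
  (forall Y : R, exists X : C, isomorphic (E X) Y) ->
  (forall X, is_iso (sg X)) ->
  (forall X Y (f : hom X Y), sg Y \oc fmap U (fmap E f) = fmap F f \oc sg X) ->
  fiber_functor M F ->
  exists N : monoidal R, fiber_functor N U /\ monoidally_equivalent M N.
Proof.
move=> Ef Efull Ess isg sgN [sF Fex Ff].
have [G [ep [iep epN]]] := inverse_functor Ef Efull Ess.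
have Gf := inverse_faithful iep epN; have Gfull := inverse_full Ef iep epN.
have [nu [inu nuN]] := inverse_unit Ef Efull iep epN.
(* The product of [X] and [Y] in [R] is [E] of the product of [G X] and [G Y], the unit is [E] of
   the unit, and [nu] supplies the comparison maps. *)
have [N sG] := transport_monoidal Gf Gfull (inu (unit_ob M)) (fun X Y => inu (ten M (G X) (G Y))).
have [sg' sgP] := dep_choice isg.
have [tau [itau tauN]] : exists tau : forall X : R, hom (F (G X)) (U X),
    (forall X, is_iso (tau X)) /\
    forall X Y (f : hom X Y), fmap U f \oc tau X = tau Y \oc fmap F (fmap G f).
  exists (fun X => fmap U (ep X) \oc sg' (G X)); split=> [X|X Y f].
    apply: iso_comp; first exact: fmap_iso.
    by have [? ?] := sgP (G X); exists (sg (G X)).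
  rewrite compA -fmap_comp epN fmap_comp -!compA; congr (_ \oc _).
  apply: (iso_mono (isg (G Y))); rewrite compA sgN -compA (sgP _).2 compm1.
  by rewrite compA (sgP _).2 comp1m.
exists N; split; last first.
  exists E; split; last exact: (inverse_equivalence Ef Efull iep epN).
  exact: (inverse_strong Gf Gfull inu nuN sG).
split.
- exact: (compose_strong itau tauN sG sF).
- move=> X Y Z f g /(inverse_short_exact Ef Efull iep epN)/Fex[kf cg]; split.
    by apply: kernel_iso (itau X) (itau Y) (itau Z) _ _ kf.
  by apply: cokernel_iso (itau X) (itau Y) (itau Z) _ _ cg.
- move=> X Y f g e; apply: Gf; apply: Ff; apply: (iso_mono (itau Y)).
  by rewrite -!tauN e.
Qed.

(** * Finite type implies positivity of the Tits form *)

Section Homogeneous.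
Variables (k : fieldType) (V : finType).
Implicit Types (phi psi : (V -> k) -> k) (x : V -> k).

(** A form of degree [L], seen as a function and certified by a list of coefficients and words in
    the variables. With words, products of monomials are concatenations. *)
Definition homog L phi := exists s : seq (k * seq V),
  all (fun cw => size cw.2 == L) s /\
  forall x, phi x = \sum_(cw <- s) cw.1 * \prod_(v <- cw.2) x v.

Lemma homog_ext L phi psi : phi =1 psi -> homog L phi -> homog L psi.
Proof. by move=> e [s [hs h]]; exists s; split=> // x; rewrite -e. Qed.

Lemma homog_cst c : homog 0 (fun=> c).
Proof. by exists [:: (c, [::])]; split=> // x; rewrite big_seq1 big_nil mulr1. Qed.

Lemma homog_var v : homog 1 (fun x => x v).
Proof. by exists [:: (1, [:: v])]; split=> // x; rewrite !big_seq1 mul1r. Qed.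

Lemma homog0 L : homog L (fun=> 0).
Proof. by exists [::]; split=> // x; rewrite big_nil. Qed.

Lemma homogD L phi psi : homog L phi -> homog L psi -> homog L (fun x => phi x + psi x).
Proof.
move=> [s [hs h]] [s' [hs' h']]; exists (s ++ s'); rewrite all_cat hs hs'; split=> // x.
by rewrite big_cat h h'.
Qed.

Lemma homogM L L' phi psi : homog L phi -> homog L' psi -> homog (L + L') (fun x => phi x * psi x).
Proof.
move=> [s [hs h]] [s' [hs' h']].
exists [seq (c.1 * c'.1, c.2 ++ c'.2) | c <- s, c' <- s']; split.
  apply/allP => cw /allpairsP[[c c'] /= [cs cs' ->]] /=.
  by rewrite size_cat (eqP (allP hs _ cs)) (eqP (allP hs' _ cs')).
move=> x; rewrite big_allpairs_dep h h' mulr_suml; apply: eq_bigr => c _.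
rewrite mulr_sumr; apply: eq_bigr => c' _ /=.
by rewrite big_cat /= mulrACA.
Qed.

Lemma homogZ L c phi : homog L phi -> homog L (fun x => c * phi x).
Proof. by move=> h; exact: (homogM (homog_cst c) h). Qed.

Lemma homog_sum L I (r : seq I) (P : pred I) (phi : I -> (V -> k) -> k) :
  (forall i, P i -> homog L (phi i)) -> homog L (fun x => \sum_(i <- r | P i) phi i x).
Proof.
move=> h; elim: r => [|i r IH].
  by apply: homog_ext (homog0 L) => x; rewrite big_nil.
case Pi: (P i); last by apply: homog_ext IH => x; rewrite big_cons Pi.
by apply: homog_ext (homogD (h i Pi) IH) => x; rewrite big_cons Pi.
Qed.

Lemma homog_prod I (r : seq I) (P : pred I) (L : I -> nat) (phi : I -> (V -> k) -> k) :
  (forall i, P i -> homog (L i) (phi i)) ->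
  homog (\sum_(i <- r | P i) L i)%N (fun x => \prod_(i <- r | P i) phi i x).
Proof.
move=> h; elim: r => [|i r IH].
  by rewrite big_nil; apply: homog_ext (homog_cst 1) => x; rewrite big_nil.
rewrite big_cons; case Pi: (P i); last by apply: homog_ext IH => x; rewrite big_cons Pi.
by apply: homog_ext (homogM (h i Pi) IH) => x; rewrite big_cons Pi.
Qed.

Lemma homogX L n phi : homog L phi -> homog (n * L) (fun x => phi x ^+ n).
Proof.
move=> h; elim: n => [|n IH]; first exact: homog_cst.
by apply: homog_ext (homogM h IH) => x; rewrite exprS.
Qed.

Lemma homog_det n (A : (V -> k) -> 'M[k]_n) : (forall i j, homog 1 (fun x => A x i j)) ->
  homog n (fun x => \det (A x)).
Proof.
move=> h; apply: homog_sum => s _; apply: homogZ.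
have {1}-> : n = (\sum_(i < n) 1)%N by rewrite sum1_card card_ord.
by apply: homog_prod => i _; apply: h.
Qed.

Lemma homog_adj n (A : (V -> k) -> 'M[k]_n) i j : (forall i j, homog 1 (fun x => A x i j)) ->
  homog n.-1 (fun x => (\adj (A x)) i j).
Proof.
move=> h; apply: (@homog_ext _ (fun x => cofactor (A x) j i)) => [x|]; first by rewrite mxE.
apply: homogZ; apply: (@homog_det _ (fun x => row' j (col' i (A x)))) => a b.
by apply: (homog_ext _ (h (lift j a) (lift i b))) => x; rewrite !mxE.
Qed.

Definition monomials L := {mu : {ffun V -> 'I_L.+1} | (\sum_v mu v)%N == L}.

Lemma prod_count x (w : seq V) : \prod_(v <- w) x v = \prod_v x v ^+ count_mem v w.
Proof.
elim: w => [|a w IH]; first by rewrite big_nil big1.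
rewrite big_cons IH [in RHS](bigD1 a) //= eqxx exprS -mulrA; congr (_ * _).
rewrite (bigD1 a) //=; congr (_ * _); apply: eq_bigr => v va.
by rewrite eq_sym (negPf va).
Qed.

Lemma sum_count (w : seq V) : (\sum_v count_mem v w)%N = size w.
Proof.
elim: w => [|a w IH]; first by rewrite big1.
by rewrite /= big_split /= IH (bigD1 a) //= eqxx big1 // => v /negPf; rewrite eq_sym => ->.
Qed.

Lemma homog_expand L phi : homog L phi ->
  exists c : monomials L -> k, forall x, phi x = \sum_mu c mu * \prod_v x v ^+ val mu v.
Proof.
case=> s [hs h].
exists (fun mu : monomials L => \sum_(cw <- s | [forall v, count_mem v cw.2 == val mu v]) cw.1) => x.
rewrite h; under [in RHS]eq_bigr do rewrite big_distrl.
rewrite (exchange_big_dep predT) //=; apply: eq_big_seq => -[c w] /(allP hs)/= /eqP sw.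
have cL v : (count_mem v w < L.+1)%N by rewrite ltnS -sw count_size.
pose mu0 := [ffun v => Ordinal (cL v)] : {ffun V -> 'I_L.+1}.
have h0 : (\sum_v mu0 v)%N == L.
  by rewrite -[X in _ == X]sw -sum_count; apply/eqP/eq_bigr => v _; rewrite ffunE.
rewrite (big_pred1 (Sub mu0 h0 : monomials L)) => [|mu].
  by rewrite prod_count SubK; congr (_ * _); apply: eq_bigr => v _; rewrite ffunE.
apply/forallP/eqP => [e|-> v]; last by rewrite SubK ffunE.
by apply/val_inj/ffunP => v; apply/val_inj; rewrite SubK ffunE /= (eqP (e v)).
Qed.

(** In fixed degree the exponent of [v0] is determined by the others, which saves one variable. *)
Lemma card_monomials L (v0 : V) : (#|{: monomials L}| <= L.+1 ^ #|V|.-1)%N.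
Proof.
have <- : #|{ffun {v : V | v != v0} -> 'I_L.+1}| = (L.+1 ^ #|V|.-1)%N.
  by rewrite card_ffun card_ord card_sig cardC1.
pose f (mu : monomials L) := [ffun v : {v : V | v != v0} => val mu (val v)].
apply: (@leq_card _ _ f) => mu nu /ffunP e.
have e' v : v != v0 -> val mu v = val nu v by move=> vv; have := e (Sub v vv); rewrite !ffunE SubK.
apply/val_inj/ffunP => v; case: (eqVneq v v0) => [->|]; last exact: e'.
apply/val_inj; have := etrans (eqP (valP mu)) (esym (eqP (valP nu))).
rewrite (bigD1 v0) //= [in RHS](bigD1 v0) //= (eq_bigr _ (fun v h => congr1 val (e' v h))).
by move/addIn.
Qed.

(** There are more forms than monomials, so the coefficient matrix has a nonzero left kernel; a
    vector in it is a relation. *)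
Lemma homog_dependent (J : finType) L (v0 : V) (phi : J -> (V -> k) -> k) :
  (L.+1 ^ #|V|.-1 < #|J|)%N -> (forall j, homog L (phi j)) ->
  exists c : J -> k, (exists j, c j != 0) /\ forall x, \sum_j c j * phi j x = 0.
Proof.
move=> lt h; have [c hc] := dep_choice (fun j => homog_expand (h j)).
pose A := \matrix_(i < #|J|, l < #|{: monomials L}|) c (enum_val i) (enum_val l).
have : kermx A != 0.
  rewrite -mxrank_eq0 mxrank_ker subn_eq0 -ltnNge.
  exact: leq_ltn_trans (rank_leq_col A) (leq_ltn_trans (card_monomials L v0) lt).
case/rowV0Pn => r /sub_kermxP rA r0.
exists (fun j => r 0 (enum_rank j)); split.
  apply/existsP; apply: contraNT r0; rewrite negb_exists => /forallP h0.
  by apply/eqP/rowP => i; rewrite mxE; have /negPn/eqP := h0 (enum_val i); rewrite enum_valK.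
move=> x; under eq_bigr => j _ do rewrite hc mulr_sumr.
rewrite exchange_big big1 //= => mu _.
under eq_bigr => j _ do rewrite mulrA.
rewrite -mulr_suml; suff -> : \sum_i r 0 (enum_rank i) * c i mu = 0 by rewrite mul0r.
have := congr1 (fun B : 'M_(_, _) => B 0 (enum_rank mu)) rA; rewrite !mxE => e0; rewrite -[RHS]e0.
rewrite (reindex (@enum_val J predT)) /=; last exact: (onW_bij _ (@enum_val_bij J)).
by apply: eq_bigr => i _; rewrite mxE enum_valK enum_rankK.
Qed.

End Homogeneous.

(** * Representation spaces and polynomial relations on orbits *)

Section Orbit.
Variables (k : fieldType) (Q : quiver) (d : vertex Q -> nat).

Definition group_index : finType := {i : vertex Q & ('I_(d i) * 'I_(d i))%type}.
Definition rep_index : finType := {a : arrow Q & ('I_(d (src a)) * 'I_(d (tgt a)))%type}.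

Lemma card_group_index : #|group_index| = (\sum_i d i ^ 2)%N.
Proof.
rewrite card_tagged sumnE big_map big_enum /=.
by apply: eq_bigr => i _; rewrite card_prod card_ord.
Qed.
Lemma card_rep_index : #|rep_index| = (\sum_a d (src a) * d (tgt a))%N.
Proof.
rewrite card_tagged sumnE big_map big_enum /=.
by apply: eq_bigr => i _; rewrite card_prod !card_ord.
Qed.

Definition rep_mx := forall a : arrow Q, 'M[k]_(d (src a), d (tgt a)).
Definition coef (A : rep_mx) (e : rep_index) : k := A (tag e) (tagged e).1 (tagged e).2.

Definition equivalent_mx (A B : rep_mx) := exists g : forall i, 'M[k]_(d i),
  (forall i, g i \in unitmx) /\ forall a, A a *m g (tgt a) = g (src a) *m B a.

Definition group_mx (x : group_index -> k) i : 'M[k]_(d i) :=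
  \matrix_(r, c) x (Tagged (fun i => ('I_(d i) * 'I_(d i))%type) (r, c)).

Let Dg := (\sum_i d i)%N.

(* On the orbit of B the coordinate e is numerator B e / total_det. Both are
   homogeneous of degree Dg in the entries of the group element, so a scalar is
   lost: an orbit has dimension at most #|group_index| - 1. *)
Definition total_det x := \prod_i \det (group_mx x i).
Definition numerator (B : rep_mx) (e : rep_index) x :=
  (group_mx x (src (tag e)) *m B (tag e) *m \adj (group_mx x (tgt (tag e)))) (tagged e).1 (tagged e).2
  * \prod_(v | v != tgt (tag e)) \det (group_mx x v).

Lemma group_mx_homog i r c : homog 1 (fun x => group_mx x i r c).
Proof. by apply: (homog_ext _ (homog_var k _)) => x; rewrite mxE. Qed.

Lemma total_det_homog : homog Dg total_det.
Proof. by apply: homog_prod => i _; apply: homog_det => r c; apply: group_mx_homog. Qed.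

Lemma numerator_homog B e : homog Dg (numerator B e).
Proof.
case: e => a [r c]; suff : homog Dg (fun x : group_index -> k =>
    (group_mx x (src a) *m B a *m \adj (group_mx x (tgt a))) r c *
    \prod_(v | v != tgt a) \det (group_mx x v)) by [].
have dt : (0 < d (tgt a))%N by apply: leq_ltn_trans (ltn_ord c).
(* One degree comes from the matrix at the source, the size less one from the adjugate at the
   target, the rest from the other determinants. The index [c] shows that the size at the target is
   positive. *)
have -> : Dg = (1 + (d (tgt a)).-1 + \sum_(v | v != tgt a) d v)%N.
  by rewrite /Dg (bigD1 (tgt a)) //= add1n prednK.
have h2 : homog (\sum_(v | v != tgt a) d v) (fun x => \prod_(v | v != tgt a) \det (group_mx x v)).
  by apply: homog_prod => i _; apply: homog_det => r' c'; apply: group_mx_homog.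
have h1 j : homog 1 (fun x => \sum_i group_mx x (src a) r i * B a i j).
  apply: homog_sum => i _.
  exact: (homogM (group_mx_homog r i) (homog_cst group_index (B a i j))).
have h3 j : homog (d (tgt a)).-1 (fun x => (\adj (group_mx x (tgt a))) j c).
  by apply: homog_adj => r' c'; apply: group_mx_homog.
have h4 : homog (1 + (d (tgt a)).-1) (fun x => \sum_j (\sum_i group_mx x (src a) r i * B a i j) *
    (\adj (group_mx x (tgt a))) j c).
  by apply: homog_sum => j _; exact: (homogM (h1 j) (h3 j)).
apply: (homog_ext _ (homogM h4 h2)) => x; congr (_ * _).
rewrite [RHS]mxE; apply: eq_bigr => j _; congr (_ * _); by rewrite [RHS]mxE.
Qed.

Definition group_coef (g : forall i, 'M[k]_(d i)) (e : group_index) : k :=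
  g (tag e) (tagged e).1 (tagged e).2.

Lemma group_coefK g i : group_mx (group_coef g) i = g i.
Proof. by apply/matrixP => r c; rewrite mxE. Qed.

Lemma coef_numerator A B g e : (forall a, A a *m g (tgt a) = g (src a) *m B a) ->
  total_det (group_coef g) * coef A e = numerator B e (group_coef g).
Proof.
case: e => a [r c] h; rewrite /total_det /numerator /coef /=.
under eq_bigr do rewrite group_coefK; under [in RHS]eq_bigr do rewrite group_coefK.
rewrite !group_coefK -h -mulmxA mul_mx_adj (bigD1 (tgt a)) //= mulrAC; congr (_ * _).
by rewrite -scalemx1 -scalemxAr mulmx1 mxE.
Qed.

Variables (n : nat) (v0 : vertex Q).
Hypothesis dv0 : (0 < d v0)%N.
Hypothesis bound : ((#|rep_index| * n * Dg).+1 ^ #|group_index|.-1 < n ^ #|rep_index|)%N.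

(** The [n ^ #|rep_index|] monomials with exponents below [n] are pulled back along the orbit map of
    [B]. Cleared of denominators they become forms of one degree, and [bound] says that there are
    too many of them to be independent. *)
Lemma orbit_relation (B : rep_mx) : exists c : {ffun rep_index -> 'I_n} -> k,
  (exists al, c al != 0) /\
  forall A, equivalent_mx A B -> \sum_al c al * \prod_e coef A e ^+ al e = 0.
Proof.
pose w (al : {ffun rep_index -> 'I_n}) := (\sum_e al e)%N.
have wN al : (w al <= #|rep_index| * n)%N.
  rewrite -sum_nat_const; apply: leq_sum => e _; exact: ltnW.
(* The power of [total_det] pads all monomials to a common degree. On the orbit every [phi al] is
   the same power of [total_det] times a monomial in the entries of [A], so the determinant cancels
   from the relation. *)
pose phi al x := total_det x ^+ (#|rep_index| * n - w al) * \prod_e numerator B e x ^+ al e.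
have hphi al : homog (#|rep_index| * n * Dg)%N (phi al).
  have -> : (#|rep_index| * n * Dg)%N =
      ((#|rep_index| * n - w al) * Dg + \sum_e al e * Dg)%N.
    by rewrite -big_distrl /= -mulnDl subnK.
  apply: homogM; first exact/homogX/total_det_homog.
  by apply: homog_prod => e _; apply/homogX/numerator_homog.
pose z0 : group_index := Tagged (fun i => ('I_(d i) * 'I_(d i))%type) (Ordinal dv0, Ordinal dv0).
have [|c [c0 hc]] := homog_dependent z0 _ hphi.
  by rewrite card_ffun card_ord.
exists c; split=> // A [g [gu gA]].
have dg : total_det (group_coef g) != 0.
  apply/prodf_neq0 => i _; rewrite group_coefK.
  by have := gu i; rewrite unitmxE unitfE.
apply: (mulfI (expf_neq0 (#|rep_index| * n)%N dg)); rewrite mulr0 -[RHS](hc (group_coef g)).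
rewrite mulr_sumr; apply: eq_bigr => al _; rewrite mulrCA; congr (_ * _).
rewrite /phi -{1}(subnK (wN al)) exprD -mulrA; congr (_ * _).
rewrite /w -prodrXr -big_split; apply: eq_bigr => e _ /=.
by rewrite -exprMn (coef_numerator _ gA).
Qed.

End Orbit.

Section Digits.
Variable b : nat.

Lemma digits_inj n (f g : 'I_n -> 'I_b) :
  (\sum_i f i * b ^ i = \sum_i g i * b ^ i)%N -> f =1 g.
Proof.
elim: n f g => [|n IH] f g; first by move=> _ [].
rewrite !big_ord_recl /= !expn0 !muln1.
have shift (h : 'I_n.+1 -> 'I_b) : (\sum_(i < n) h (lift ord0 i) * b ^ bump 0 i =
    (\sum_(i < n) h (lift ord0 i) * b ^ i) * b)%N.
  by rewrite big_distrl /=; apply: eq_bigr => i _; rewrite /bump /= add1n expnSr mulnA.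
rewrite !shift => e.
have e0 : f ord0 = g ord0.
  apply/val_inj; have := congr1 (fun x => x %% b)%N e.
  by rewrite !(addnC _ (_ * b)%N) !modnMDl !modn_small // /=.
have b0 : (0 < b)%N by apply: leq_ltn_trans (ltn_ord (f ord0)).
have /IH e1 : (\sum_(i < n) f (lift ord0 i) * b ^ i = \sum_(i < n) g (lift ord0 i) * b ^ i)%N.
  by apply/eqP; rewrite -(eqn_pmul2r b0); move: e; rewrite e0 => /addnI/eqP.
by move=> i; case: (unliftP ord0 i) => [j|] ->.
Qed.
End Digits.

(* The points of the curve t |-> (t ^ (b ^ i))_i separate the monomials of
   degree less than b in each variable, so that finitely many nonzero
   polynomials become nonzero polynomials in t. *)
Lemma curve_avoids (k : closedFieldType) (J : finType) b (T : finType)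
    (c : T -> {ffun J -> 'I_b} -> k) : (forall t, exists al, c t al != 0) ->
  exists x : J -> k, forall t, \sum_al c t al * \prod_j x j ^+ al j != 0.
Proof.
move=> h; pose enc (al : {ffun J -> 'I_b}) := (\sum_j al j * b ^ enum_rank j)%N.
have enc_inj : injective enc.
  move=> f g e; apply/ffunP => j.
  have s (h0 : {ffun J -> 'I_b}) : enc h0 = (\sum_(i < #|J|) h0 (enum_val i) * b ^ i)%N.
    rewrite /enc (reindex (@enum_val J predT)) /=; last exact: (onW_bij _ (@enum_val_bij J)).
    by apply: eq_bigr => i _; rewrite enum_valK.
  rewrite !s in e; have /(_ (enum_rank j)) := digits_inj (f := f \o enum_val) (g := g \o enum_val) e.
  by rewrite /= enum_rankK.
pose P t : {poly k} := \sum_al c t al *: 'X^(enc al).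
have P0 t : P t != 0.
  have [al ca] := h t; apply: contraNneq ca => e.
  have := congr1 (fun p : {poly k} => p`_(enc al)) e; rewrite coef0 coef_sum (bigD1 al) //=.
  rewrite coefZ coefXn eqxx mulr1 big1 ?addr0 => [->//|be ba].
  by rewrite coefZ coefXn (inj_eq enc_inj) eq_sym (negPf ba) mulr0.
have : \prod_t P t != 0 by apply/prodf_neq0 => t _.
case/closed_nonrootP => z; rewrite /root horner_prod prodf_seq_neq0 => /allP hz.
exists (fun j => z ^+ (b ^ enum_rank j)) => t.
have := hz t (mem_index_enum _); rewrite /= horner_sum; congr (_ != 0).
apply: eq_bigr => al _; rewrite hornerZ hornerXn; congr (_ * _).
by rewrite /enc -prodrXr; apply: eq_bigr => j _; rewrite -exprM mulnC.
Qed.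

(** If the group had at most as many coordinates as the space, each of the finitely many orbits
    would satisfy a nonzero equation, and [curve_avoids] finds a point violating all of them. *)
Lemma infinite_orbits (k : closedFieldType) (Q : quiver) (d : vertex Q -> nat) v0 (T : finType)
    (B : T -> rep_mx k d) : (0 < d v0)%N ->
  (forall A, exists t, equivalent_mx A (B t)) ->
  (\sum_a d (src a) * d (tgt a) < \sum_i d i ^ 2)%N.
Proof.
move=> dv0 hB; rewrite -card_rep_index -card_group_index ltnNge; apply/negP => le.
set m := #|_| in le; set N := #|_| in le; pose D := (\sum_i d i)%N.
have m0 : (0 < m)%N.
  by apply/card_gt0P; exists (Tagged (fun i => ('I_(d i) * 'I_(d i))%type) (Ordinal dv0, Ordinal dv0)).
(* With [q = N D + 1] one has [N n D + 1 <= n q], and the power [m - 1] of [n q] is below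
   [n ^ m <= n ^ N] as soon as [n] exceeds [q ^ (m - 1)]. *)
pose n := ((N * D).+1 ^ m.-1).+1.
have bd : ((N * n * D).+1 ^ m.-1 < n ^ N)%N.
  have n0 : (0 < n)%N by [].
  apply: leq_trans (leq_pexp2l n0 le); rewrite -(prednK m0) expnS.
  have le1 : ((N * n * D).+1 ^ m.-1 <= (n * (N * D).+1) ^ m.-1)%N.
    case: (m.-1) => // p; rewrite leq_exp2r // mulnS mulnCA mulnA.
    by rewrite -addn1 addnC leq_add2r.
  apply: leq_ltn_trans le1 _; rewrite expnMn mulnC ltn_pmul2r ?expn_gt0 //.
have [c hc] := dep_choice (fun t => orbit_relation dv0 bd (B t)).
have [x hx] := curve_avoids (fun t => (hc t).1).
pose A : rep_mx k d := fun a => \matrix_(r, s) x (Tagged (fun a => ('I_(d (src a)) * 'I_(d (tgt a)))%type) (r, s)).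
have AE : coef A =1 x by case=> a [r s]; rewrite /coef mxE.
have [t eqA] := hB A; have := hx t; rewrite -[X in X != 0](_ : 0 = _) ?eqxx //.
rewrite -[LHS]((hc t).2 A eqA); apply: eq_bigr => al _; congr (_ * _).
by apply: eq_bigr => e _; rewrite AE.
Qed.

(** * From finite type to finitely many orbits *)

Section FiniteClasses.
Context {k : fieldType} {C : kCat k} (ab : abelian C) (F : kFunctor C (Vec k)).
Hypotheses (Fex : exact_functor F) (Ff : faithful F) (ft : finite_type C).

Lemma direct_sum_isom (X Y A B A' B' : C) : is_direct_sum X A B -> is_direct_sum Y A' B' ->
  isomorphic A A' -> isomorphic B B' -> isomorphic X Y.
Proof.
move=> [i [j [p [q [pi qj pj qi ij]]]]] [i' [j' [p' [q' [pi' qj' pj' qi' ij']]]]].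
move=> [f [f' [f'f ff']]] [g [g' [g'g gg']]].
exists (i' \oc f \oc p + j' \oc g \oc q), (i \oc f' \oc p' + j \oc g' \oc q').
have R (A0 A1 A2 A3 : C) (x : hom A1 A2) (y : hom A0 A1) (z : hom A2 A3) (w : hom A0 A2) :
  x \oc y = w -> z \oc x \oc y = z \oc w by move=> <-; rewrite compA.
split; rewrite !compDl !compDr !compA.
  rewrite (R _ _ _ _ _ _ _ _ pi') (R _ _ _ _ _ _ _ _ pj') (R _ _ _ _ _ _ _ _ qj') (R _ _ _ _ _ _ _ _ qi').
  rewrite !compm1 !compm0 !comp0m addr0 add0r (R _ _ _ _ _ _ _ _ f'f) (R _ _ _ _ _ _ _ _ g'g).
  by rewrite !compm1.
rewrite (R _ _ _ _ _ _ _ _ pi) (R _ _ _ _ _ _ _ _ pj) (R _ _ _ _ _ _ _ _ qj) (R _ _ _ _ _ _ _ _ qi).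
rewrite !compm1 !compm0 !comp0m addr0 add0r (R _ _ _ _ _ _ _ _ ff') (R _ _ _ _ _ _ _ _ gg').
by rewrite !compm1.
Qed.

(** Induction on the dimension: an object is zero, indecomposable, or a sum of two objects of
    smaller dimension, and each kind contributes finitely many classes. *)
Lemma finitely_many_classes n : exists (T : finType) (L : T -> C),
  forall X : C, (dm F X <= n)%N -> exists t, isomorphic X (L t).
Proof.
have zero_isom (X Y : C) : is_zero X -> is_zero Y -> isomorphic X Y.
  by move=> zX zY; exists 0, 0; split; [apply: zX.1 | apply: zY.1].
have [Z zZ] := abelian_zero ab.
elim: n => [|n [T [L hL]]].
  exists unit, (fun=> Z) => X; rewrite leqn0 => /eqP/(dm0 Ff) zX.
  by exists tt; apply: zero_isom.
have [m [E hE]] := ft.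
have [S hS] := dep_choice (fun st : T * T => abelian_sum ab (L st.1) (L st.2)).
pose L' (x : (unit + 'I_m) + (T * T)) := match x with
  | inl (inl _) => Z | inl (inr i) => E i | inr st => S st end.
exists (((unit + 'I_m) + (T * T))%type : finType), L' => X dX.
case: (classic (is_zero X)) => [zX|nzX]; first by exists (inl (inl tt)); apply: zero_isom.
case: (classic (indecomposable X)) => [/hE[i Xi]|nX]; first by exists (inl (inr i)).
have [A [B [ds [nA nB]]]] : exists A B, is_direct_sum X A B /\ ~ is_zero A /\ ~ is_zero B.
  apply: NNPP => h; apply: nX; split=> // A B ds.
  case: (classic (is_zero A)) => [|nA]; [by left | right; apply: NNPP => nB].
  by apply: h; exists A, B.
move: dX; rewrite (sum_dim ab Fex ds) => dX.
have [|s As] := hL A.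
  by rewrite -ltnS; apply: leq_trans dX; rewrite -addn1 leq_add2l (dm_gt0 Ff nB).
have [|t Bt] := hL B.
  by rewrite -ltnS; apply: leq_trans dX; rewrite -add1n leq_add2r (dm_gt0 Ff nA).
by exists (inr (s, t)); apply: direct_sum_isom ds (hS (s, t)) As Bt.
Qed.

End FiniteClasses.

Section MatrixRep.
Variables (k : fieldType) (Q : quiver) (d : vertex Q -> nat).

Definition mxrep (A : rep_mx k d) : @rep k Q :=
  Representation (rsp := fun i => 'rV[k]_(d i) : vectType k) (fun a => linfun (mulmxr (A a))).

Lemma mxrep_isom A B : @isomorphic _ (Rep k Q) (mxrep A) (mxrep B) -> equivalent_mx A B.
Proof.
move=> [phi [psi [e1 e2]]].
pose g i : 'M[k]_(d i) := lin1_mx (rep_fun phi i).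
pose h i : 'M[k]_(d i) := lin1_mx (rep_fun psi i).
have gh i : g i *m h i = 1%:M.
  apply/row_matrixP => r; rewrite !rowE mulmxA !mul_rV_lin1 mulmx1.
  by rewrite -[RHS](rfun_id (V := mxrep A)) -[rep_id _]e1 [RHS]rfun_comp.
exists g; split=> [i|a]; first by have [] := mulmx1_unit (gh i).
have gE i (v : 'rV[k]_(d i)) : v *m g i = rep_fun phi i v := mul_rV_lin1 _ v.
apply/row_matrixP => r; rewrite !rowE !mulmxA !gE.
have rmapE D i (v : 'rV[k]_(d (src i))) : rmap (mxrep D) i v = v *m D i.
  exact: (lfunE (mulmxr (D i)) v).
have := rfun_nat (a := a) phi (delta_mx 0 r : 'rV[k]_(d (src a))).
by rewrite !rmapE => e; rewrite e.
Qed.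

End MatrixRep.

(** Positivity of the Tits form at nonzero dimension vectors. Objects of [C] giving representations
    of vector [d] have one common dimension, hence fall into finitely many classes, and isomorphic
    representations have equivalent matrices. *)
Theorem weakly_positive (k : closedFieldType) (C : kCat k) (F : kFunctor C (Vec k)) (Q : quiver)
    (d : vertex Q -> nat) (v0 : vertex Q) :
  abelian C -> exact_functor F -> faithful F -> finite_type C -> presentation F Q ->
  (0 < d v0)%N -> (\sum_a d (src a) * d (tgt a) < \sum_i d i ^ 2)%N.
Proof.
move=> ab Fex Ff ft p dv0.
pose c := dim (dsum (fun i : vertex Q => 'rV[k]_(d i) : vectType k)).
have dimX X (A : rep_mx k d) : @isomorphic _ (Rep k Q) (toRep ab Fex Ff p X) (mxrep A) -> dm F X = c.
  case=> phi iphi; rewrite /dm dimvf -(vec_iso_dim (forget_iso_is_iso ab Fex Ff p X)).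
  exact: (vec_iso_dim (fmap_iso (forgetful k Q) iphi)).
have [T [L hL]] := finitely_many_classes ab Fex Ff ft c.
pose real t (A : rep_mx k d) := exists X, @isomorphic _ (Rep k Q) (toRep ab Fex Ff p X) (mxrep A) /\ isomorphic X (L t).
have [B hB] : exists B : T -> rep_mx k d, forall t A, real t A -> real t (B t).
  suff ex t : exists B : rep_mx k d, forall A, real t A -> real t B.
    by have [B hB] := dep_choice ex; exists B.
  case: (classic (exists A, real t A)) => [[A h]|h]; first by exists A.
  (* A class realised by no matrices of this size gets a dummy representative. *)
  by exists (fun a => 0) => A rA; case: h; exists A.
apply: (infinite_orbits (B := B) dv0) => A.
have [X XA] := toRep_ess_surj ab Fex Ff p (mxrep A).
have [t Xt] : exists t, isomorphic X (L t) by apply: hL; rewrite (dimX _ _ XA).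
exists t; have [|Y [YB Yt]] := hB t A; first by exists X.
apply: mxrep_isom; apply: isom_trans (isom_sym XA) (isom_trans _ YB).
have [f fi] := isom_trans Xt (isom_sym Yt).
by exists (fmap (toRepF ab Fex Ff p) f); exact: (fmap_iso (toRepF ab Fex Ff p) fi).
Qed.

(** * Positive quivers are Dynkin *)

(* The null root of an extended diagram of type D. *)
Lemma D_weights (i j m : nat) : (0 < i)%N -> (i <= j)%N -> (j.+1 < m)%N ->
  exists W : nat -> nat, [/\ forall x, (i <= x <= j)%N -> W x = 2%N,
    forall x, x.+1 = i -> W x = 1%N, W j.+1 = 1%N, forall x, (m <= x)%N -> W x = 1%N
    & forall x, [\/ (i <= x <= j)%N, x.+1 = i, x = j.+1 | W x = 0%N \/ (m <= x)%N]].
Proof.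
move=> i0 ij jm.
exists (fun x => if (i <= x <= j)%N then 2 else
  if [|| x.+1 == i, x == j.+1 | m <= x]%N then 1 else 0)%N.
split=> [x|x e||x mx|x].
- by move=> ->.
- by rewrite e eqxx /=; case: ifP => //; lia.
- by rewrite eqxx orbT; case: ifP => //; lia.
- by rewrite mx !orbT; case: ifP => //; lia.
case: ifP => [?|_]; first exact: Or41.
case: ifP => [/or3P[/eqP ?|/eqP ?|?]|_]; [exact: Or42|exact: Or43|apply: Or44; by right|].
by apply: Or44; left.
Qed.

Section Dynkin.
Variable Q : quiver.
Local Notation V := (vertex Q).
Hypothesis pos : forall (d : V -> nat) v0, (0 < d v0)%N ->
  (\sum_a d (src a) * d (tgt a) < \sum_i d i ^ 2)%N.

Local Open Scope nat_scope.

Definition joins (x y : V) : {set arrow Q} :=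
  [set a : arrow Q | ((src a == x) && (tgt a == y)) || ((src a == y) && (tgt a == x))].
Definition adj (x y : V) := 0 < #|joins x y|.

Lemma joinsC x y : joins x y = joins y x.
Proof. by apply/setP => a; rewrite !inE orbC. Qed.
Lemma adjC x y : adj x y = adj y x.
Proof. by rewrite /adj joinsC. Qed.

(* Summing d v * (sum of the neighbours - 2 d v) over all v would give a
   nonpositive value of the Tits form at d. *)
Lemma no_subharmonic (d : V -> nat) v0 : 0 < d v0 ->
  (forall v, 0 < d v -> 2 * d v <= \sum_w #|joins v w| * d w) -> False.
Proof.
move=> d0 h; have := pos d0; rewrite ltnNge => /negP; apply.
rewrite -(leq_pmul2l (isT : 0 < 2)).
have h1 : 2 * \sum_i d i ^ 2 <= \sum_v \sum_w \sum_(a in joins v w) d v * d w.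
  rewrite big_distrr /=; apply: leq_sum => v _.
  have -> : \sum_w \sum_(a in joins v w) d v * d w = d v * \sum_w #|joins v w| * d w.
    by rewrite big_distrr /=; apply: eq_bigr => w _; rewrite sum_nat_const mulnCA.
  rewrite -mulnn mulnCA; case: (posnP (d v)) => [->//|dv].
  by rewrite leq_pmul2l ?h.
apply: leq_trans h1 _; rewrite pair_big /= (exchange_big_dep predT) //= big_distrr /=.
apply: leq_sum => a _.
rewrite (eq_bigl (fun i : V * V => a \in joins i.1 i.2)) //.
apply: (@leq_trans (\sum_(i : V * V) ((i == (src a, tgt a)) * (d i.1 * d i.2) + (i == (tgt a, src a)) * (d i.1 * d i.2)))).
  rewrite big_mkcond; apply: leq_sum => -[v w] _; rewrite inE /= !xpair_eqE.
  rewrite [src a == v]eq_sym [tgt a == w]eq_sym [src a == w]eq_sym [tgt a == v]eq_sym.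
  by do 4![case: eqP => ?] => //=; rewrite ?mul1n ?mul0n ?addn0 ?leq_addr.
rewrite big_split /= (bigD1 (src a, tgt a)) //= eqxx mul1n big1 => [|i /negPf->]; last by rewrite mul0n.
rewrite (bigD1 (tgt a, src a)) //= eqxx mul1n big1 => [|i /negPf->]; last by rewrite mul0n.
by rewrite !addn0 [d (tgt a) * _]mulnC mul2n addnn.
Qed.

(** A loop violates positivity at the indicator function of [x]. *)
Lemma no_loop x : #|joins x x| = 0.
Proof.
apply/eqP; rewrite -leqn0 leqNgt; apply/negP => /card_gt0P[a]; rewrite inE orbb => /andP[/eqP sa /eqP ta].
have := @pos (fun v => v == x) x; rewrite eqxx => /(_ isT).
rewrite [X in _ < X](bigD1 x) //= eqxx [X in _ < _ + X]big1 => [|i /negPf->] //.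
by rewrite (bigD1 a) //= sa ta eqxx.
Qed.

(** Two arrows between [x] and [y] would make the indicator of the pair subharmonic; it is the null
    root of the Kronecker quiver. *)
Lemma joins_adj x y : #|joins x y| = adj x y.
Proof.
rewrite /adj; case: (leqP #|joins x y| 1) => [|lt]; first by case: #|_| => [|[]].
have xy : x != y by apply: contraTneq lt => ->; rewrite no_loop.
case: (@no_subharmonic (fun v => (v == x) || (v == y)) x); first by rewrite eqxx.
move=> v; rewrite lt0b => /orP[]/eqP->; rewrite eqxx ?orbT muln1.
  by rewrite (bigD1 y) //= eqxx orbT muln1; apply: leq_trans lt (leq_addr _ _).
by rewrite (bigD1 x) //= eqxx muln1 joinsC; apply: leq_trans lt (leq_addr _ _).
Qed.

Lemma adj_irr x : adj x x = false.
Proof. by rewrite /adj no_loop. Qed.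

Variable x0 : V.

(** [s] traces an extended Dynkin diagram, not necessarily as a full subgraph: [l] lists some
    neighbours of a node, and any others only enlarge the sum in [no_subharmonic]. *)
Lemma weights_test (s : seq V) (W : nat -> nat) i0 : uniq s -> i0 < size s -> 0 < W i0 ->
  (forall i, i < size s -> exists l, [/\ uniq l,
     all (fun j => (j < size s) && adj (nth x0 s i) (nth x0 s j)) l
     & 2 * W i <= \sum_(j <- l) W j]) -> False.
Proof.
move=> us i0s W0 h; pose d v := (v \in s) * W (index v s).
have dE i : i < size s -> d (nth x0 s i) = W i.
  by move=> is_; rewrite /d mem_nth // index_uniq // mul1n.
apply: (@no_subharmonic d (nth x0 s i0)); first by rewrite dE.
move=> v; rewrite {1}/d; case vs: (v \in s); last by rewrite mul0n.
move=> _; have vi : index v s < size s by rewrite index_mem.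
have [l [ul al]] := h _ vi; rewrite -(dE _ vi) nth_index // => hl.
apply: leq_trans hl _.
have -> : \sum_(j <- l) W j = \sum_(w <- map (nth x0 s) l) d w.
  by rewrite big_map; apply: eq_big_seq => j /(allP al)/andP[js _]; rewrite dE.
have um : uniq (map (nth x0 s) l).
  rewrite map_inj_in_uniq // => a b /(allP al)/andP[as_ _] /(allP al)/andP[bs _] /eqP.
  by rewrite nth_uniq // => /eqP.
rewrite (big_uniq _ um) /= big_mkcond; apply: leq_sum => w _.
case: ifP => // /mapP[j /(allP al)/andP[js]]; rewrite nth_index // => aj ->.
by rewrite joins_adj aj mul1n.
Qed.

Lemma sorted_adj (p : seq V) i : sorted adj p -> i.+1 < size p -> adj (nth x0 p i) (nth x0 p i.+1).
Proof. by move=> /(sortedP x0); apply. Qed.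

(** Positions [i] to [j] close up to a cycle, an extended diagram of type A with null root
    constantly 1; the neighbours chosen for [i] and [j] wrap around. *)
Lemma no_cycle (p : seq V) i j : uniq p -> sorted adj p -> j < size p -> i.+1 < j ->
  adj (nth x0 p i) (nth x0 p j) -> False.
Proof.
move=> up sp jp ij aij; pose W x : nat := if (i <= x <= j) then 1 else 0.
have Wx y : i <= y <= j -> W y = 1 by rewrite /W => ->.
apply: (@weights_test p W i) => //; first lia.
  by rewrite Wx; lia.
move=> x xp; case ixj: (i <= x <= j); last by exists [::]; rewrite /W ixj.
have am : 0 < x -> adj (nth x0 p x) (nth x0 p x.-1).
  by move=> x1; rewrite adjC -{2}(@prednK x) ?sorted_adj //; lia.
have ap : x.+1 < size p -> adj (nth x0 p x) (nth x0 p x.+1) by apply: sorted_adj.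
exists [:: if x == i then j else x.-1; if x == j then i else x.+1].
case: (x =P i) => xi; case: (x =P j) => xj; first by lia.
- rewrite !big_cons big_nil !Wx ?unlock; try lia; rewrite /= inE ap ?xi ?aij; try lia.
  by split=> //; lia.
- rewrite !big_cons big_nil !Wx; try lia; rewrite /= inE am ?[nth x0 p x]xj; try lia.
  by rewrite xj adjC aij; split=> //; lia.
- rewrite !big_cons big_nil !Wx; try lia; rewrite /= inE am ?ap; try lia.
  by split=> //; lia.
Qed.

(** The stretch from [i - 1] to [j + 1] with [y] and [z] attached is an extended diagram of type D:
    weight 2 from [i] to [j], weight 1 at the four ends. For [i = j] it is a centre with four
    neighbours. *)
Lemma no_two_branches (p : seq V) y z i j : uniq p -> sorted adj p -> y \notin p -> z \notin p -> y != z ->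
  0 < i -> i <= j -> j.+1 < size p -> adj (nth x0 p i) y -> adj (nth x0 p j) z -> False.
Proof.
move=> up sp yp zp yz i0 ij jp ay az; pose m := size p; pose s := p ++ [:: y; z].
have us : uniq s by rewrite cat_uniq up /= !inE !negb_or yp zp yz.
have sE : size s = m.+2 by rewrite size_cat addn2.
have sp_ x : x < m -> nth x0 s x = nth x0 p x by move=> xm; rewrite nth_cat xm.
have sy : nth x0 s m = y by rewrite nth_cat ltnn subnn.
have sz : nth x0 s m.+1 = z by rewrite nth_cat ltnNge leqnSn subSnn.
have jm : j.+1 < m by [].
have ad x : x.+1 < m -> adj (nth x0 s x) (nth x0 s x.+1).
  by move=> xm; rewrite !sp_ ?sorted_adj // ltnW.
have a1 x : 0 < x < m -> adj (nth x0 s x) (nth x0 s x.-1).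
  by move=> /andP[x1 xm]; rewrite adjC -{2}(prednK x1) ad ?prednK.
have aim : adj (nth x0 s i) (nth x0 s m) by rewrite sy sp_ //; clear - ij jm; lia.
have ajm : adj (nth x0 s j) (nth x0 s m.+1) by rewrite sz sp_ //; clear - jm; lia.
have [W [W2 Wl Wr Wm W0]] := D_weights i0 ij jm.
clearbody s; clear ay az sp_ sy sz yz yp zp jp up sp.
apply: (@weights_test s W i) => //; rewrite ?sE.
- by clear - ij jm; lia.
- by rewrite W2 ?leqnn.
have tests x l : uniq l -> all (fun t => t < m.+2) l ->
    all (fun t => adj (nth x0 s x) (nth x0 s t)) l -> 2 * W x <= \sum_(t <- l) W t ->
    exists l, [/\ uniq l, all (fun t => (t < m.+2) && adj (nth x0 s x) (nth x0 s t)) l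
      & 2 * W x <= \sum_(t <- l) W t].
  by move=> ul ml al le; exists l; split=> //; rewrite all_predI ml al.
move=> x xm; case: (W0 x) => [ixj|xi|xj|[Wx0|mx]].
- have x_pos : 0 < x < m by clear - ixj i0 jm; lia.
  have xm1 : x.+1 < m by clear - ixj jm; lia.
  have Wp : 1 <= W x.-1.
    case: (ltnP i x) => ix; first by rewrite W2 //; clear - ixj ix; lia.
    by rewrite Wl //; clear - ixj ix i0; lia.
  have Wn : 1 <= W x.+1.
    case: (ltnP x j) => jx; first by rewrite W2 //; clear - ixj jx; lia.
    by have -> : x = j; [clear - ixj jx; lia | rewrite Wr].
  have Wm0 := Wm m (leqnn m); have Wm1 := Wm m.+1 (leqnSn m).
  have ax1 := a1 x x_pos; have ax2 := ad x xm1.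
  case: (x =P i) => xi; case: (x =P j) => xj.
  + apply: (tests x [:: x.-1; x.+1; m; m.+1]); rewrite ?big_cons ?big_nil ?(W2 x) //= ?inE ?ax1 ?ax2.
    * by clear - x_pos xm1; lia.
    * by clear - x_pos xm1; lia.
    * by rewrite {1}xi aim xj ajm.
    * by rewrite Wm0 Wm1; clear - Wp Wn; lia.
  + have Wn2 : W x.+1 = 2 by rewrite W2 //; clear - ixj xj; lia.
    apply: (tests x [:: x.-1; x.+1; m]); rewrite ?big_cons ?big_nil ?(W2 x) //= ?inE ?ax1 ?ax2.
    * by clear - x_pos xm1; lia.
    * by clear - x_pos xm1; lia.
    * by rewrite xi aim.
    * by rewrite Wm0 Wn2; clear - Wp; lia.
  + have Wp2 : W x.-1 = 2 by rewrite W2 //; clear - ixj xi; lia.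
    apply: (tests x [:: x.-1; x.+1; m.+1]); rewrite ?big_cons ?big_nil ?(W2 x) //= ?inE ?ax1 ?ax2.
    * by clear - x_pos xm1; lia.
    * by clear - x_pos xm1; lia.
    * by rewrite xj ajm.
    * by rewrite Wm1 Wp2; clear - Wn; lia.
  + have Wp2 : W x.-1 = 2 by rewrite W2 //; clear - ixj xi; lia.
    have Wn2 : W x.+1 = 2 by rewrite W2 //; clear - ixj xj; lia.
    apply: (tests x [:: x.-1; x.+1]); rewrite ?big_cons ?big_nil ?(W2 x) //= ?inE ?ax1 ?ax2 ?Wp2 ?Wn2 //.
    * by clear - x_pos xm1; lia.
    * by clear - x_pos xm1; lia.
- have im : i < m.+2 by clear - ij jm; lia.
  apply: (tests x [:: i]); rewrite ?big_seq1 ?(Wl _ xi) ?W2 ?leqnn //= ?im //.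
  by rewrite -xi ad // xi; clear - ij jm; lia.
- have jm' : j < m.+2 by clear - jm; lia.
  apply: (tests x [:: j]); rewrite ?xj ?big_seq1 ?Wr ?W2 ?leqnn ?ij //= ?jm' //.
  by rewrite adjC ad.
- by exists [::]; rewrite Wx0.
- have im : i < m.+2 by clear - ij jm; lia.
  have jm' : j < m.+2 by clear - jm; lia.
  have [e|e] : x = m \/ x = m.+1 by clear - xm mx; lia.
    apply: (tests x [:: i]); rewrite ?big_seq1 ?(Wm x mx) ?W2 ?leqnn //= ?im //.
    by rewrite e adjC aim.
  apply: (tests x [:: j]); rewrite ?big_seq1 ?(Wm x mx) ?W2 ?leqnn ?ij //= ?jm' //.
  by rewrite e adjC ajm.
Qed.

(* The weights in no_E6, no_E7 and no_E8 are the null roots of the extended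
   diagrams of these types. *)
Lemma no_E6 a0 a1 a2 a3 a4 y z : uniq [:: a0; a1; a2; a3; a4; y; z] ->
  adj a0 a1 -> adj a1 a2 -> adj a2 a3 -> adj a3 a4 -> adj a2 y -> adj y z -> False.
Proof.
move=> us h01 h12 h23 h34 hy hz.
apply: (weights_test (W := nth 0 [:: 1; 2; 3; 2; 1; 2; 1]) (i0 := 0) us) => // i li.
exists (nth [::] [:: [:: 1]; [:: 0; 2]; [:: 1; 3; 5]; [:: 2; 4]; [:: 3]; [:: 2; 6]; [:: 5]] i).
by do 7?[case: i li => [|i] li]; rewrite // ?unlock /=; split=> //=; do ?[apply/andP; split=> //]; rewrite // adjC.
Qed.

Lemma no_E7 a0 a1 a2 a3 a4 a5 a6 y : uniq [:: a0; a1; a2; a3; a4; a5; a6; y] ->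
  adj a0 a1 -> adj a1 a2 -> adj a2 a3 -> adj a3 a4 -> adj a4 a5 -> adj a5 a6 -> adj a3 y -> False.
Proof.
move=> us h01 h12 h23 h34 h45 h56 hy.
apply: (weights_test (W := nth 0 [:: 1; 2; 3; 4; 3; 2; 1; 2]) (i0 := 0) us) => // i li.
exists (nth [::] [:: [:: 1]; [:: 0; 2]; [:: 1; 3]; [:: 2; 4; 7]; [:: 3; 5]; [:: 4; 6]; [:: 5]; [:: 3]] i).
by do 8?[case: i li => [|i] li]; rewrite // ?unlock /=; split=> //=; do ?[apply/andP; split=> //]; rewrite // adjC.
Qed.

Lemma no_E8 a0 a1 a2 a3 a4 a5 a6 a7 y : uniq [:: a0; a1; a2; a3; a4; a5; a6; a7; y] ->
  adj a0 a1 -> adj a1 a2 -> adj a2 a3 -> adj a3 a4 -> adj a4 a5 -> adj a5 a6 -> adj a6 a7 ->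
  adj a2 y -> False.
Proof.
move=> us h01 h12 h23 h34 h45 h56 h67 hy.
apply: (weights_test (W := nth 0 [:: 2; 4; 6; 5; 4; 3; 2; 1; 3]) (i0 := 0) us) => // i li.
exists (nth [::] [:: [:: 1]; [:: 0; 2]; [:: 1; 3; 8]; [:: 2; 4]; [:: 3; 5]; [:: 4; 6]; [:: 5; 7]; [:: 6]; [:: 2]] i).
by do 9?[case: i li => [|i] li]; rewrite // ?unlock /=; split=> //=; do ?[apply/andP; split=> //]; rewrite // adjC.
Qed.

Lemma uniq_window (p t : seq V) i n : uniq p -> i + n <= size p -> uniq t ->
  {in t, forall v, v \notin p} -> uniq (map (nth x0 p) (iota i n) ++ t).
Proof.
move=> up le ut tp; rewrite cat_uniq ut andbT; apply/andP; split.
  rewrite map_inj_in_uniq ?iota_uniq // => a b; rewrite !mem_iota => la lb /eqP.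
  have a1 : a < size p by clear - la le; lia.
  have b1 : b < size p by clear - lb le; lia.
  by rewrite nth_uniq // => /eqP.
apply/hasPn => v vt; apply: contra (tp v vt) => /mapP[a].
rewrite mem_iota => la ->; have a1 : a < size p by clear - la le; lia.
exact: mem_nth.
Qed.

End Dynkin.

(** * Connected quivers with positive Tits form *)

Section Classification.
Variable Q : quiver.
Local Notation V := (vertex Q).
Hypothesis pos : forall (d : V -> nat) v0, (0 < d v0)%N ->
  (\sum_a d (src a) * d (tgt a) < \sum_i d i ^ 2)%N.
Variable x0 : V.
Local Notation adj := (@adj Q).
Hypothesis conn : forall x y, connect adj x y.

Local Open Scope nat_scope.

Lemma sorted_cons (s : seq V) y : 0 < size s -> sorted adj s -> adj y (nth x0 s 0) -> sorted adj (y :: s).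
Proof. by case: s => //= a s _ -> ->. Qed.

Lemma sorted_rcons (s : seq V) y : 0 < size s -> sorted adj s -> adj (nth x0 s (size s).-1) y ->
  sorted adj (rcons s y).
Proof. by case: s => //= a s _ ps; rewrite rcons_path ps nth_last. Qed.

Lemma boundary (A : pred V) x v : x \in A -> v \notin A ->
  exists u w, [/\ u \in A, w \notin A & adj u w].
Proof.
have /connectP[q pq ->] := conn x v; elim: q x pq => [|a q IH] x /=; first by move=> _ ->.
move=> /andP[xa pq] xA; case aA: (a \in A); first exact: IH.
by move=> _; exists x, a; rewrite xA aA.
Qed.

Lemma longest_path : exists p : seq V, [/\ uniq p, sorted adj p, 0 < size p &
  forall q : seq V, uniq q -> sorted adj q -> size q <= size p].
Proof.
have [||n [[p [up [sp <-]]] hp]] := @ex_max_nat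
  (fun n => exists p : seq V, uniq p /\ sorted adj p /\ size p = n) #|V|.
- by exists 0, [::].
- by move=> n [p [up [_ <-]]]; rewrite -(card_uniqP up) max_card.
exists p; split=> // [|q uq sq]; last by apply: hp; exists q.
by apply: hp; exists [:: x0].
Qed.

Lemma adj_path (p : seq V) i j : uniq p -> sorted adj p -> i < size p -> j < size p ->
  adj (nth x0 p i) (nth x0 p j) = (j == i.+1) || (i == j.+1).
Proof.
move=> up sp ip jp; apply/idP/orP => [aij|[]/eqP e].
- case: (ltngtP i j) => [ij|ji|e]; last by rewrite e adj_irr in aij.
    left; case: (ltnP i.+1 j) => [lt|le]; last by clear - ij le; lia.
    by case: (no_cycle pos up sp jp lt aij).
  right; rewrite adjC in aij; case: (ltnP j.+1 i) => [lt|le]; last by clear - ji le; lia.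
  by case: (no_cycle pos up sp ip lt aij).
- by rewrite e sorted_adj // -e.
- by rewrite e adjC sorted_adj // -e.
Qed.

(** The stretch of [p] from [i] to [j], prolonged by [y], is a path with adjacent ends, hence closes
    a cycle. *)
Lemma one_attachment (p : seq V) (y : V) i j : uniq p -> sorted adj p -> y \notin p ->
  i < j -> j < size p -> adj (nth x0 p i) y -> adj (nth x0 p j) y -> False.
Proof.
move=> up sp yp ij jp ai aj; pose q0 := drop i (take j.+1 p); pose q := rcons q0 y.
have sz0 : size q0 = (j - i).+1 by rewrite size_drop size_takel // subSn // ltnW.
have n0 t : t <= j - i -> nth x0 q0 t = nth x0 p (i + t).
  by move=> tj; rewrite nth_drop nth_take //; clear - tj ij; lia.
have uq : uniq q.
  rewrite rcons_uniq drop_uniq ?take_uniq // andbT.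
  by apply: contra yp => /mem_drop/mem_take.
have sq : sorted adj q.
  apply: sorted_rcons; first by rewrite sz0.
    by apply: drop_sorted; apply: take_sorted.
  by rewrite sz0 /= n0 // subnKC // ltnW.
apply: (@no_cycle Q pos x0 q 0 (j - i).+1) => //.
- by rewrite size_rcons sz0.
- by clear - ij; lia.
- by rewrite !nth_rcons sz0 ltnS leq0n ltnn eqxx n0 // addn0.
Qed.

(** The whole quiver is a star with arms of lengths [b] and [size p - b - 1] along [p], and [y] as
    an arm of length 1. *)
Definition branched (p : seq V) (y : V) b := [/\ uniq p, sorted adj p, y \notin p, b < size p &
  adj (nth x0 p b) y /\ forall v, v != y -> v \in p].

Lemma branched_rev (p : seq V) (y : V) b : branched p y b -> branched (rev p) y (size p - b.+1).
Proof.
move=> [up sp yp bp [ab cov]]; split.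
- by rewrite rev_uniq.
- by rewrite rev_sorted (eq_sorted (e' := adj)) // => u v; rewrite adjC.
- by rewrite mem_rev.
- by rewrite size_rev; clear - bp; lia.
- split=> [|v vy]; last by rewrite mem_rev cov.
  rewrite nth_rev; last by clear - bp; lia.
  by have -> : size p - (size p - b.+1).+1 = b by clear - bp; lia.
Qed.

(** Vertices are numbered by position in [rcons p y], so that [y] gets the last label, as
    [branched_edge] requires. Edges beyond the expected ones would close a cycle. *)
Lemma branched_labelling (p : seq V) (y : V) b : branched p y b ->
  exists sigma : V -> 'I_(size p).+1, bijective sigma /\ forall x z,
    #|joins x z| = branched_edge (size p).+1 b (sigma x) (sigma z)
                || branched_edge (size p).+1 b (sigma z) (sigma x) :> nat.
Proof.
move=> [up sp yp bp [ab cov]]; pose s := rcons p y.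
have ss : size s = (size p).+1 by rewrite size_rcons.
have us : uniq s by rewrite rcons_uniq yp.
have ms v : v \in s by rewrite mem_rcons inE; case: eqVneq => //= /cov.
have is_ v : index v s < (size p).+1 by rewrite -ss index_mem.
exists (fun v => Ordinal (is_ v)); split.
  exists (fun i : 'I__ => nth x0 s i) => [v|i]; first by rewrite /= nth_index.
  by apply/val_inj; rewrite /= index_uniq // ss.
have iy : index y s = size p by rewrite /s -cats1 index_cat (negPf yp) /= eqxx addn0.
have ip v : v != y -> index v s = index v p /\ index v p < size p.
  by move=> vy; rewrite /s -cats1 index_cat index_mem cov.
have yadj v : v != y -> adj v y = (index v p == b).
  move=> vy; have [_ vp] := ip v vy; rewrite -{1}(nth_index x0 (cov v vy)).
  apply/idP/eqP => [av|->//]; case: (ltngtP (index v p) b) => // lt.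
    by case: (one_attachment up sp yp lt bp av ab).
  by case: (one_attachment up sp yp lt vp ab av).
move=> x z; rewrite (joins_adj pos) /branched_edge /=; congr nat_of_bool.
case: (eqVneq x y) => [->|xy]; case: (eqVneq z y) => [->|zy].
- by rewrite (adj_irr pos) iy; clear - bp; lia.
- have [-> zp] := ip z zy; rewrite adjC yadj // iy; clear - bp zp; lia.
- have [-> xp] := ip x xy; rewrite yadj // iy; clear - bp xp; lia.
- have [-> xp] := ip x xy; have [-> zp] := ip z zy.
  rewrite -{1}(nth_index x0 (cov x xy)) -{1}(nth_index x0 (cov z zy)) adj_path //.
  clear - xp zp; lia.
Qed.

Lemma ADE_branched (p : seq V) (y : V) b T : branched p y b -> dynkin_rank T = (size p).+1 ->
  dynkin_edge T = branched_edge (size p).+1 b -> ADE Q.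
Proof.
move=> /branched_labelling[sg [bsg hsg]] rT eT; exists T.
exists (fun x => cast_ord (esym rT) (sg x)); split=> [|x z].
  apply: bij_comp bsg; exists (cast_ord rT) => i; by rewrite ?cast_ordK ?cast_ordKV.
by rewrite [LHS]hsg /dynkin_adj eT.
Qed.

(** A right arm of length 1 gives type D. A left arm of length 2 gives D5, E6, E7, E8 for paths of 4
    to 7 vertices and contains the extended E8 beyond. Two arms of length at least 3 contain the
    extended E7. Other lengths reduce to these by reversing the path. *)
Lemma branched_ADE (p : seq V) (y : V) b : branched p y b -> 0 < b -> b.+1 < size p ->
  (b.+2 = size p \/ b = 2 \/ 2 < b /\ b + 3 < size p) -> ADE Q.
Proof.
move=> br b0 bs; have [up sp yp bp [ab cov]] := br.
have win i n : i + n <= size p -> uniq (map (nth x0 p) (iota i n) ++ [:: y]).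
  by move=> le; apply: uniq_window => // v; rewrite inE => /eqP->.
have ad i : i.+1 < size p -> adj (nth x0 p i) (nth x0 p i.+1) by apply: sorted_adj.
case=> [e|[e|[b2 b3]]].
- have n3 : 3 < (size p).+1 by clear - e b0; lia.
  apply: (ADE_branched (T := DynD n3) br) => //=.
  by congr branched_edge; clear - e; lia.
- subst b; have : size p \in [:: 4; 5; 6; 7] \/ 7 < size p.
    by rewrite !inE; clear - bs; lia.
  case=> [|lt]; last first.
    have h := win 0 8 lt; suff : False by [].
    by apply: (no_E8 pos x0 h) => //; apply: ad; clear - lt; lia.
  rewrite !inE => /or4P[]/eqP e.
  + by apply: (ADE_branched (T := @DynD (size p).+1 ltac:(by rewrite e)) br) => //=; rewrite e.
  + by apply: (ADE_branched (T := DynE6) br); rewrite e.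
  + by apply: (ADE_branched (T := DynE7) br); rewrite e.
  + by apply: (ADE_branched (T := DynE8) br); rewrite e.
- have le : b - 3 + 7 <= size p by clear - b2 b3; lia.
  have h := win (b - 3) 7 le; suff : False by [].
  have eb : (b - 3).+3 = b by clear - b2; lia.
  apply: (no_E7 pos x0 h); last (by rewrite eb); apply: ad; clear - le; lia.
Qed.

Lemma path_ADE (p : seq V) : uniq p -> sorted adj p -> 0 < size p -> (forall v, v \in p) -> ADE Q.
Proof.
move=> up sp p0 cov; exists (@DynA _ p0).
have ip v : index v p < size p by rewrite index_mem.
exists (fun v => Ordinal (ip v) : 'I_(dynkin_rank (DynA p0))); split.
  exists (fun i : 'I__ => nth x0 p i) => [v|i]; first by rewrite /= nth_index.
  by apply/val_inj; rewrite /= index_uniq //; apply: (valP i).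
move=> x z; rewrite [LHS](joins_adj pos) -{1}(nth_index x0 (cov x)) -{1}(nth_index x0 (cov z)).
by rewrite adj_path.
Qed.

Theorem ADE_of_positive : ADE Q.
Proof.
have [p [up sp p0 pmax]] := longest_path.
case: (boolP [forall v, v \in p]) => [/forallP cov|]; first exact: path_ADE cov.
rewrite negb_forall => /existsP[v vp].
have x0p : nth x0 p 0 \in p by apply: mem_nth.
have [u [y [/= up' yp]]] := boundary x0p vp.
rewrite -{1}(nth_index x0 up'); set b := index u p => ab.
have bp : b < size p by rewrite /b index_mem.
(* A vertex attached to an end of a longest path would prolong it. *)
have attach z i : z \notin p -> i < size p -> adj (nth x0 p i) z -> 0 < i /\ i.+1 < size p.
  move=> zp ip az; split.
    rewrite lt0n; apply/negP => /eqP i0; rewrite i0 in az.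
    have /pmax : uniq (z :: p) by rewrite /= zp.
    rewrite /= ltnn => h; suff : false by []; apply: h.
    by apply: sorted_cons; rewrite // adjC.
  rewrite ltn_neqAle ip andbT; apply/negP => /eqP e.
  have /pmax : uniq (rcons p z) by rewrite rcons_uniq zp.
  rewrite size_rcons ltnn => h; suff : false by []; apply: h.
  by apply: sorted_rcons; rewrite // -e.
have [b0 bs] := attach y b yp bp ab.
have cov w : w != y -> w \in p.
  (* A second missed vertex yields an edge from [p] or [y] to some [z] outside both. From [p] it is
     a second branch, hence an extended D; from [y] it makes an arm of length 2, and maximality of
     [p] forces an extended E6. *)
  move=> wy; apply: contraT => wp.
  have [||u' [z [/= uA zA auz]]] := @boundary (fun t => (t \in p) || (t == y)) (nth x0 p 0) w.
  - by rewrite unfold_in x0p.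
  - by rewrite unfold_in negb_or wp.
  move: zA uA; rewrite !unfold_in negb_or => /andP[zp zy] /orP[u'p|/eqP e].
    have cp : index u' p < size p by rewrite index_mem.
    rewrite -(nth_index x0 u'p) in auz; have [c0 cs] := attach z _ zp cp auz.
    case: (leqP b (index u' p)) => [le|/ltnW le].
      by case: (no_two_branches pos up sp yp zp _ b0 le cs ab auz); rewrite eq_sym.
    by case: (no_two_branches pos up sp zp yp zy c0 le bs auz ab).
  (* The path from [z] through [y] into the right arm is no longer than [p], so the left arm has
     length at least 2; [b3] is the same with the arms exchanged. *)
  subst u'; have b2 : 1 < b.
    have /pmax : uniq (z :: y :: drop b p).
      rewrite /= inE negb_or zy drop_uniq // andbT.
      by apply/andP; split; [apply: contra zp | apply: contra yp]; apply: mem_drop.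
    have sd : 0 < size (drop b p) by rewrite size_drop subn_gt0.
    have nd : nth x0 (drop b p) 0 = nth x0 p b by rewrite nth_drop addn0.
    move=> h; have : sorted adj (z :: y :: drop b p).
      apply: sorted_cons => //; last by rewrite adjC.
      by apply: sorted_cons => //; [apply: drop_sorted | rewrite nd adjC].
    by move/h; rewrite /= size_drop; clear - bp; lia.
  have b3 : b + 2 < size p.
    have zt : z \notin take b.+1 p by apply: contra zp; apply: mem_take.
    have yt : y \notin take b.+1 p by apply: contra yp; apply: mem_take.
    have /pmax : uniq (rcons (rcons (take b.+1 p) y) z).
      by rewrite !rcons_uniq mem_rcons inE negb_or zy zt yt take_uniq.
    have st : size (take b.+1 p) = b.+1 by rewrite size_takel.
    move=> h; have : sorted adj (rcons (rcons (take b.+1 p) y) z).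
      apply: sorted_rcons; rewrite ?size_rcons ?st //=.
        by apply: sorted_rcons; rewrite ?st //= ?take_sorted ?nth_take.
      by rewrite nth_rcons st ltnn eqxx.
    by move/h; rewrite !size_rcons st; clear; lia.
  have le : b - 2 + 5 <= size p by clear - b2 b3; lia.
  have h : uniq (map (nth x0 p) (iota (b - 2) 5) ++ [:: y; z]).
    apply: uniq_window => //; first by rewrite /= inE eq_sym zy.
    by move=> t; rewrite !inE => /orP[]/eqP->.
  have ad i : i.+1 < size p -> adj (nth x0 p i) (nth x0 p i.+1) by apply: sorted_adj.
  have eb : (b - 2).+2 = b by clear - b2; lia.
  suff : False by [].
  apply: (no_E6 pos x0 h) auz; last (by rewrite eb); apply: ad; clear - le; lia.
have br : branched p y b by split.
(* The length of the right arm, which is the branching position in the reversed path. The shorter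
   arm has length 1, 2 or at least 3, and this selects the case and the orientation. *)
pose c := size p - b.+1.
have brr : branched (rev p) y c by apply: branched_rev.
have := branched_ADE br b0 bs; have := branched_ADE brr; rewrite size_rev => h2 h1.
have c0 : 0 < c by rewrite /c; clear - bs; lia.
have cs : c.+1 < size p by rewrite /c; clear - bs b0; lia.
have {}h2 := h2 c0 cs.
have [e|e] : (b.+2 = size p \/ b = 2 \/ 2 < b /\ b + 3 < size p) \/
  (c.+2 = size p \/ c = 2 \/ 2 < c /\ c + 3 < size p) by rewrite /c; clear - bs b0; lia.
  exact: h1.
exact: h2.
Qed.

End Classification.

(** * Decomposition into connected components *)

Section Components.
Variable Q : quiver.
Local Notation V := (vertex Q).

Definition component : finType := {c : V | fingraph.root (@adj Q) c == c}.

Lemma adj_arrow (a : arrow Q) : adj (src a) (tgt a).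
Proof. by apply/card_gt0P; exists a; rewrite inE !eqxx. Qed.

Lemma adj_connect_sym : connect_sym (@adj Q).
Proof. by apply: sym_connect_sym => x y; rewrite adjC. Qed.

Lemma root_arrow (a : arrow Q) : fingraph.root (@adj Q) (tgt a) = fingraph.root (@adj Q) (src a).
Proof.
by apply/esym/eqP; rewrite (root_connect adj_connect_sym); apply/connect1/adj_arrow.
Qed.

Section Component.
Variable c : component.

Definition component_vertex : finType := {x : V | fingraph.root (@adj Q) x == val c}.
Definition component_arrow : finType := {a : arrow Q | fingraph.root (@adj Q) (src a) == val c}.

Fact component_tgt_subproof (a : component_arrow) : fingraph.root (@adj Q) (tgt (sval a)) == val c.
Proof. by rewrite root_arrow; apply: (svalP a). Qed.

Definition component_quiver : quiver :=
  @Quiver component_vertex component_arrow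
    (fun a => exist _ (src (sval a)) (svalP a))
    (fun a => exist _ (tgt (sval a)) (component_tgt_subproof a)).

Lemma component_adj (x y : vertex component_quiver) : adj (val x) (val y) -> adj x y.
Proof.
case/card_gt0P => a; rewrite inE => h.
have ca : fingraph.root (@adj Q) (src a) == val c.
  case/orP: h => /andP[/eqP e1 /eqP e2]; first by rewrite e1; apply: (valP x).
  by rewrite e1; apply: (valP y).
by apply/card_gt0P; exists (exist _ a ca); rewrite inE -!val_eqE.
Qed.

Lemma component_connected (x y : vertex component_quiver) : connect (@adj component_quiver) x y.
Proof.
have : connect (@adj Q) (val x) (val y).
  by rewrite -(root_connect adj_connect_sym) (eqP (valP x)) (eqP (valP y)).
case/connectP => q; elim: q x => [|z q IH] x /=; first by move=> _ /val_inj->.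
move=> /andP[xz pq] yq; have rz : fingraph.root (@adj Q) z == val c.
  by rewrite -(eqP (valP x)) eq_sym; rewrite (root_connect adj_connect_sym) connect1.
pose z' : vertex component_quiver := exist _ z rz.
apply: connect_trans (IH z' pq yq); apply: connect1.
exact: component_adj.
Qed.

(** Extend [d] by zero to all of [Q]: the sum of squares is unchanged, and the sum over the arrows
    of the component is bounded by the sum over all arrows. *)
Lemma component_positive :
  (forall (d : V -> nat) v0, (0 < d v0)%N -> (\sum_a d (src a) * d (tgt a) < \sum_i d i ^ 2)%N) ->
  forall (d : vertex component_quiver -> nat) v0, (0 < d v0)%N ->
    (\sum_a d (src a) * d (tgt a) < \sum_i d i ^ 2)%N.
Proof.
move=> pos d v0 dv0.
pose d0 (x : V) := if insub x is Some y then d y else 0%N.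
have d0E (y : vertex component_quiver) : d0 (val y) = d y by rewrite /d0 valK.
have := @pos d0 (val v0); rewrite d0E => /(_ dv0).
have -> : (\sum_i d0 i ^ 2 = \sum_i d i ^ 2)%N.
  rewrite (bigID (fun x => fingraph.root (@adj Q) x == val c)) /= addnC big1 ?add0n => [|i ni].
    rewrite (reindex_omap (fun y : vertex component_quiver => val y) insub) /=.
      apply: eq_big => [y|y _]; last by rewrite d0E.
      by rewrite valK eqxx andbT (valP y).
    by move=> i hi; rewrite insubT.
  by rewrite /d0 insubN.
apply: leq_ltn_trans.
rewrite [X in (_ <= X)%N](bigID (fun a => fingraph.root (@adj Q) (src a) == val c)) /=.
apply: leq_trans (leq_addr _ _).
rewrite [X in (_ <= X)%N](reindex_omap (fun a : arrow component_quiver => val a) insub) /=.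
  rewrite [X in (_ <= X)%N](eq_bigl predT) => [|a]; last by rewrite valK eqxx andbT (valP a).
  by apply: leq_sum => a _; rewrite -!d0E.
by move=> i hi; rewrite insubT.
Qed.

Lemma component_base : vertex component_quiver.
Proof. by exists (val c); apply: (valP c). Qed.

End Component.

Definition split_quiver : quiver := quiver_sum component_quiver.
Definition split_vertex (x : vertex split_quiver) : V := sval (tagged x).
Definition split_arrow (a : arrow split_quiver) : arrow Q := sval (tagged a).

Lemma split_vertex_inj : injective split_vertex.
Proof.
move=> [c [x hx]] [c' [x' hx']]; rewrite /split_vertex /= => e; subst x'.
have ec : c = c' by apply/val_inj; rewrite -(eqP hx) -(eqP hx').
by subst c'; rewrite (eq_irrelevance hx hx').
Qed.

Lemma root_component (x : V) : fingraph.root (@adj Q) (fingraph.root (@adj Q) x) == fingraph.root (@adj Q) x.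
Proof. exact: (roots_root adj_connect_sym). Qed.

Definition component_of (x : V) : component :=
  @exist V (fun c => fingraph.root (@adj Q) c == c) _ (root_component x).

Lemma split_vertex_surj x : exists y, split_vertex y = x.
Proof.
pose y : component_vertex (component_of x) :=
  @exist V (fun z => fingraph.root (@adj Q) z == fingraph.root (@adj Q) x) x (eqxx _).
by exists (Tagged (fun c => vertex (component_quiver c)) y).
Qed.

Lemma split_arrow_bij : bijective split_arrow.
Proof.
pose g (a : arrow Q) : component_arrow (component_of (src a)) :=
  @exist (arrow Q) (fun b => fingraph.root (@adj Q) (src b) == fingraph.root (@adj Q) (src a)) a (eqxx _).
exists (fun a => Tagged (fun c => arrow (component_quiver c)) (g a)) => //.
move=> [c0 [a ha]]; rewrite /split_arrow /=.
have e : c0 = component_of (src a) by apply/val_inj; rewrite /= (eqP ha).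
subst c0; congr (Tagged _ _); rewrite /g; congr exist; exact: eq_irrelevance.
Qed.

(** The goal asks for a literal [quiver_sum]. Reindexing the presentation along the bijections of
    vertices and arrows, before the functor is built, avoids comparing [Rep] of two isomorphic
    quivers. *)
Lemma split_presentation (k : fieldType) (C : kCat k) (F : kFunctor C (Vec k)) :
  presentation F Q -> presentation F split_quiver.
Proof.
move=> p; apply: (@Presentation k C F split_quiver (fun i => pP p (split_vertex i))
  (fun i => pS p (split_vertex i)) (fun i => pt p (split_vertex i))
  (fun i => pt_local p (split_vertex i)) _ (fun i => pS_dim p (split_vertex i)) _ _
  (fun i => pK p (split_vertex i)) (fun i => pk p (split_vertex i))
  (fun i => pk_ker p (split_vertex i))
  (fun i a => pin p (split_vertex i) (split_arrow a))
  (fun i a => ppr p (split_vertex i) (split_arrow a))).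
- by move=> i; apply: pP_proj.
- move=> X /(pS_surj p)[i Xi]; have [y yi] := split_vertex_surj i.
  by exists y; rewrite yi.
- by move=> i j /pS_inj/split_vertex_inj.
move=> i; have [h1 h2 h3] := pK_sum p (split_vertex i).
have sE (a : arrow split_quiver) : (src a == i) = (src (split_arrow a) == split_vertex i).
  by rewrite -(inj_eq split_vertex_inj).
split=> [a|a b|].
- by rewrite sE; apply: h1.
- by rewrite !sE -(inj_eq (bij_inj split_arrow_bij)); apply: h2.
- rewrite -h3 [RHS](reindex split_arrow) /=; last exact: onW_bij split_arrow_bij.
  by apply: eq_bigl => a; rewrite sE.
Qed.

End Components.

Theorem corollary4p2 (k : closedFieldType) (C : kCat k) (M : monoidal C)
  (C_abelian : abelian C)
  (C_hereditary : hereditary C)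
  (M_pointed : pointed M)
  (C_finite : finite_category C)
  (C_finite_type : finite_type C)
  (M_fiber : exists F : kFunctor C (Vec k), fiber_functor M F) :
  exists (I : finType) (Q : I -> quiver),
    (forall i, ADE (Q i)) /\
    exists N : monoidal (Rep k (quiver_sum Q)),
      fiber_functor N (forgetful k (quiver_sum Q)) /\
      monoidally_equivalent M N.
Proof.
have [F fF] := M_fiber; have [sF Fex Ff] := fF.
have [Q0 [p0]] := presentation_exists C_abelian Fex Ff C_finite_type C_hereditary
  (fun S sS => simple_one_dim C_abelian Fex Ff sF M_pointed C_finite_type sS).
exists (component Q0), (@component_quiver Q0); split=> [c|].
  apply: (ADE_of_positive _ (component_base c) (@component_connected _ c)).
  apply: component_positive => d v0.
  exact: weakly_positive C_abelian Fex Ff C_finite_type p0.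
have p := split_presentation p0.
apply: (transport_fiber_functor (E := toRepF C_abelian Fex Ff p) (F := F)
  (sg := forget_iso C_abelian Fex Ff p)) => //.
- by move=> X Y f g; apply: toRep_faithful.
- by move=> X Y f; apply: toRep_full.
- by move=> Y; apply: toRep_ess_surj.
- by move=> X; apply: forget_iso_is_iso.
- by move=> X Y f; apply: forget_iso_nat.
Qed.
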